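(* Let $\alpha:\mathbb{R}\to(0,1)$ with $\alpha^*=\min_{x\in\mathbb{R}}\alpha(x)>0$ and $\max_{x\in\mathbb{R}}\alpha(x)<1$, and let $A_0=\{x\in\mathbb{R}:\alpha(x)=\alpha^*\}=\bigcup_iI_i$ be bounded, where the $I_i$ are disjoint intervals. Suppose $\ell(A_0)\in(0,\infty)$, $\ell(\partial A_0)=0$, and that $A_0=A_\beta$ for all small $\beta>0$, where $A_\beta=\{x\in\mathbb{R}:\alpha(x)<\alpha^*+\beta\}$. Finally suppose the limits $\alpha_I=\lim_{x\to\infty}\alpha(x)<1$ and $\alpha_J=\lim_{x\to-\infty}\alpha(x)<1$ exist. If $2\alpha^*<\min\{\alpha_I,\alpha_J\}$, then the process $X$ of the context satisfies $$\lim_{t\to\infty}P\big(X(t)\in A_0\big)=1.$$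
   Context: $\ell$ is Lebesgue measure on $\mathbb{R}$; $\alpha$ is Borel measurable. $B$ is a standard one-dimensional Brownian motion started at $0$. $\sigma$ is a right-continuous strictly increasing pure-jump process with $\sigma(0)=0$ which, conditionally on the path of $B$, has independent increments with $$\mathbb{E}\big[e^{-\lambda\sigma(y)}\mid B(w),w\le y\big]=e^{-\int_0^y\lambda^{\alpha(B_w)}dw},$$ i.e. its jump intensity at time $w$ is $\nu(ds,B_w)\,dw$ with $\nu(ds,x)=\frac{\alpha(x)s^{-\alpha(x)-1}}{\Gamma(1-\alpha(x))}ds$. $L(t)=\inf\{s\ge0:\sigma(s)>t\}$ and $X(t)=B(L(t))$. *)

(* Defs.v *)
From HB Require Import structures.
From mathcomp Require Import all_boot all_order all_algebra.
From mathcomp Require Import all_classical all_reals all_analysis.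
From mathcomp Require Import measurable_realfun.
Import Order.TTheory GRing.Theory Num.Theory.
Import numFieldNormedType.Exports.

Set Implicit Arguments.
Unset Strict Implicit.
Unset Printing Implicit Defensive.

Local Open Scope classical_set_scope.
Local Open Scope ring_scope.

(** Processes are functions [R -> Omega -> R], of which only the values at
    times [t >= 0] are meaningful.  Path properties are required for every
    [w : Omega], which makes events such as [{X(t) \in A0}] measurable without
    any completeness assumption on [P]. *)

Section gamma_and_intensity.
Context {R : realType}.

Definition Gamma (z : R) : R :=
  \int[lebesgue_measure]_(s in `]0, +oo[) (s `^ (z - 1) * expR (- s)).

(* nu(ds, x) in terms of a = alpha(x) *)
Definition stable_intensity (a : R) (E : set R) : \bar R :=
  (\int[lebesgue_measure]_(s in E `&` `]0%R, +oo[)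
     (a * s `^ (- a - 1) / Gamma (1 - a))%:E)%E.

Definition jump (f : R -> R) (s : R) : R := f s - lim (f r @[r --> s^'-]).

Definition boundary (A : set R) : set R := closure A `\` interior A.

Definition is_min_of (f : R -> R) (m : R) : Prop :=
  (exists x, f x = m) /\ (forall x, m <= f x).

Definition is_max_of (f : R -> R) (m : R) : Prop :=
  (exists x, f x = m) /\ (forall x, f x <= m).

End gamma_and_intensity.

Section processes.
Context {d : measure_display} {Omega : measurableType d} {R : realType}.
Variable P : probability Omega R.

Definition increment (Z : R -> Omega -> R) (t : nat -> R) (i : nat)
    (w : Omega) : R :=
  Z (t i.+1) w - Z (t i) w.

Definition time_grid (t : nat -> R) : Prop :=
  0 <= t 0%N /\ forall i, t i <= t i.+1.

Definition independent_increments (Z : R -> Omega -> R) : Prop :=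
  forall (t : nat -> R) (n : nat) (E : nat -> set R),
    time_grid t -> (forall i, measurable (E i)) ->
    P [set w | forall i, (i < n)%N -> E i (increment Z t i w)] =
    (\prod_(i < n) fine (P (increment Z t i @^-1` E i)))%:E.

Record is_brownian_motion (B : R -> Omega -> R) : Prop := {
  bm_measurable : forall t : R, 0 <= t -> measurable_fun setT (B t) ;
  bm_start : forall w, B 0 w = 0 ;
  bm_continuous : forall w, {within `[0, +oo[, continuous (B ^~ w)} ;
  bm_independent_increments : independent_increments B ;
  bm_gaussian : forall s t : R, 0 <= s -> s < t ->
    forall E : set R, measurable E ->
      P [set w | E (B t w - B s w)] = normal_prob 0 (Num.sqrt (t - s)) E
}.

(* The sets generating the sigma-algebra sigma(B(u), u <= T); T = +oo gives
   the sigma-algebra of the whole path. *)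
Definition past (B : R -> Omega -> R) (T : \bar R) : set (set Omega) :=
  [set A | exists u : R, [/\ 0 <= u, (u%:E <= T)%E &
    preimage_set_system setT (B u) measurable A]].

(* Y is a version of the conditional expectation, given the sigma-algebra
   generated by G, of the [0, +oo]-valued random variable Z. *)
Definition is_cond_expectation (G : set (set Omega)) (Z Y : Omega -> \bar R) :
    Prop :=
  [/\ measurable_fun setT (Y : g_sigma_algebraType G -> \bar R),
      (forall w, 0 <= Y w)%E &
      forall A, <<s G >> A ->
        (\int[P]_(w in A) Y w = \int[P]_(w in A) Z w)%E].

Definition is_cond_probability (G : set (set Omega)) (A : set Omega)
    (Y : Omega -> R) : Prop :=
  is_cond_expectation G (fun w => (\1_A w)%:E) (fun w => (Y w)%:E).

(* Conditional probabilities exist and are almost surely unique, so that it is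
   equivalent to ask for one choice of versions or for all choices. *)
Definition cond_independent_increments (G : set (set Omega))
    (Z : R -> Omega -> R) : Prop :=
  forall (t : nat -> R) (n : nat) (E : nat -> set R),
    time_grid t -> (forall i, measurable (E i)) ->
    exists Y : nat -> Omega -> R,
      (forall i, is_cond_probability G (increment Z t i @^-1` E i) (Y i)) /\
      is_cond_probability G
        [set w | forall i, (i < n)%N -> E i (increment Z t i w)]
        (fun w => \prod_(i < n) Y i w).

(* In [sg_laplace] the choice T = y gives conditioning on B(w), w <= y, and
   T = +oo gives conditioning on the whole path of B. *)
Record is_variable_order_subordinator (alpha : R -> R) (B sigma : R -> Omega -> R)
    : Prop := {
  sg_measurable : forall y : R, 0 <= y -> measurable_fun setT (sigma y) ;
  sg_start : forall w, sigma 0 w = 0 ;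
  sg_right_continuous : forall (w : Omega) (y : R), 0 <= y ->
    sigma s w @[s --> y^'+] --> sigma y w ;
  sg_increasing : forall (w : Omega) (s y : R), 0 <= s -> s < y -> sigma s w < sigma y w ;
  sg_pure_jump : forall (w : Omega) (y : R), 0 <= y ->
    (sigma y w)%:E = (\esum_(s in `]0%R, y]) (jump (sigma ^~ w) s)%:E)%E ;
  sg_cond_independent_increments :
    cond_independent_increments (past B +oo%E) sigma ;
  sg_laplace : forall (lambda y : R) (T : \bar R),
    0 < lambda -> 0 <= y -> (y%:E <= T)%E ->
    is_cond_expectation (past B T)
      (fun w => (expR (- (lambda * sigma y w)))%:E)
      (fun w => (expR (- \int[lebesgue_measure]_(u in `[0, y])
                           (lambda `^ alpha (B u w))))%:E) ;
  (* expected number, given B, of jumps of size in E during ]a, b] *)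
  sg_intensity : forall (a b : R) (E : set R),
    0 <= a -> a <= b -> measurable E -> E `<=` `]0, +oo[ ->
    is_cond_expectation (past B +oo%E)
      (fun w => counting
        [set s : R | s \in `]a, b] /\ E (jump (sigma ^~ w) s)])
      (fun w => (\int[lebesgue_measure]_(u in `]a, b])
        stable_intensity (alpha (B u w)) E)%E)
}.

(* [inf] of the empty set is 0; the set below is empty only if sigma is
   bounded by t. *)
Definition first_passage (sigma : R -> Omega -> R) (t : R) (w : Omega) : R :=
  inf [set s | 0 <= s /\ t < sigma s w].

Definition time_changed (B sigma : R -> Omega -> R) (t : R) (w : Omega) : R :=
  B (first_passage sigma t w) w.

End processes.

(* Main.v *)
Require Import Defs.
From HB Require Import structures.
From mathcomp Require Import all_boot all_order all_algebra.
From mathcomp Require Import all_classical all_reals all_analysis.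
From mathcomp Require Import measurable_realfun.
From mathcomp Require Import ring lra.
Import Order.TTheory GRing.Theory Num.Theory.
Import numFieldNormedType.Exports.
Local Open Scope classical_set_scope.
Local Open Scope ring_scope.

Set Implicit Arguments.
Unset Strict Implicit.
Unset Printing Implicit Defensive.

(** Write [a = alpha_min], [Phi_y(l)] for the integral of [l ^ alpha(B_u)] over
    [0 <= u <= y], so that [E(e^(-l sigma(y)) | B) = e^(-Phi_y(l))], and, for an
    open set [O], let [J_O(l)] be the expectation of the integral over [y >= 0]
    of [1_O(B_y) l^alpha(B_y) e^(-Phi_y(l))].  Then [J_O(l)] is [l] times the
    Laplace transform at [l] of [t |-> P(X(t) \in O)], and also of
    [r(t) = E int 1_O(B_y) nu(]t - sigma(y), +oo[, B_y) dy].  A Palm formula for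
    the jumps of [sigma] shows that [t^n r(t)] is nondecreasing as soon as
    [alpha_max <= n (1 - alpha_max)]; together with the semicontinuity of
    [P(X(t) \in O)] this Tauberian condition gives
    [P(X(t) \in O) <= 2^n e^3 J_O(1/t)].

    Let [O] be a small neighbourhood of the complement of [A0], so that
    [O `&` A0] has small measure since [boundary A0] is null, and cut [J_O(l)] at
    the time [T = (k / l^a)^2].  As [B_y] has density at most
    [(2 pi y)^(-1/2)], the part before [T] is at most a multiple of
    [k |O `&` A0|] plus positive powers of [l]: [alpha] exceeds [a] by a gap off
    [A0], and [2 a] far away, where only the bound [T] on the time is available.
    The part after [T] is at most [E e^(-Phi_T(l))].  Expanding
    [1 - e^(-Phi_s)] over the past of [s] bounds the expected time spent by [B]
    in [A0] before [T] by
    [(l^(-a) + |A0| int_0^T (2 pi s)^(-1/2) ds) (1 - E e^(-Phi_T))]; this time is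
    itself asymptotic to [|A0| int_0^T (2 pi s)^(-1/2) ds], which forces
    [E e^(-Phi_T)] to be small when [k] is large and [l] small. *)

(** A bound on [J_O(l)] as [l] tends to 0 controls only averages of [P(X(t) \in O)] over [t]; a
    bound at every [t] needs regularity in time, and no monotonicity of this probability is at hand.
    The function [r] arises from the compensation formula for the jump of [sigma] across level [t]:
    it contains the stable tail, which is homogeneous, so that a scaling argument can start there.
    The Palm formula that drives it is the identity [E(e^(-l sigma(y)) | B) = e^(-Phi_y(l))]
    differentiated in [l]; weighted measures are then identified by their Laplace transforms at
    integers.

    The scale of [T] comes from a balance: the mean time in [A0] before [T] is of order [sqrt T],
    and a time of order [l^(-a)] in [A0] brings [Phi] to size 1. Far away from the origin, where
    [alpha >= b], the path may spend all of [T]; this costs [l^b T = k^2 l^(b - 2 a)], which is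
    small because the hypothesis on the limits at infinity leaves room for some [b > 2 a]. *)

Section image_density.
Import HBNNSimple.
Local Open Scope ereal_scope.
Context d d' (X : measurableType d) (Y : measurableType d') (R : realType).

(** [nu] is the image under [phi] of the measure with density [p] with respect to [mu]. Only the
    integration formula is exported: equalities between integrals of all kernels then follow from
    the equality of two such measures on a generating class. *)
Lemma image_density (mu : {measure set X -> \bar R}) (phi : X -> Y)
    (p : X -> R) :
  measurable_fun setT phi -> measurable_fun setT p -> (forall x, 0 <= p x)%R ->
  exists nu : {measure set Y -> \bar R},
    forall g : Y -> \bar R, measurable_fun setT g -> (forall y, 0 <= g y) ->
      \int[nu]_y g y = \int[mu]_x (g (phi x) * (p x)%:E).
Proof.
move=> mphi mp p0.
pose m (A : set Y) := \int[mu]_(x in phi @^-1` A) (p x)%:E.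
have mpE : measurable_fun setT (EFin \o p) by exact/measurable_EFinP.
have m0 : m set0 = 0 by rewrite /m preimage_set0 integral_set0.
have mge0 A : 0 <= m A by apply: integral_ge0 => x _; rewrite lee_fin.
have mpre A : measurable A -> measurable (phi @^-1` A).
  by move=> mA; rewrite -[X in measurable X]setTI; exact: mphi.
have madd : semi_sigma_additive m.
  move=> A mA tA mUA; rewrite /m preimage_bigcup ge0_integral_bigcup//.
  - by apply: is_cvg_ereal_nneg_natsum_cond => n _ _; exact: mge0.
  - by move=> k; exact: mpre.
  - exact: measurable_funTS.
  - by move=> x _; rewrite lee_fin.
  - move=> i j _ _ [x [/= Ai Aj]]; apply: (tA i j) => //.
    by exists (phi x).
pose mix := isMeasure.Build _ _ _ m m0 mge0 madd.
pose nu : {measure set Y -> \bar R} := HB.pack m mix.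
exists nu => g mg g0.
have mgp : measurable_fun setT (fun x => g (phi x)) by exact: measurableT_comp.
pose g_ := nnsfun_approx measurableT mg.
have cg y : (g_ n y)%:E @[n --> \oo] --> g y.
  by apply: cvg_nnsfun_approx => //; rewrite inE.
(* The formula for simple functions; monotone convergence extends it to [g]. *)
have step (h : {nnsfun Y >-> R}) :
    \int[nu]_y (h y)%:E = \int[mu]_x ((h (phi x))%:E * (p x)%:E).
  under eq_integral do rewrite fimfunE -fsumEFin//.
  rewrite ge0_integral_fsum//; last 2 first.
  - by move=> y; exact/measurable_EFinP/measurable_funM.
  - by move=> y x _; rewrite nnfun_muleindic_ge0.
  under [RHS]eq_integral => x _.
    rewrite fimfunE -fsumEFin// muleC ge0_mule_fsumr//; last first.
      by move=> y; rewrite nnfun_muleindic_ge0.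
    over.
  rewrite ge0_integral_fsum//; last 2 first.
  - move=> y; apply: emeasurable_funM => //; apply/measurable_EFinP.
    apply: measurable_funM => //.
    exact: (measurableT_comp (measurable_indic (measurable_sfunP h (measurable_set1 y))) mphi).
  - by move=> y x _; rewrite EFinM; apply: mule_ge0; [rewrite lee_fin|exact: nnfun_muleindic_ge0].
  apply: eq_fsbigr => r _.
  have [r0|r0] := leP 0%R r; last first.
    rewrite preimage_nnfun0//.
    by rewrite !integral0_eq// => x _; rewrite indicE in_set0 mulr0 ?mule0.
  rewrite integralZl_indic_nnsfun// integral_indic// setIT /= /m.
  rewrite [in LHS]integral_mkcond -ge0_integralZl//; last 2 first.
  - apply/(measurable_restrictT _ _).1; first exact: mpre.
    exact: measurable_funTS.
  - by move=> x _; apply: erestrict_ge0 => t _; rewrite lee_fin.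
  apply: eq_integral => x _.
  rewrite EFinM muleCA; congr (_ * _).
  rewrite patchE indicE /=.
  have -> : (phi x \in h @^-1` [set r]) = (x \in phi @^-1` (h @^-1` [set r])).
    by apply/idP/idP; rewrite !inE.
  by case: ifP; rewrite ?mule1 ?mule0.
transitivity (limn (fun n => \int[nu]_y (g_ n y)%:E)).
  rewrite -monotone_convergence//.
  - by apply: eq_integral => y _; apply/esym/cvg_lim.
  - by move=> n; exact/measurable_EFinP.
  - by move=> n y _; rewrite lee_fin.
  - by move=> y _ k n kn; rewrite lee_fin; exact/lefP/nd_nnsfun_approx.
transitivity (limn (fun n => \int[mu]_x ((g_ n (phi x))%:E * (p x)%:E))).
  by congr (limn _); apply/funext => n; exact: step.
rewrite -monotone_convergence//.
- apply: eq_integral => x _; apply/cvg_lim => //.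
  by apply: cvgeZr => //; exact: cg.
- move=> n; apply: emeasurable_funM => //; apply/measurable_EFinP.
  exact: (measurableT_comp (measurable_funPT (g_ n)) mphi).
- by move=> n x _; apply: mule_ge0; rewrite lee_fin.
- move=> x _ k n kn; apply: lee_wpmul2r; first by rewrite lee_fin.
  by rewrite lee_fin; exact/lefP/nd_nnsfun_approx.
Qed.

End image_density.

(** * Laplace transforms determine finite measures *)

Lemma bernoulli_inequality (R : realFieldType) (u : R) (n : nat) :
  0 <= u <= 1 -> 1 - n%:R * u <= (1 - u) ^+ n.
Proof.
move=> /andP[u0 u1]; elim: n => [|n IH]; first by rewrite mul0r subr0 expr0.
rewrite exprS.
have h1 : (1 - u) * (1 - n%:R * u) <= (1 - u) * (1 - u) ^+ n.
  by rewrite ler_wpM2l// subr_ge0.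
apply: le_trans h1; rewrite -natr1.
have : 0 <= n%:R * u * u by rewrite !mulr_ge0.
lra.
Qed.

Section ray_threshold.
Context {R : realType}.
Implicit Types y s : R.

(** The cut at 0 keeps the value in [[0, 1]] for every [s], so that its powers are bounded test
    functions on all of [R]; the measures tested with it put no mass on the negative half-line. *)
Definition expN_pos s : R := expR (- Num.max s 0).

Definition ray_exponent y (m : nat) : nat :=
  (Num.truncn (m%:R * expR (m%:R * y))).+1.

Lemma expN_pos_itv s : 0 <= expN_pos s <= 1.
Proof.
by rewrite /expN_pos expR_ge0 expR_le1 oppr_le0 le_max lexx orbT.
Qed.

Lemma expN_pos_powE s m : expN_pos s ^+ m = expR (- (m%:R * Num.max s 0)).
Proof. by rewrite /expN_pos -expRM_natl mulrN. Qed.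

Lemma expN_pos_pow_itv s m : 0 <= expN_pos s ^+ m <= 1.
Proof.
have /andP[h0 h1] := expN_pos_itv s.
by rewrite exprn_ge0// exprn_ile1.
Qed.

(* [(1 - e^(-ms))^N] is a polynomial in [e^(-s)]; its threshold is at
   [N ~ e^(ms)], and the extra factor [m] in [N] sends the value at the
   threshold itself to 0. *)
Lemma cvg_ray_threshold y s : 0 <= y ->
  (1 - expN_pos s ^+ m) ^+ ray_exponent y m @[m --> \oo] -->
  (\1_(`]y, +oo[) s : R).
Proof.
move=> y0; set r := Num.max s 0.
have r0 : 0 <= r by rewrite le_max lexx orbT.
have pos m : 0 <= (1 - expN_pos s ^+ m) ^+ ray_exponent y m.
  by have /andP[h0 h1] := expN_pos_pow_itv s m; rewrite exprn_ge0// subr_ge0.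
have [sy|ys] := leP s y.
  have -> : (\1_(`]y, +oo[) s : R) = 0.
    by rewrite indicE memNset//= in_itv/= andbT; apply/negP; rewrite -leNgt.
  have ry : r <= y by rewrite /r ge_max sy y0.
  apply: (@squeeze_cvgr _ _ _ _ (fun=> 0) (fun m : nat => expR (- m%:R))); last 2 first.
    exact: cvg_cst.
    exact: cvgn_expR.
  (* With [N = ray_exponent y m], below the threshold [N u >= m exp(m (y - r)) >= m], whence
     [(1 - u)^N <= exp(- N u) <= exp(- m)]. *)
  near=> m; rewrite pos/=.
  set u := expN_pos s ^+ m.
  have /andP[u0 u1] := expN_pos_pow_itv s m.
  have h1 : 1 - u <= expR (- u) by have := expR_ge1Dx (- u); lra.
  have : (1 - u) ^+ ray_exponent y m <= expR (- u) ^+ ray_exponent y m.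
    by apply: lerXn2r => //; rewrite ?nnegrE ?expR_ge0 ?subr_ge0.
  move/le_trans; apply.
  rewrite -expRM_natl ler_expR mulrN lerN2 /u expN_pos_powE -/r.
  have hN : m%:R * expR (m%:R * y) <= (ray_exponent y m)%:R.
    by rewrite /ray_exponent ltW// truncnS_gt.
  apply: le_trans (ler_wpM2r (expR_ge0 _) hN).
  rewrite -mulrA -expRD ler_peMr// -expR0 ler_expR.
  by rewrite -mulrBr mulr_ge0// subr_ge0.
have -> : (\1_(`]y, +oo[) s : R) = 1.
  by rewrite indicE mem_set//= in_itv/= andbT.
have ry : y < r by rewrite /r lt_max ys.
have d0 : 0 < r - y by rewrite subr_gt0.
set e := r - y in d0.
(* Above the threshold Bernoulli gives [(1 - u)^N >= 1 - N u] with [N u <= (m + 1) exp(- m e)], and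
   [exp(m e) >= 1 + (m e)^2 / 2] bounds this by [4 / (e^2 m)]. *)
apply: (@squeeze_cvgr _ _ _ _ (fun m : nat => 1 - (4 / e ^+ 2) * m%:R^-1) (fun=> 1)); last 2 first.
- rewrite -[X in _ --> X]subr0; apply: cvgB; first exact: cvg_cst.
  rewrite -(mulr0 (4 / e ^+ 2)); apply: cvgM; first exact: cvg_cst.
  by rewrite -cvg_shiftS; exact: cvg_harmonic.
- exact: cvg_cst.
near=> m.
have m1 : (0 < m)%N by near: m; exists 1%N.
set u := expN_pos s ^+ m.
have /andP[u0 u1] := expN_pos_pow_itv s m.
apply/andP; split; last first.
  by rewrite exprn_ile1// ?subr_ge0// lerBlDr lerDl.
apply: le_trans (bernoulli_inequality _ (expN_pos_pow_itv s m)).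
rewrite lerD2l lerN2.
have mR : 0 < m%:R :> R by rewrite ltr0n.
have hN : (ray_exponent y m)%:R <= (m%:R + 1) * expR (m%:R * y).
  rewrite /ray_exponent -natr1 mulrDl mul1r lerD//.
    by rewrite truncn_le mulr_ge0// expR_ge0.
  by rewrite -expR0 ler_expR mulr_ge0.
apply: (le_trans (ler_wpM2r u0 hN)).
rewrite [X in _ * X]expN_pos_powE -/r. rewrite -[leLHS]mulrA -expRD.
have -> : m%:R * y + - (m%:R * r) = - (m%:R * e) by rewrite /e; ring.
have h2 : 1 + (m%:R * e) ^+ 2 / 2 <= expR (m%:R * e).
  by have := @expR_ge1Dxn R (m%:R * e) 1; apply; rewrite mulr_ge0// ltW.
rewrite expRN -ler_pdivlMr ?invr_gt0 ?expR_gt0// invrK.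
apply: le_trans (ler_wpM2l _ h2); last first.
  by rewrite mulr_ge0// ?invr_ge0// ?divr_ge0// ?exprn_ge0// ltW.
have m1R : 1 <= m%:R :> R by rewrite ler1n.
have e20 : 0 < e ^+ 2 by rewrite exprn_gt0.
have -> : 4 / e ^+ 2 * m%:R^-1 * (1 + (m%:R * e) ^+ 2 / 2) =
   4 / e ^+ 2 * m%:R^-1 + 2 * m%:R.
  by field; rewrite ?gt_eqF.
have : 0 <= 4 / e ^+ 2 * m%:R^-1 by rewrite !mulr_ge0// ?invr_ge0// ltW.
lra.
Unshelve. all: by end_near. Qed.

Lemma measurable_expN_pos : measurable_fun setT expN_pos.
Proof.
apply: measurableT_comp => //; apply: measurableT_comp => //.
exact: measurable_maxr.
Qed.

End ray_threshold.

Section finite_measures_on_halflines.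
Local Open Scope ereal_scope.
Context d (T : measurableType d) (R : realType).

(** For fixed [D], the sets [E] such that [D x E] belongs to the generated sigma-algebra form a
    sigma-algebra containing the rays, hence all Borel sets. Complements are taken inside [D x R], a
    countable union of the generating products. *)
Lemma prod_rays_measurableE :
  @measurable _ (T * R)%type =
  <<s [set A | exists D (y : R), measurable D /\ A = D `*` `]y, +oo[%classic] >>.
Proof.
set G := (X in <<s X >>).
have GT (D : set T) : measurable D -> <<s G >> (D `*` setT).
  move=> mD.
  have -> : D `*` [set: R] = \bigcup_n (D `*` `](- (n%:R : R))%R, +oo[%classic).
    apply/seteqP; split => [[t s] /= [Dt _]|[t s] /= [n _ [Dt _]]//].
    exists (Num.truncn (- s)).+1 => //=; split => //.
    by rewrite in_itv/= andbT ltrNl truncnS_gt.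
  apply: sigma_algebra_bigcup => n; apply: sub_sigma_algebra.
  by exists D, (- n%:R)%R.
rewrite measurable_prod_measurableType; apply/seteqP; split; last first.
  apply: smallest_sub; first exact: smallest_sigma_algebra.
  move=> _ [D [y [mD ->]]]; apply: sub_sigma_algebra.
  by exists D => //; exists `]y, +oo[%classic => //; exact: measurable_itv.
apply: smallest_sub; first exact: smallest_sigma_algebra.
move=> _ [D mD [E mE <-]].
have : E \in [set E | <<s G >> (D `*` E)].
  rewrite inE; move: E mE.
  change (@measurable _ R `<=` [set E | <<s G >> (D `*` E)]).
  have -> : @measurable _ R = (@RGenOInfty.G R).-sigma.-measurable.
    exact: RGenOInfty.measurableE.
  apply: smallest_sub.
    split => /=.
    - by rewrite setX0; exact: sigma_algebra0.
    - move=> E hE; rewrite setTD.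
      have -> : D `*` ~` E = (D `*` [set: R]) `\` (D `*` E).
        apply/seteqP; split => [[t s] /= [Dt nE]|[t s] /= [[Dt _] h]].
          by split => // -[].
        by split => // Es; apply: h.
      rewrite setDE.
      exact: (@measurableI _ (g_sigma_algebraType G) _ _ (GT _ mD)
                (@measurableC _ (g_sigma_algebraType G) _ hE)).
    - move=> F hF; rewrite setX_bigcupr.
      exact: sigma_algebra_bigcup.
  move=> _ [y ->]; apply: sub_sigma_algebra.
  by exists D, y.
by rewrite inE.
Qed.

(** The products [D x ]y, +oo[] are stable under intersection, generate the product sigma-algebra,
    and exhaust the space as [y] goes to minus infinity. *)
Lemma finite_measure_eq_rays (m1 m2 : {measure set (T * R) -> \bar R}) :
  m1 setT < +oo ->
  (forall D (y : R), measurable D ->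
    m1 (D `*` `]y, +oo[%classic) = m2 (D `*` `]y, +oo[%classic)) ->
  forall A, measurable A -> m1 A = m2 A.
Proof.
move=> m1oo m12 A mA.
apply: (measure_unique
  [set A | exists D (y : R), measurable D /\ A = D `*` `]y, +oo[%classic]
  (fun n => setT `*` `](- (n%:R : R))%R, +oo[%classic)) => //.
- exact: prod_rays_measurableE.
- move=> _ _ [D1 [y1 [mD1 ->]]] [D2 [y2 [mD2 ->]]].
  exists (D1 `&` D2), (Num.max y1 y2); split; first exact: measurableI.
  rewrite -setXI; congr (_ `*` _); apply/seteqP; split => x /=.
    by rewrite !in_itv/= !andbT gt_max => -[-> ->].
  by rewrite !in_itv/= !andbT gt_max => /andP[-> ->].
- by move=> n; exists setT, (- (n%:R : R))%R.
- apply/seteqP; split => // -[t s] _; exists (Num.truncn (- s)).+1 => //=.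
  by split => //; rewrite in_itv/= andbT ltrNl truncnS_gt.
- by move=> _ [D [y [mD ->]]]; exact: m12.
- move=> n; apply: le_lt_trans m1oo; apply: le_measure; rewrite ?inE//.
  by apply: measurableX => //; exact: measurable_itv.
Qed.

(** Linear combinations of the moments are integrals of polynomials in [expN_pos], and suitable
    polynomials converge boundedly to the indicator of a ray; dominated convergence then gives the
    masses of the products [D x ]y, +oo[]. *)
Lemma laplace_measure_unique (m1 m2 : {measure set (T * R) -> \bar R}) :
  m1 setT < +oo -> m2 setT < +oo ->
  m1 (setT `*` `]-oo, 0%R[%classic) = 0 -> m2 (setT `*` `]-oo, 0%R[%classic) = 0 ->
  (forall D j, measurable D ->
    \int[m1]_z (\1_D z.1 * expN_pos z.2 ^+ j)%:E =
    \int[m2]_z (\1_D z.1 * expN_pos z.2 ^+ j)%:E) ->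
  forall A, measurable A -> m1 A = m2 A.
Proof.
move=> m1oo m2oo m10 m20 m12; apply: finite_measure_eq_rays => // D y mD.
have mD1 : measurable_fun setT (fun z : T * R => \1_D z.1 : R).
  exact: (measurableT_comp (measurable_indic mD) measurable_fst).
have mx : measurable_fun setT (fun z : T * R => expN_pos z.2).
  exact: (measurableT_comp measurable_expN_pos measurable_snd).
have bD (z : T * R) : (0 <= (\1_D z.1 : R) <= 1)%R.
  by rewrite indicE; case: (_ \in _); rewrite ?lexx ler01.
have ib (m : {measure set (T * R) -> \bar R}) j : m setT < +oo ->
    m.-integrable setT (fun z => (\1_D z.1 * expN_pos z.2 ^+ j)%:E).
  move=> moo; apply: (@measurable_bounded_integrable _ _ _ m
    (fun z => \1_D z.1 * expN_pos z.2 ^+ j)%R) => //.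
    by apply: measurable_funM => //; exact: measurable_funX.
  exists 1%R; split => // M M1 z _ /=.
  have /andP[a0 a1] := bD z; have /andP[b0 b1] := expN_pos_pow_itv z.2 j.
  by rewrite ger0_norm ?mulr_ge0// (le_trans _ (ltW M1))// mulr_ile1.
(* The extra power [j] lets the induction on polynomials close: multiplication by the variable is
   absorbed into [j + 1]. *)
have poly (P : {poly R}) j :
  [/\ m1.-integrable setT (fun z => (\1_D z.1 * (P.[expN_pos z.2] * expN_pos z.2 ^+ j))%:E),
      m2.-integrable setT (fun z => (\1_D z.1 * (P.[expN_pos z.2] * expN_pos z.2 ^+ j))%:E) &
    \int[m1]_z (\1_D z.1 * (P.[expN_pos z.2] * expN_pos z.2 ^+ j))%:E =
    \int[m2]_z (\1_D z.1 * (P.[expN_pos z.2] * expN_pos z.2 ^+ j))%:E].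
  elim/poly_ind: P j => [|P c IH] j.
    have -> : (fun z : T * R => (\1_D z.1 * ((0 : {poly R}).[expN_pos z.2] * expN_pos z.2 ^+ j))%:E) = cst 0.
      by apply/funext => z; rewrite horner0 mul0r mulr0.
    by split; rewrite ?integral0//; exact: integrable0.
  have -> : (fun z : T * R => (\1_D z.1 * ((P * 'X + c%:P).[expN_pos z.2] * expN_pos z.2 ^+ j))%:E) =
     (fun z => (\1_D z.1 * (P.[expN_pos z.2] * expN_pos z.2 ^+ j.+1))%:E +
               c%:E * (\1_D z.1 * expN_pos z.2 ^+ j)%:E).
    apply/funext => z; rewrite hornerMXaddC -EFinM -EFinD exprS; congr EFin.
    by ring.
  have [i1 i2 e12] := IH j.+1.
  have I1 := integrableZl measurableT c (ib m1 j m1oo).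
  have I2 := integrableZl measurableT c (ib m2 j m2oo).
  split; [exact: integrableD|exact: integrableD|].
  rewrite integralD// [RHS]integralD// e12; congr (_ + _).
  by rewrite integralZl ?integralZl ?m12//; exact: ib.
(* The polynomial approximation needs [0 <= y]. A ray starting below 0 carries the whole mass over
   [D], which is the moment of order 0. *)
have [y0|y0] := ltP y 0%R.
  have full (m : {measure set (T * R) -> \bar R}) :
     m (setT `*` `]-oo, 0%R[%classic) = 0 ->
     m (D `*` `]y, +oo[%classic) = \int[m]_z (\1_D z.1 * expN_pos z.2 ^+ 0)%:E.
    move=> m0.
    under eq_integral do rewrite expr0 mulr1.
    have mDR : measurable (D `*` [set: R]) by exact: measurableX.
    have -> : \int[m]_z (\1_D z.1)%:E = m (D `*` [set: R]).
      rewrite -(setIT (D `*` [set: R])) -integral_indic//; apply: eq_integral => z _.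
      by rewrite !indicE; congr ((_ : bool)%:R%:E); apply/idP/idP; rewrite !inE//= => -[].
    apply/eqP; rewrite eq_le; apply/andP; split.
      apply: le_measure; rewrite ?inE//.
        by apply: measurableX => //; exact: measurable_itv.
      by move=> z [].
    rewrite -[leRHS]adde0 -m0.
    have mI1 : measurable (D `*` (`]y, +oo[%classic : set R)).
      by apply: measurableX => //; exact: measurable_itv.
    have mI2 : measurable ([set: T] `*` (`]-oo, 0%R[%classic : set R)).
      by apply: measurableX => //; exact: measurable_itv.
    apply: le_trans (measureU2 _ mI1 mI2).
    apply: le_measure; rewrite ?inE//.
      exact: measurableU.
    move=> [t s] /= [Dt _]; rewrite !in_itv/= andbT.
    by have [sy|ys] := leP s y; [right|left]; split => //; exact: le_lt_trans y0.
  by rewrite !full// m12.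
have approx (m : {measure set (T * R) -> \bar R}) : m setT < +oo ->
    \int[m]_z (\1_D z.1 * (1 - expN_pos z.2 ^+ k) ^+ ray_exponent y k)%:E @[k --> \oo] -->
    m (D `*` `]y, +oo[%classic).
  move=> moo.
  have -> : m (D `*` `]y, +oo[%classic) =
      \int[m]_z (\1_D z.1 * \1_(`]y, +oo[%classic) z.2)%:E.
    rewrite -(setIT (D `*` _)) -integral_indic//; last first.
      by apply: measurableX => //; exact: measurable_itv.
    apply: eq_integral => z _; rewrite !indicE -natrM mulnb.
    by congr ((_ : bool)%:R%:E); apply/idP/andP; rewrite !inE//= => -[].
  have [] // := @dominated_convergence _ _ _ m setT measurableT
    (fun k z => (\1_D z.1 * (1 - expN_pos z.2 ^+ k) ^+ ray_exponent y k)%:E)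
    (fun z => (\1_D z.1 * \1_(`]y, +oo[%classic) z.2)%:E) (cst 1).
  - move=> k; apply/measurable_EFinP; apply: measurable_funM => //.
    apply: measurable_funX; apply: measurable_funB => //.
    exact: measurable_funX.
  - apply/measurable_EFinP; apply: measurable_funM => //.
    by apply: (measurableT_comp (measurable_indic _) measurable_snd); exact: measurable_itv.
  - apply/aeW => z _; apply: cvg_EFin; first exact: nearW.
    by apply: cvgM; [exact: cvg_cst|exact: cvg_ray_threshold].
  - apply/integrableP; split; first exact: measurable_cst.
    under eq_integral do rewrite /= normr1.
    by rewrite integral_cst// mul1e.
  - apply/aeW => z k _; rewrite lee_fin.
    have /andP[a0 a1] := bD z; have /andP[b0 b1] := expN_pos_pow_itv z.2 k.
    have c0 : (0 <= 1 - expN_pos z.2 ^+ k)%R by rewrite subr_ge0.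
    rewrite ger0_norm ?mulr_ge0// ?exprn_ge0// mulr_ile1 ?exprn_ge0//.
    by rewrite exprn_ile1// lerBlDr lerDl.
have := approx _ m2oo.
have -> : (fun k => \int[m2]_z (\1_D z.1 * (1 - expN_pos z.2 ^+ k) ^+ ray_exponent y k)%:E) =
          (fun k => \int[m1]_z (\1_D z.1 * (1 - expN_pos z.2 ^+ k) ^+ ray_exponent y k)%:E).
  apply/funext => k; have [_ _ e] := poly ((1 - 'X^k) ^+ ray_exponent y k)%R 0%N.
  move: e; under eq_integral do rewrite expr0 mulr1 horner_exp !hornerE.
  move=> ->.
  by under [RHS]eq_integral do rewrite expr0 mulr1 horner_exp !hornerE.
move=> h2; have h1 := approx _ m1oo.
exact: (cvg_unique _ h1 h2).
Qed.

End finite_measures_on_halflines.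

Section laplace_uniqueness.
Local Open Scope ereal_scope.
Context d (T : measurableType d) (R : realType)
  dX (X : measurableType dX) dY (Y : measurableType dY).

(** The images of [p mu] and [q nu] are compared through their moments. Where the weight does not
    vanish the second coordinate is nonnegative, so [expN_pos] is the genuine exponential there; the
    case [j = 0] transfers finiteness of the total mass from one side to the other. *)
Lemma laplace_uniqueness (mu : {measure set X -> \bar R})
    (nu : {measure set Y -> \bar R}) (f : X -> T * R) (g : Y -> T * R)
    (p : X -> R) (q : Y -> R) :
  measurable_fun setT f -> measurable_fun setT g ->
  measurable_fun setT p -> measurable_fun setT q ->
  (forall x, 0 <= p x)%R -> (forall y, 0 <= q y)%R ->
  (forall x, p x = 0 \/ 0 <= (f x).2)%R -> (forall y, q y = 0 \/ 0 <= (g y).2)%R ->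
  \int[mu]_x (p x)%:E < +oo ->
  (forall D (j : nat), measurable D ->
    \int[mu]_x (\1_D (f x).1 * expR (- (j%:R * (f x).2)) * p x)%:E =
    \int[nu]_y (\1_D (g y).1 * expR (- (j%:R * (g y).2)) * q y)%:E) ->
  forall K : T * R -> \bar R, measurable_fun setT K -> (forall z, 0 <= K z) ->
    \int[mu]_x (K (f x) * (p x)%:E) = \int[nu]_y (K (g y) * (q y)%:E).
Proof.
move=> mf mg mp mq p0 q0 fp gq muoo H K mK K0.
have [m1 m1E] := image_density mu mf mp p0.
have [m2 m2E] := image_density nu mg mq q0.
rewrite -m1E// -m2E//.
have D1 D j : measurable D ->
    \int[m1]_z (\1_D z.1 * expN_pos z.2 ^+ j)%:E =
    \int[mu]_x (\1_D (f x).1 * expR (- (j%:R * (f x).2)) * p x)%:E.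
  move=> mD; rewrite m1E//.
  - apply: eq_integral => x _; rewrite -EFinM; congr EFin.
    have [->|f0] := fp x; first by rewrite !mulr0.
    by rewrite expN_pos_powE (max_l f0).
  - apply/measurable_EFinP; apply: measurable_funM.
      exact: (measurableT_comp (measurable_indic mD) measurable_fst).
    apply: measurable_funX.
    exact: (measurableT_comp measurable_expN_pos measurable_snd).
  - move=> z; rewrite lee_fin mulr_ge0//.
    by have /andP[] := expN_pos_pow_itv z.2 j.
have D2 D j : measurable D ->
    \int[m2]_z (\1_D z.1 * expN_pos z.2 ^+ j)%:E =
    \int[nu]_x (\1_D (g x).1 * expR (- (j%:R * (g x).2)) * q x)%:E.
  move=> mD; rewrite m2E//.
  - apply: eq_integral => x _; rewrite -EFinM; congr EFin.
    have [->|f0] := gq x; first by rewrite !mulr0.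
    by rewrite expN_pos_powE (max_l f0).
  - apply/measurable_EFinP; apply: measurable_funM.
      exact: (measurableT_comp (measurable_indic mD) measurable_fst).
    apply: measurable_funX.
    exact: (measurableT_comp measurable_expN_pos measurable_snd).
  - move=> z; rewrite lee_fin mulr_ge0//.
    by have /andP[] := expN_pos_pow_itv z.2 j.
have e12 D j : measurable D ->
    \int[m1]_z (\1_D z.1 * expN_pos z.2 ^+ j)%:E =
    \int[m2]_z (\1_D z.1 * expN_pos z.2 ^+ j)%:E.
  by move=> mD; rewrite D1// D2// H.
have tot1 : m1 setT = \int[mu]_x (p x)%:E.
  rewrite -[LHS]mul1e -integral_cst// m1E//.
  by under eq_integral do rewrite mul1e.
have totE (m : {measure set (T * R) -> \bar R}) :
    m setT = \int[m]_z (\1_setT z.1 * expN_pos z.2 ^+ 0)%:E.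
  rewrite -[LHS]mul1e -integral_cst//; apply: eq_integral => z _.
  by rewrite indicE in_setT expr0 mulr1.
have neg1 : m1 (setT `*` `]-oo, 0%R[%classic) = 0.
  have mS : measurable ([set: T] `*` (`]-oo, 0%R[%classic : set R)).
    by apply: measurableX => //; exact: measurable_itv.
  rewrite -(setIT (setT `*` _)) -integral_indic// m1E//.
  - rewrite integral0_eq// => x _; have [->|f0] := fp x; first by rewrite mule0.
    rewrite indicE memNset ?mul0e// => -[_] /=.
    by rewrite in_itv/= ltNge f0.
  - by apply/measurable_EFinP; exact: measurable_indic.
have neg2 : m2 (setT `*` `]-oo, 0%R[%classic) = 0.
  have mS : measurable ([set: T] `*` (`]-oo, 0%R[%classic : set R)).
    by apply: measurableX => //; exact: measurable_itv.
  rewrite -(setIT (setT `*` _)) -integral_indic// m2E//.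
  - rewrite integral0_eq// => x _; have [->|f0] := gq x; first by rewrite mule0.
    rewrite indicE memNset ?mul0e// => -[_] /=.
    by rewrite in_itv/= ltNge f0.
  - by apply/measurable_EFinP; exact: measurable_indic.
apply: eq_measure_integral => A mA _.
apply: laplace_measure_unique => //; first by rewrite tot1.
by rewrite totE -e12// -totE tot1.
Qed.

End laplace_uniqueness.

(** * Exponentials of primitives of bounded measurable rates *)

Section exponential_of_primitive.
Context {R : realType}.
Notation mu := (@lebesgue_measure R).

Lemma integrable_itv_bounded (c : R -> R) (M : R) (a b : R) (b0 b1 : bool) :
  measurable_fun setT c -> (forall u, 0 <= c u <= M) ->
  mu.-integrable [set` Interval (BSide b0 a) (BSide b1 b)] (EFin \o c).
Proof.
move=> mc cM; apply: measurable_bounded_integrable => //=.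
- by rewrite lebesgue_measure_itv/=; case: ifPn; rewrite ?ltry.
- exact: measurable_funTS.
- exists M; split; first by rewrite num_real.
  move=> N MN x _ /=; have /andP[c0 c1] := cM x.
  by rewrite ger0_norm// (le_trans c1)// ltW.
Qed.

Lemma le_Rintegral_itv_bounded (c : R -> R) (M : R) (v u : R) :
  measurable_fun setT c -> (forall u, 0 <= c u <= M) -> v <= u ->
  0 <= \int[mu]_(x in `[v, u]) c x <= M * (u - v).
Proof.
move=> mc cM vu; apply/andP; split.
  by apply: Rintegral_ge0 => x _; have /andP[] := cM x.
have M0 : 0 <= M by have /andP[c0 c1] := cM v; exact: le_trans c1.
have -> : M * (u - v) = \int[mu]_(x in `[v, u]) M.
  rewrite Rintegral_cst//= lebesgue_measure_itv/= lte_fin.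
  case: ltP => //= uv; congr (_ * _); apply/eqP; rewrite subr_eq0 eq_le uv//.
apply: le_Rintegral => //.
- exact: (integrable_itv_bounded (M := M)).
- by apply: (integrable_itv_bounded (c := cst M) (M := M)) => // ?; rewrite lexx M0.
- by move=> x _; have /andP[] := cM x.
Qed.

Lemma Rintegral_itv_split (c : R -> R) (M : R) (p v u : R) :
  measurable_fun setT c -> (forall u, 0 <= c u <= M) -> p <= v -> v <= u ->
  \int[mu]_(x in `[p, u]) c x =
  \int[mu]_(x in `[p, v]) c x + \int[mu]_(x in `[v, u]) c x.
Proof.
move=> mc cM pv vu.
rewrite -[X in _ = _ + X]Rintegral_itv_obnd_cbnd; last exact: (integrable_itv_bounded (M := M)).
rewrite -(@Rintegral_itvB R c (BLeft p) (BRight u) v).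
- by rewrite addrC subrK.
- exact: (integrable_itv_bounded (M := M)).
- by rewrite bnd_simp.
- by rewrite bnd_simp.
Qed.

(** Cutting [[p, q]] into [n + 1] equal pieces leaves an error of [K (q - p)^2 / (n + 1)]. This
    stands in for the fundamental theorem of calculus when the integrand is merely measurable. *)
Lemma quadratic_increments_cst (f : R -> R) (K p q : R) : p <= q ->
  (forall v u, p <= v -> v <= u -> u <= q -> `|f u - f v| <= K * (u - v) ^+ 2) ->
  f q = f p.
Proof.
move=> pq fK; apply/eqP; rewrite -subr_eq0 -normr_le0.
have K0 : 0 <= K * (q - p) ^+ 2 by apply: le_trans (fK p q _ _ _).
have bound n : `|f q - f p| <= K * (q - p) ^+ 2 * n.+1%:R^-1.
  pose h := (q - p) / n.+1%:R.
  have h0 : 0 <= h by rewrite divr_ge0// subr_ge0.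
  pose x i := p + i%:R * h.
  have xn : x n.+1 = q by rewrite /x /h mulrC divfK// addrC subrK.
  have x0 : x 0%N = p by rewrite /x mul0r addr0.
  have xle i j : (i <= j)%N -> x i <= x j.
    by move=> ij; rewrite lerD2l ler_wpM2r// ler_nat.
  have -> : f q - f p = \sum_(0 <= i < n.+1) (f (x i.+1) - f (x i)).
    by rewrite (telescope_sumr (fun i => f (x i)))// xn x0.
  apply: le_trans (ler_norm_sum _ _ _) _.
  have -> : K * (q - p) ^+ 2 * n.+1%:R^-1 = \sum_(0 <= i < n.+1) (K * h ^+ 2).
    rewrite sumr_const_nat subn0 -mulr_natl /h; field.
    by rewrite addrC natr1 pnatr_eq0.
  rewrite big_nat [leRHS]big_nat; apply: ler_sum => i /andP[_ ilt].
  have -> : h = x i.+1 - x i by rewrite /x -natr1; ring.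
  apply: fK; first by rewrite -x0 xle.
    by rewrite xle.
  by rewrite -xn xle.
have c0 : K * (q - p) ^+ 2 * n.+1%:R^-1 @[n --> \oo] --> (0 : R).
  rewrite -(mulr0 (K * (q - p) ^+ 2)); apply: cvgM; first exact: cvg_cst.
  exact: cvg_harmonic.
rewrite -(cvg_lim _ c0)//; apply: limr_ge; first by apply/cvg_ex; eexists; exact: c0.
exact: nearW.
Qed.

Lemma expN_second_order (x : R) : 0 <= x ->
  x - x ^+ 2 <= 1 - expR (- x) <= x /\ x - x ^+ 2 <= x * expR (- x) <= x.
Proof.
move=> x0.
have e1 : 1 - x <= expR (- x) by have := expR_ge1Dx (- x); lra.
have e0 : expR (- x) <= 1 by rewrite -expR0 ler_expR oppr_le0.
have e2 : (1 + x) * expR (- x) <= 1.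
  rewrite expRN ler_pdivrMr ?expR_gt0// mul1r; exact: expR_ge1Dx.
have h : x * (1 - x) <= x * expR (- x) by rewrite ler_wpM2l.
have h' : x * expR (- x) <= x * 1 by rewrite ler_wpM2l.
rewrite expr2; split; apply/andP; split; lra.
Qed.

Definition primitive (c : R -> R) (p u : R) : R := \int[mu]_(x in `[p, u]) c x.

Lemma primitive_measurable (c : R -> R) (M p : R) :
  measurable_fun setT c -> (forall u, 0 <= c u <= M) ->
  measurable_fun setT (primitive c p).
Proof.
move=> mc cM.
apply: nondecreasing_measurable => // v u vu.
have [pv|vp] := leP p v.
  rewrite [leRHS](Rintegral_itv_split mc cM pv vu) lerDl.
  by have /andP[] := le_Rintegral_itv_bounded mc cM vu.
rewrite /primitive set_itv_ge ?bnd_simp -?ltNge// Rintegral_set0.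
by apply: Rintegral_ge0 => x _; have /andP[] := cM x.
Qed.

(** As [c] is only bounded and measurable, its primitive [C] need not be differentiable everywhere.
    Instead [D(u)], the integral of [c e^(-C)] up to [u] plus [e^(-C(u))], has increments of size at
    most [M^2 (u - v)^2], hence is constant. *)
Lemma Rintegral_mul_expN_primitive (c : R -> R) (M p q : R) :
  measurable_fun setT c -> (forall u, 0 <= c u <= M) -> p <= q ->
  \int[mu]_(u in `[p, q]) (c u * expR (- primitive c p u)) =
  1 - expR (- primitive c p q).
Proof.
move=> mc cM pq.
have M0 : 0 <= M by have /andP[c0 c1] := cM p; exact: le_trans c1.
have C0 u : 0 <= primitive c p u.
  by apply: Rintegral_ge0 => x _; have /andP[] := cM x.
have mC : measurable_fun setT (primitive c p) by exact: primitive_measurable cM.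
have CS v u : p <= v -> v <= u ->
    primitive c p u = primitive c p v + primitive c v u.
  exact: Rintegral_itv_split cM.
have PM v u : v <= u -> 0 <= primitive c v u <= M * (u - v).
  exact: le_Rintegral_itv_bounded.
have Cp : primitive c p p = 0 by rewrite /primitive set_itv1 Rintegral_set1.
have int_prim v u r : \int[mu]_(x in `[v, u]) (c x * r) = primitive c v u * r.
  have mI : measurable (`[v, u]%classic : set (measurableTypeR R)) by [].
  exact: (RintegralZr r mI (integrable_itv_bounded v u true false mc cM)).
move: (primitive c p) C0 mC CS Cp => C C0 mC CS Cp.
have mg : measurable_fun setT (fun u => c u * expR (- C u)).
  by apply: measurable_funM => //; do 2 apply: measurableT_comp => //.
have gM u : 0 <= c u * expR (- C u) <= M.
  have /andP[c0 c1] := cM u; rewrite mulr_ge0 ?expR_ge0//=.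
  by rewrite (le_trans _ c1)// ler_piMr// expR_le1 oppr_le0.
pose D u := \int[mu]_(x in `[p, u]) (c x * expR (- C x)) + expR (- C u).
suff : D q = D p.
  by rewrite /D set_itv1 Rintegral_set1 add0r Cp oppr0 expR0 => <-; rewrite addrK.
apply: (@quadratic_increments_cst D (M ^+ 2)) => // v u pv vu uq.
rewrite /D (Rintegral_itv_split mg gM pv vu).
have CE := CS v u pv vu.
have /andP[d0 d1] := PM v u vu.
have i1 := integrable_itv_bounded v u true false mc cM.
have i2 := integrable_itv_bounded v u true false mg gM.
have mI : measurable (`[v, u]%classic : set (measurableTypeR R)) by [].
have j1 r := integrableZr mI r i1.
(* On [[v, u]] the exponential lies between its values at the two ends, as [C] is nondecreasing;
   this frames the integral up to second order. *)
have I1 : \int[mu]_(x in `[v, u]) (c x * expR (- C x)) <= primitive c v u * expR (- C v).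
  rewrite -int_prim; apply: (le_Rintegral mI i2 (j1 _)) => x /=.
  rewrite in_itv/= => /andP[vx xu]; have /andP[c0 c1] := cM x.
  rewrite ler_wpM2l// ler_expR lerN2 (CS v x)// lerDl.
  by have /andP[] := PM v x vx.
have I0 : primitive c v u * expR (- C u) <= \int[mu]_(x in `[v, u]) (c x * expR (- C x)).
  rewrite -int_prim; apply: (le_Rintegral mI (j1 _) i2) => x /=.
  rewrite in_itv/= => /andP[vx xu]; have /andP[c0 c1] := cM x.
  rewrite ler_wpM2l// ler_expR lerN2 (CS x u)// ?lerDl; last exact: le_trans vx.
  by have /andP[] := PM x u xu.
have e0 := expR_ge0 (- C v).
have e1 : expR (- C v) <= 1 by rewrite expR_le1 oppr_le0.
rewrite CE opprD expRD in I0 *.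
move: I0 I1 d0 d1 e0 e1.
move: (\int[mu]_(x in `[v, u]) _) (\int[mu]_(x in `[p, v]) _) => I J.
move: (primitive c v u) (expR (- C v)) => d e I0 I1 d0 d1 e0 e1.
have [/andP[a1 a2] /andP[a3 a4]] := expN_second_order d0.
have d2 : d ^+ 2 <= M ^+ 2 * (u - v) ^+ 2.
  by rewrite -exprMn; apply: lerXn2r => //; rewrite nnegrE mulr_ge0// subr_ge0.
apply: le_trans d2.
have b1 := ler_wpM2l e0 a1; have b2 := ler_wpM2l e0 a2; have b3 := ler_wpM2l e0 a3.
have b4 : e * d ^+ 2 <= d ^+ 2 by rewrite ler_piMl// exprn_ge0.
have -> : J + I + e * expR (- d) - (J + e) = I - e * (1 - expR (- d)) by ring.
have c1 : d * (e * expR (- d)) = e * (d * expR (- d)) by ring.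
rewrite c1 in I0.
move: (expR (- d)) a1 a2 a3 a4 b1 b2 b3 c1 I0 => z a1 a2 a3 a4 b1 b2 b3 c1 I0.
rewrite ler_norml; apply/andP; split; lra.
Qed.

Lemma integral_mul_expN_primitive (c : R -> R) (M p q : R) :
  measurable_fun setT c -> (forall u, 0 <= c u <= M) -> p <= q ->
  (\int[mu]_(u in `[p, q]) (c u * expR (- primitive c p u))%:E =
  (1 - expR (- primitive c p q))%:E)%E.
Proof.
move=> mc cM pq; rewrite -(Rintegral_mul_expN_primitive mc cM pq) /Rintegral fineK//.
have C0 u : 0 <= primitive c p u by apply: Rintegral_ge0 => x _; have /andP[] := cM x.
apply: integrable_fin_num => //.
apply: (integrable_itv_bounded (M := M) (c := fun u => c u * expR (- primitive c p u))).
  apply: measurable_funM => //; do 2 apply: measurableT_comp => //.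
  exact: primitive_measurable cM.
move=> u; have /andP[c0 c1] := cM u; rewrite mulr_ge0 ?expR_ge0//=.
by rewrite (le_trans _ c1)// ler_piMr// expR_le1 oppr_le0.
Qed.

End exponential_of_primitive.

(** * Affine substitutions, integrals of powers and stable tails *)

Section lebesgue_affine.
Context {R : realType}.
Local Open Scope ereal_scope.
Notation mu := (@lebesgue_measure R).

(** The image of [c] times Lebesgue measure under [x |-> c x + b] gives every interval []u, v]] its
    length, so it is Lebesgue measure. *)
Lemma integral_affine (c b : R) (f : R -> \bar R) : (0 < c)%R ->
  measurable_fun setT f -> (forall x, 0 <= f x) ->
  \int[mu]_x f (c * x + b)%R = (c^-1)%:E * \int[mu]_x f x.
Proof.
move=> c0 mf f0.
have c1 : (0 <= c^-1)%R by rewrite invr_ge0 ltW.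
have mphi : measurable_fun [set: R] (fun x : R => c * x + b)%R.
  by apply: measurable_funD => //; exact: measurable_funM.
have [nu nuE] := @image_density _ _ (measurableTypeR R) (measurableTypeR R) R mu (fun x => c * x + b)%R (cst c) mphi
  (measurable_cst _) (fun=> ltW c0).
have muE A : measurable A -> mu A = nu A.
  apply: lebesgue_measure_unique => X [[u v] _ <-]/=.
  rewrite -[in RHS](setIT `]u, v]%classic) -integral_indic//.
  rewrite nuE//; last first.
    by apply/measurable_EFinP; apply: measurable_indic.
  have -> : \int[mu]_x ((\1_(`]u, v]%classic) (c * x + b)%R)%:E * (cst c x)%:E) =
     c%:E * \int[mu]_x (\1_(`](u - b) / c, (v - b) / c]%classic)%R x)%:E.
    rewrite -ge0_integralZl//; last 2 first.
    - by apply/measurable_EFinP; apply: measurable_indic.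
    - by rewrite lee_fin ltW.
    apply: eq_integral => x _; rewrite muleC; congr (_ * _).
    rewrite !indicE; congr ((_ : bool)%:R%:E); apply/idP/idP; rewrite !inE/= !in_itv/=.
      by move=> /andP[h1 h2]; rewrite ltr_pdivrMr// ler_pdivlMr//; apply/andP; split; lra.
    by rewrite ltr_pdivrMr// ler_pdivlMr// => /andP[h1 h2]; apply/andP; split; lra.
  rewrite integral_indic//.
  rewrite setIT [in LHS]lebesgue_measure_itv/= lebesgue_measure_itv/= !lte_fin.
  have -> : ((u - b) / c < (v - b) / c)%R = (u < v)%R.
    by rewrite ltr_pM2r ?invr_gt0// ltrD2r.
  case: ifP => _; last by rewrite mule0.
  by rewrite -!EFinB -EFinM; congr EFin; field; rewrite gt_eqF.
have -> : \int[mu]_x f x = \int[nu]_x f x.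
  by apply: eq_measure_integral => A mA _; exact: muE.
rewrite nuE// -ge0_integralZl//; last 2 first.
- apply: emeasurable_funM; last exact/measurable_EFinP.
  exact: measurableT_comp.
- by move=> x _; rewrite mule_ge0// lee_fin ltW.
apply: eq_integral => x _.
by rewrite muleCA -EFinM mulVf ?gt_eqF// mule1.
Qed.

End lebesgue_affine.

Lemma measurable_powR2 d (T : measurableType d) (R : realType) (f g : T -> R) :
  measurable_fun setT f -> measurable_fun setT g ->
  measurable_fun setT (fun x => f x `^ g x).
Proof.
move=> mf mg; rewrite /powR.
apply: measurable_fun_ifT.
- exact: measurable_fun_eqr.
- have -> : (fun x => (g x == 0)%:R) = (\1_(g @^-1` [set 0]) : T -> R).
    apply/funext => x; rewrite indicE; congr ((_ : bool)%:R).
    by apply/eqP/idP; rewrite inE.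
  apply: measurable_indic.
  by rewrite -[X in measurable X]setTI; apply: mg => //; exact: measurable_set1.
- apply: measurableT_comp => //; apply: measurable_funM => //.
  by apply: measurableT_comp => //; exact: measurable_ln.
Qed.

Section power_integrals.
Context {R : realType}.
Notation mu := (@lebesgue_measure R).

(** The integrand may be singular at 0, so the fundamental theorem of calculus is used on
    [[T / (n + 2), T]]; these intervals increase to []0, T]]. *)
Lemma integral_powRN (th T : R) : 0 <= th < 1 -> 0 <= T ->
  (\int[mu]_(s in `]0%R, T]) (s `^ (- th))%:E = (T `^ (1 - th) / (1 - th))%:E)%E.
Proof.
move=> /andP[th0 th1]; rewrite le_eqVlt => /predU1P[<-|T0].
  rewrite set_itv_ge ?bnd_simp ?ltxx// integral_set0 powR0 ?mul0r//.
  by rewrite subr_eq0 gt_eqF.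
have th1' : 0 < 1 - th by rewrite subr_gt0.
pose F (s : R) := s `^ (1 - th) / (1 - th).
pose a n : R := T / n.+2%:R.
have a0 n : 0 < a n by rewrite divr_gt0.
have aT n : a n < T by rewrite ltr_pdivrMr// ltr_pMr// ltr1n.
have dF (x : R) : 0 < x -> derivable F x 1.
  by move=> x0; apply: derivableM => //; apply: derivable_powR; rewrite in_itv/= x0.
have cF (x : R) : 0 < x -> F y @[y --> x] --> F x.
  by move=> x0; apply/differentiable_continuous/derivable1_diffP/dF.
have int n : (\int[mu]_(s in `[a n, T]) (s `^ (- th))%:E = (F T)%:E - (F (a n))%:E)%E.
  apply: continuous_FTC2 => //.
  - apply: derivable_within_continuous => x; rewrite in_itv/= => /andP[ax _].
    by apply: derivable_powR; rewrite in_itv/= (lt_le_trans _ ax).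
  - split.
    + by move=> x; rewrite in_itv/= => /andP[ax _]; apply: dF; exact: lt_trans ax.
    + by apply: cvg_at_right_filter; exact: cF.
    + by apply: cvg_at_left_filter; exact: cF.
  - move=> x; rewrite in_itv/= => /andP[ax _].
    have x0 : 0 < x by exact: lt_trans ax.
    rewrite /F derive1Mr; last by apply: derivable_powR; rewrite in_itv/= x0.
    rewrite powR_derive1; last by rewrite in_itv/= x0.
    by rewrite mulrAC divff ?gt_eqF// mul1r; congr (_ `^ _); ring.
have mf : measurable_fun [set: R] (fun s : R => (s `^ (- th))%:E).
  by apply/measurable_EFinP; exact: measurable_powR.
have bE : \bigcup_n `[a n, T]%classic = `]0, T]%classic.
  apply/seteqP; split => x /=.
    move=> [n _]; rewrite /= !in_itv/= => /andP[ax ->]; rewrite andbT.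
    exact: lt_le_trans ax.
  rewrite in_itv/= => /andP[x0 xT].
  exists (Num.truncn (T / x)) => //=; rewrite in_itv/= xT andbT /a.
  rewrite ler_pdivrMr// mulrC -ler_pdivrMr//.
  by rewrite (le_trans (ltW (truncnS_gt _)))// ler_nat.
have h1 : (\int[mu]_(s in `[a n, T]) (s `^ (- th))%:E @[n --> \oo] -->
   \int[mu]_(s in `]0%R, T]) (s `^ (- th))%:E)%E.
  rewrite -bE; apply: ge0_nondecreasing_set_cvg_integral => //.
  - apply/nondecreasing_seqP => n; rewrite subsetEset => x /=.
    rewrite !in_itv/= => /andP[ax ->]; rewrite andbT (le_trans _ ax)//.
    by rewrite ler_pM2l// lef_pV2 ?posrE// ler_nat.
  - by move=> n; apply: measurable_funTS.
  - by move=> n x _; rewrite lee_fin powR_ge0.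
have h2 : ((F T)%:E - (F (a n))%:E)%E @[n --> \oo] --> (F T)%:E.
  apply: cvg_EFin; first by apply: nearW => n.
  rewrite -[X in _ --> X]subr0; apply: cvgB; first exact: cvg_cst.
  rewrite -(mul0r (1 - th)^-1); apply: cvgMr_tmp.
  move: (powR_cvg0 th1') => /cvg_at_rightP; apply; split => //.
  rewrite -(mulr0 T); apply: cvgMl_tmp.
  have := @cvg_harmonic R; rewrite -cvg_shiftS; exact.
move: h1; under eq_fun do rewrite int.
by move=> h1; exact: (cvg_unique _ h1 h2).
Qed.

End power_integrals.

Section stable_density.
Context {R : realType}.
Notation mu := (@lebesgue_measure R).

(* Tail [nu(]s, +oo[, x)] of the Levy measure of order [th = alpha x]. *)
Definition stable_tail (th s : R) : R :=
  \1_(`]0, +oo[%classic) s * (s `^ (- th) / Gamma (1 - th)).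

(** [Gamma] is a real-valued integral, which would be 0 if the integral diverged, so finiteness has
    to be shown: [s^(-th)] dominates on []0, 1]] and [e^(-s)] on []1, +oo[]. Positivity comes from
    the lower bound [e^(-1)] on []0, 1]]. *)
Lemma Gamma_integral (th : R) : 0 <= th < 1 ->
  (\int[mu]_(s in `]0%R, +oo[) (s `^ (- th) * expR (- s))%:E = (Gamma (1 - th))%:E)%E /\
  0 < Gamma (1 - th).
Proof.
move=> /andP[th0 th1].
set J := (X in X = _).
have mf : measurable_fun [set: R] (fun s : R => (s `^ (- th) * expR (- s))%:E).
  apply/measurable_EFinP; apply: measurable_funM; first exact: measurable_powR.
  exact: measurableT_comp.
have f0 (s : R) : (0 <= (s `^ (- th) * expR (- s))%:E)%E.
  by rewrite lee_fin mulr_ge0 ?powR_ge0 ?expR_ge0.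
have split : `]0, +oo[%classic = `]0, 1]%classic `|` `]1, +oo[%classic :> set R.
  apply/seteqP; split => x /=; rewrite !in_itv/= !andbT.
    by move=> x0; have [x1|x1] := leP x 1; [left|right] => //; rewrite x0.
  by move=> [/andP[]//|]; exact: lt_trans.
have JE : (J = \int[mu]_(s in `]0%R, 1%R]) (s `^ (- th) * expR (- s))%:E +
   \int[mu]_(s in `]1%R, +oo[) (s `^ (- th) * expR (- s))%:E)%E.
  rewrite /J split ge0_integral_setU//.
  - exact: measurable_funTS.
  - apply/disj_setPS => x /= [].
    by rewrite !in_itv/= andbT => /andP[_ x1]; rewrite ltNge x1.
have J1 : (\int[mu]_(s in `]0%R, 1%R]) (s `^ (- th) * expR (- s))%:E <= ((1 - th)^-1)%:E)%E.
  have := @integral_powRN R th 1; rewrite th0 th1 ler01 powR1 div1r => <-//.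
  apply: ge0_le_integral => //.
  - exact: measurable_funTS.
  - by apply/measurable_EFinP/measurable_funTS; exact: measurable_powR.
  - move=> x /=; rewrite in_itv/= => /andP[x0 _].
    by rewrite lee_fin ler_piMr ?powR_ge0// expR_le1 oppr_le0 ltW.
have J2 : (\int[mu]_(s in `]1%R, +oo[) (s `^ (- th) * expR (- s))%:E <= 1)%E.
  rewrite -(@integral_exponential_pdf R 1)//.
  rewrite [leLHS]integral_mkcond; apply: ge0_le_integral => //.
  - by move=> x _; apply: erestrict_ge0.
  - by apply/(measurable_restrictT _ _).1 => //; exact: measurable_funTS.
  - by apply/measurable_EFinP; exact: measurable_exponential_pdf.
  - move=> x _; rewrite patchE; case: ifPn => [|_]; last first.
      by rewrite lee_fin exponential_pdf_ge0.
    rewrite inE/= in_itv/= andbT => x1; have x0 := ltW (lt_trans ltr01 x1).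
    rewrite exponential_pdfE//= lee_fin mul1r mulN1r ler_piMl ?expR_ge0//.
    by rewrite powRN invf_le1 ?powR_gt0 ?(lt_trans ltr01)// -[leLHS](powRr0 x) ler_powR// ltW.
have Jfin : J \is a fin_num.
  rewrite ge0_fin_numE; last exact: integral_ge0.
  rewrite JE; apply: lte_add_pinfty.
    by apply: le_lt_trans J1 _; rewrite ltry.
  by apply: le_lt_trans J2 _; rewrite ltry.
have GE : J = (Gamma (1 - th))%:E.
  rewrite /Gamma -(fineK Jfin) /Rintegral; congr (fine _)%:E.
  by apply: eq_integral => s _; congr (_ `^ _ * _)%:E; ring.
split; first exact: GE.
rewrite -lte_fin -GE JE; apply: (@lt_le_trans _ _ (expR (-1))%:E).
  by rewrite lte_fin expR_gt0.
apply: le_trans (leeDl _ (integral_ge0 _ _)) => //.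
have -> : (expR (-1))%:E = (\int[mu]_(s in `]0%R, 1%R]) (expR (- 1 : R))%:E)%E.
  by rewrite integral_cst//= lebesgue_measure_itv/= lte_fin ltr01 -EFinB subr0 mule1.
apply: ge0_le_integral => //.
- exact: measurable_funTS.
- move=> x /=; rewrite in_itv/= => /andP[x0 x1].
  rewrite lee_fin -[leLHS]mul1r ler_pM ?ler01 ?expR_ge0//; last by rewrite ler_expR lerN2.
  by rewrite powRN invf_ge1 ?powR_gt0// -(powRr0 x) ger_powR// x0.
Qed.

Lemma stable_tail_ge0 (th s : R) : 0 <= th < 1 -> 0 <= stable_tail th s.
Proof.
move=> th01; rewrite /stable_tail mulr_ge0// divr_ge0 ?powR_ge0//.
by have [_ /ltW] := Gamma_integral th01.
Qed.

(** Replacing [s] by [la s] reduces this to the integral for [Gamma (1 - th)], which cancels the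
    normalisation of the tail. *)
Lemma laplace_stable_tail (th la : R) : 0 <= th < 1 -> 0 < la ->
  (\int[mu]_s (stable_tail th s * expR (- (la * s)))%:E = (la `^ (th - 1))%:E)%E.
Proof.
move=> th01 la0; have [GE G0] := Gamma_integral th01.
pose f (s : R) : \bar R := ((s `^ (- th) * expR (- s))%:E * (\1_(`]0, +oo[%classic) s)%:E)%E.
have mf : measurable_fun [set: R] f.
  apply: emeasurable_funM; apply/measurable_EFinP.
    apply: measurable_funM; first exact: measurable_powR.
    exact: measurableT_comp.
  by apply: measurable_indic; exact: measurable_itv.
have f0 s : (0 <= f s)%E.
  by rewrite mule_ge0 ?lee_fin// mulr_ge0 ?powR_ge0 ?expR_ge0.
have fE : (\int[mu]_s f s = (Gamma (1 - th))%:E)%E.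
  rewrite -GE [RHS]integral_mkcond; apply: eq_integral => s _.
  by rewrite epatch_indic.
have e (s : R) : (stable_tail th s * expR (- (la * s)))%:E =
    ((la `^ th / Gamma (1 - th))%:E * f (la * s + 0)%R)%E.
  rewrite /stable_tail /f addr0 -!EFinM; congr EFin.
  have -> : (\1_(`]0, +oo[%classic) (la * s) : R) = \1_(`]0, +oo[%classic) s.
    rewrite !indicE; congr ((_ : bool)%:R).
    by apply/idP/idP; rewrite !inE/= !in_itv/= !andbT pmulr_rgt0.
  rewrite indicE; case: (boolP (s \in _)); last by rewrite !mul0r !mulr0.
  rewrite inE/= in_itv/= andbT => s0; rewrite mul1r mulr1.
  rewrite powRM ?ltW// powRN [_ `^ (- th)]powRN.
  by field; rewrite !gt_eqF ?powR_gt0.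
under eq_integral do rewrite e.
rewrite ge0_integralZl//; last 2 first.
- apply: (measurableT_comp mf); exact: measurable_funD.
- by rewrite lee_fin divr_ge0 ?powR_ge0// ltW.
rewrite integral_affine// fE -!EFinM; congr EFin.
rewrite powRD; last by rewrite (gt_eqF la0) implybT.
rewrite powR_inv1 ?ltW//; field.
by rewrite !gt_eqF.
Qed.

End stable_density.

(** * Joint measurability of processes and conditioning *)

Section joint_measurability.
Local Open Scope ring_scope.
Context d (T : measurableType d) d' (U : measurableType d') (R : realType).

(** A point of the grid of mesh [1 / (m + 1)] lying strictly to the right of [u >= 0], even when [u]
    is itself on the grid: a right limit only speaks of times after [u]. *)
Definition right_grid (m : nat) (u : R) : R := (Num.truncn (m.+1%:R * u)).+1%:R / m.+1%:R.

Lemma right_grid_itv m u : 0 <= u -> u < right_grid m u <= u + m.+1%:R^-1.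
Proof.
move=> u0; have m0 : 0 < m.+1%:R :> R by [].
have /truncn_itv /andP[h1 h2] : 0 <= m.+1%:R * u by rewrite mulr_ge0.
rewrite /right_grid ltr_pdivlMr// mulrC h2/=.
rewrite ler_pdivrMr// mulrDl mulVf ?gt_eqF// -natr1 lerD2r.
by rewrite (mulrC u).
Qed.

Lemma cvg_right_grid u : 0 <= u ->
  (forall m, u < right_grid m u) /\ right_grid m u @[m --> \oo] --> u.
Proof.
move=> u0; split; first by move=> m; have /andP[] := right_grid_itv m u0.
apply: (@squeeze_cvgr _ _ _ _ (fun=> u) (fun m => u + m.+1%:R^-1)).
- by apply: nearW => m; have /andP[/ltW -> ->] := right_grid_itv m u0.
- exact: cvg_cst.
- rewrite -[X in _ --> X]addr0; apply: cvgD; first exact: cvg_cst.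
  exact: cvg_harmonic.
Qed.

(** Right continuity makes the map the limit of [Y] evaluated at [right_grid]; there the time takes
    countably many values, each on a measurable set of points [z]. *)
Lemma measurable_fun_right_continuous (Y : R -> T -> R) (tau : U -> R) (f : U -> T) :
  measurable_fun setT tau -> measurable_fun setT f -> (forall z, 0 <= tau z) ->
  (forall u, 0 <= u -> measurable_fun setT (Y u)) ->
  (forall w u, 0 <= u -> Y s w @[s --> u^'+] --> Y u w) ->
  measurable_fun setT (fun z => Y (tau z) (f z)).
Proof.
move=> mtau mf tau0 mY cY.
apply: (@measurable_fun_cvg _ _ _ _ (fun m z => Y (right_grid m (tau z)) (f z))); last first.
  by move=> z _; move/cvg_at_rightP: (cY (f z) (tau z) (tau0 z)); apply; exact: cvg_right_grid.
move=> m.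
pose E k := [set z | Num.truncn (m.+1%:R * tau z) = k].
have ET : [set: U] = \bigcup_k E k.
  by apply/seteqP; split => // z _; exists (Num.truncn (m.+1%:R * tau z)).
have mE k : measurable (E k).
  have -> : E k = (fun z => m.+1%:R * tau z) @^-1` `[k%:R, k.+1%:R[%classic.
    apply/seteqP; split => z /=; rewrite in_itv/=.
      by move=> <-; apply: truncn_itv; rewrite mulr_ge0.
    by move=> h; exact: truncn_def.
  rewrite -[X in measurable X]setTI.
  have mm : measurable_fun setT (fun z => m.+1%:R * tau z) by exact: measurable_funM.
  exact: mm.
rewrite ET; apply/measurable_fun_bigcup => // k.
apply: (@eq_measurable_fun _ _ _ _ _ (fun z => Y (k.+1%:R / m.+1%:R) (f z))).
  by move=> z; rewrite inE /right_grid /E /= => ->.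
apply: measurable_funTS; apply: measurableT_comp => //.
by apply: mY; rewrite divr_ge0.
Qed.

End joint_measurability.

Section conditioning.
Local Open Scope ereal_scope.
Context d (Omega : measurableType d) (R : realType) (P : probability Omega R).

Lemma measurable_id_g_sigma (G : set (set Omega)) : G `<=` measurable ->
  measurable_fun setT (id : Omega -> g_sigma_algebraType G).
Proof.
move=> Gm _ A mA; rewrite setTI preimage_id.
by apply: (smallest_sub (sigma_algebra_measurable Omega) Gm).
Qed.

(** As densities with respect to [P], [y] and [z] induce the same measure on the sigma-algebra
    generated by [G]; [c] is measurable for it, as its type records, and may be integrated against
    either. *)
Lemma cond_expectation_mul (G : set (set Omega)) (z y : Omega -> R)
    (c : g_sigma_algebraType G -> R) :
  G `<=` measurable -> measurable_fun setT z -> (forall w, 0 <= z w)%R ->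
  is_cond_expectation P G (EFin \o z) (EFin \o y) ->
  measurable_fun setT c -> (forall w, 0 <= c w)%R ->
  \int[P]_w (c w * y w)%:E = \int[P]_w (c w * z w)%:E.
Proof.
move=> Gm mz z0 [my y0 yz] mc c0.
have mid := measurable_id_g_sigma Gm.
have my' : measurable_fun setT y.
  by apply/measurable_EFinP; exact: (measurableT_comp my mid).
have y0' w : (0 <= y w)%R by have := y0 w; rewrite /= lee_fin.
have [m1 m1E] := image_density P mid my' y0'.
have [m2 m2E] := image_density P mid mz z0.
transitivity (\int[m1]_w (c w)%:E).
  rewrite m1E.
  - by apply: eq_integral => w _; rewrite EFinM.
  - exact/measurable_EFinP.
  - by move=> w; rewrite lee_fin.
transitivity (\int[m2]_w (c w)%:E); last first.
  rewrite m2E.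
  - by apply: eq_integral => w _; rewrite EFinM.
  - exact/measurable_EFinP.
  - by move=> w; rewrite lee_fin.
apply: eq_measure_integral => A mA _.
have mA' : measurable (A : set Omega).
  by have := mid measurableT _ mA; rewrite setTI preimage_id.
have aux (m : {measure set (g_sigma_algebraType G) -> \bar R}) (p : Omega -> R) :
   (forall g, measurable_fun setT g -> (forall y, 0 <= g y) ->
    \int[m]_y g y = \int[P]_x (g x * (p x)%:E)) -> m A = \int[P]_(w in A) (p w)%:E.
  move=> mE; rewrite -(setIT A) -integral_indic// mE//; last first.
    by apply/measurable_EFinP; exact: measurable_indic.
  rewrite [RHS]integral_mkcond; apply: eq_integral => w _.
  by rewrite setIT epatch_indic muleC.
by rewrite (aux _ _ m1E) (aux _ _ m2E); exact: yz.
Qed.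

End conditioning.

Lemma integral_deriv_powR (R : realType) (th T : R) : 0 < th < 1 -> 0 <= T ->
  (\int[lebesgue_measure]_(s in `]0%R, T]) (th * s `^ (th - 1))%:E = (T `^ th)%:E)%E.
Proof.
move=> /andP[th0 th1] T0.
under eq_integral do rewrite EFinM.
rewrite ge0_integralZl_EFin ?ltW//.
- have -> : th - 1 = - (1 - th) by ring.
  rewrite integral_powRN//; last by apply/andP; split; lra.
  rewrite -EFinM; congr EFin; have -> : 1 - (1 - th) = th by ring.
  by rewrite mulrC divfK// gt_eqF.
- by move=> s _; rewrite lee_fin powR_ge0.
- by apply/measurable_EFinP/measurable_funTS; exact: measurable_powR.
Qed.

(** * The Laplace exponent as a function of time and of its parameter *)

Section laplace_exponent.
Context {R : realType}.
Notation mu := (@lebesgue_measure R).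

(* Laplace exponent [int_0^y la^(a u) du] of [sigma y] along a path on which
   the order [alpha (B u)] is [a u]. *)
Definition laplace_exponent (a : R -> R) (la y : R) : R :=
  primitive (fun u => la `^ a u) 0 y.

(** The derivative of [laplace_exponent] in [la], at fixed [y], taken under the integral sign. *)
Definition laplace_exponent_deriv (a : R -> R) (y la : R) : R :=
  \int[mu]_(u in `[0, y]) (a u * la `^ (a u - 1)).

Variable a : R -> R.
Hypotheses (ma : measurable_fun setT a) (a01 : forall u, 0 < a u < 1).

Lemma powR_order_itv (la th : R) : 0 < la -> 0 < th < 1 ->
  0 <= la `^ th <= Num.max 1 la.
Proof.
move=> la0 /andP[th0 th1]; rewrite powR_ge0/= le_max.
have [la1|la1] := leP la 1.
  by apply/orP; left; rewrite -[leRHS](powRr0 la) ger_powR ?la0//= ltW.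
by apply/orP; right; rewrite -[leRHS](powRr1 (ltW la0)) ler_powR// ltW.
Qed.

Lemma powR_order_ge (la th : R) : 0 < la -> 0 < th < 1 ->
  Num.min 1 la <= la `^ th.
Proof.
move=> la0 /andP[th0 th1]; rewrite ge_min.
have [la1|la1] := leP 1 la.
  by apply/orP; left; rewrite -[leLHS](powRr0 la) ler_powR// ltW.
by apply/orP; right; rewrite -[leLHS](powRr1 (ltW la0)) ger_powR ?la0//= ltW.
Qed.

Let mrate la : measurable_fun setT (fun u => la `^ a u).
Proof. by apply: measurable_powR2. Qed.

Let rate_itv la : 0 < la -> forall u, 0 <= la `^ a u <= Num.max 1 la.
Proof. by move=> la0 u; exact: powR_order_itv. Qed.

Lemma laplace_exponent0 la : laplace_exponent a la 0 = 0.
Proof. by rewrite /laplace_exponent /primitive set_itv1 Rintegral_set1. Qed.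

Lemma laplace_exponent_ge0 la y : 0 <= laplace_exponent a la y.
Proof. by apply: Rintegral_ge0 => u _; exact: powR_ge0. Qed.

Lemma laplace_exponentE la y : 0 < la ->
  (\int[mu]_(u in `[0%R, y]) (la `^ a u)%:E = (laplace_exponent a la y)%:E)%E.
Proof.
move=> la0; rewrite /laplace_exponent /primitive /Rintegral fineK//.
apply: integrable_fin_num => //.
exact: (integrable_itv_bounded _ _ _ _ (mrate la) (rate_itv la0)).
Qed.

Lemma laplace_exponent_split la v u : 0 < la -> 0 <= v -> v <= u ->
  laplace_exponent a la u =
  laplace_exponent a la v + primitive (fun u => la `^ a u) v u.
Proof.
by move=> la0 v0 vu; exact: (Rintegral_itv_split (mrate la) (rate_itv la0)).
Qed.

Lemma primitive_rate_ge la v u : 0 < la -> v <= u ->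
  (u - v) * Num.min 1 la <= primitive (fun u => la `^ a u) v u.
Proof.
move=> la0 vu.
have -> : (u - v) * Num.min 1 la = \int[mu]_(x in `[v, u]) Num.min 1 la.
  rewrite Rintegral_cst//= lebesgue_measure_itv/= lte_fin mulrC.
  case: ltP => //= uv; congr (_ * _); apply/eqP; rewrite subr_eq0 eq_le uv//.
have mI : measurable (`[v, u]%classic : set (measurableTypeR R)) by [].
have M0 : 0 <= Num.min 1 la by rewrite le_min ler01 ltW.
apply: (le_Rintegral mI).
- apply: (integrable_itv_bounded (c := cst (Num.min 1 la)) (M := Num.min 1 la)) => //.
  by move=> ?; rewrite lexx M0.
- exact: (integrable_itv_bounded _ _ _ _ (mrate la) (rate_itv la0)).
- by move=> x _; exact: powR_order_ge.
Qed.

Lemma laplace_exponent_ge la y : 0 < la -> 0 <= y ->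
  y * Num.min 1 la <= laplace_exponent a la y.
Proof. by move=> la0 y0; have := primitive_rate_ge la0 y0; rewrite subr0. Qed.

Lemma integral_rate_expN la v u : 0 < la -> 0 <= v -> v <= u ->
  (\int[mu]_(x in `[v, u]) (la `^ a x * expR (- laplace_exponent a la x))%:E =
   (expR (- laplace_exponent a la v) - expR (- laplace_exponent a la u))%:E)%E.
Proof.
move=> la0 v0 vu.
transitivity (\int[mu]_(x in `[v, u]) ((expR (- laplace_exponent a la v))%:E *
   (la `^ a x * expR (- primitive (fun u => la `^ a u) v x))%:E))%E.
  apply: eq_integral => x; rewrite inE/= in_itv/= => /andP[vx xu].
  by rewrite (laplace_exponent_split la0 v0 vx) opprD expRD -EFinM mulrCA.
have mC : measurable_fun setT (primitive (fun u => la `^ a u) v).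
  exact: (primitive_measurable _ (mrate la) (rate_itv la0)).
rewrite ge0_integralZl//.
- rewrite (integral_mul_expN_primitive (mrate la) (rate_itv la0) vu) -EFinM.
  rewrite mulrBr mulr1 -expRD -opprD -laplace_exponent_split//.
- apply/measurable_EFinP/measurable_funTS; apply: measurable_funM => //.
    exact: mrate.
  by apply: (measurableT_comp (@measurable_expR R)); exact: measurable_funN.
- by move=> x _; rewrite lee_fin mulr_ge0 ?powR_ge0 ?expR_ge0.
Qed.

(** The exponent grows at least like [y min(1, la)], so the boundary term at infinity vanishes. *)
Lemma integral_rate_expN_tail la v : 0 < la -> 0 <= v ->
  (\int[mu]_(x in `[v, +oo[) (la `^ a x * expR (- laplace_exponent a la x))%:E =
   (expR (- laplace_exponent a la v))%:E)%E.
Proof.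
move=> la0 v0.
have mC : measurable_fun setT (laplace_exponent a la).
  exact: (primitive_measurable _ (mrate la) (rate_itv la0)).
have bE : \bigcup_n `[v, v + n%:R]%classic = `[v, +oo[%classic.
  apply/seteqP; split => x /=; first by move=> [n _]/=; rewrite !in_itv/= andbT => /andP[].
  rewrite in_itv/= andbT => vx; exists (Num.truncn (x - v)).+1 => //=.
  by rewrite in_itv/= vx/= -lerBlDl ltW// truncnS_gt.
have h1 : (\int[mu]_(x in `[v, (v + n%:R)%R]) (la `^ a x * expR (- laplace_exponent a la x))%:E
   @[n --> \oo] -->
   \int[mu]_(x in `[v, +oo[) (la `^ a x * expR (- laplace_exponent a la x))%:E)%E.
  rewrite -bE; apply: ge0_nondecreasing_set_cvg_integral => //.
  - apply/nondecreasing_seqP => n; rewrite subsetEset => x /=.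
    rewrite !in_itv/= => /andP[-> xn]; rewrite (le_trans xn)// lerD2l ler_nat//.
  - move=> n; apply/measurable_EFinP/measurable_funTS; apply: measurable_funM => //.
      exact: mrate.
    by apply: (measurableT_comp (@measurable_expR R)); exact: measurable_funN.
  - by move=> n x _; rewrite lee_fin mulr_ge0 ?powR_ge0 ?expR_ge0.
have h2 : (expR (- laplace_exponent a la v) -
    expR (- laplace_exponent a la (v + n%:R)))%:E @[n --> \oo] -->
    (expR (- laplace_exponent a la v))%:E.
  apply: cvg_EFin; first by apply: nearW.
  rewrite -[X in _ --> X]subr0; apply: cvgB; first exact: cvg_cst.
  have m0 : 0 < Num.min 1 la by rewrite lt_min ltr01 la0.
  apply: (@squeeze_cvgr _ _ _ _ (fun=> 0) (fun n => (Num.min 1 la)^-1 * n%:R^-1)).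
  - near=> n; rewrite expR_ge0/=.
    have n0 : (0 < n)%N by near: n; exists 1%N.
    rewrite expRN -invfM lef_pV2 ?posrE ?expR_gt0 ?mulr_gt0 ?ltr0n//.
    apply: le_trans (expR_ge1Dx _).
    have : n%:R * Num.min 1 la <= laplace_exponent a la (v + n%:R).
      apply: le_trans (laplace_exponent_ge la0 _); last by rewrite addr_ge0.
      by apply: ler_wpM2r; [exact: ltW|rewrite lerDr].
    lra.
  - exact: cvg_cst.
  - rewrite -(mulr0 (Num.min 1 la)^-1); apply: cvgMl_tmp.
    by rewrite -cvg_shiftS; exact: cvg_harmonic.
have e n : (\int[mu]_(x in `[v, (v + n%:R)%R]) (la `^ a x * expR (- laplace_exponent a la x))%:E =
  (expR (- laplace_exponent a la v) - expR (- laplace_exponent a la (v + n%:R)))%:E)%E.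
  by apply: integral_rate_expN => //; rewrite lerDl.
move: h1; under eq_fun do rewrite e.
by move=> h1; exact: (cvg_unique _ h1 h2).
Unshelve. all: by end_near. Qed.

Lemma laplace_exponent_derivE y la : 0 < la ->
  (\int[mu]_(u in `[0%R, y]) (a u * la `^ (a u - 1))%:E =
   (laplace_exponent_deriv a y la)%:E)%E.
Proof.
move=> la0; rewrite /laplace_exponent_deriv /Rintegral fineK//.
apply: integrable_fin_num => //.
apply: (@integrable_itv_bounded _ (fun u => a u * la `^ (a u - 1)) (Num.max 1 la / la)).
  by apply: measurable_funM => //; apply: measurable_powR2 => //; exact: measurable_funB.
move=> u; have /andP[a0 a1] := a01 u.
have -> : la `^ (a u - 1) = la `^ a u / la.
  by rewrite powRB ?(gt_eqF la0) ?implybT// (powRr1 (ltW la0)).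
apply/andP; split; first by rewrite !mulr_ge0 ?powR_ge0 ?invr_ge0 ?ltW.
rewrite mulrA ler_pM2r ?invr_gt0//.
have /andP[_ h] := powR_order_itv la0 (a01 u).
by rewrite (le_trans _ h)// ler_piMl ?powR_ge0// ltW.
Qed.

(* Tonelli and [int_0^la (a u) s^(a u - 1) ds = la^(a u)]. *)
Lemma laplace_exponent_integral y la : 0 <= y -> 0 < la ->
  (\int[mu]_(s in `]0%R, la]) (laplace_exponent_deriv a y s)%:E =
   (laplace_exponent a la y)%:E)%E.
Proof.
move=> y0 la0.
set Y := [set` `[0, y]]; set L := [set` `]0, la]].
pose M := measurableTypeR R.
have mL : measurable (L : set M) by exact: measurable_itv.
have mY : measurable (Y : set M) by exact: measurable_itv.
pose f (z : M * M) : \bar R := (a z.2 * z.1 `^ (a z.2 - 1) * (\1_L z.1 * \1_Y z.2))%:E.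
have mf : measurable_fun setT f.
  have ma2 : measurable_fun setT (fun z : M * M => a z.2).
    exact: (measurableT_comp ma measurable_snd).
  apply/measurable_EFinP; apply: measurable_funM; apply: measurable_funM => //.
  - by apply: measurable_powR2; [exact: measurable_fst|exact: measurable_funB].
  - exact: (measurableT_comp (measurable_indic mL) measurable_fst).
  - exact: (measurableT_comp (measurable_indic mY) measurable_snd).
have f0 z : (0 <= f z)%E.
  by have /andP[/ltW a0 _] := a01 z.2; rewrite lee_fin !mulr_ge0 ?powR_ge0.
have := fubini_tonelli (m1 := mu) (m2 := mu) f mf f0.
rewrite /fubini_F /fubini_G => H.
transitivity (\int[mu]_s \int[mu]_u f (s, u))%E.
  rewrite [LHS]integral_mkcond; apply: eq_integral => s _.
  rewrite patchE; case: ifPn => sL; last first.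
    by apply/esym/integral0_eq => u _; rewrite /f/= indicE (negbTE sL) mul0r mulr0.
  have s0 : 0 < s by move: sL; rewrite /L inE/= in_itv/= => /andP[].
  rewrite -(laplace_exponent_derivE y s0) integral_mkcond; apply: eq_integral => u _.
  rewrite epatch_indic /f/= [\1_L _]indicE sL mul1r.
  by rewrite -EFinM.
rewrite H -(laplace_exponentE y la0) [RHS]integral_mkcond; apply: eq_integral => u _.
rewrite patchE; case: ifPn => uY; last first.
  by apply/integral0_eq => s _; rewrite /f/= [\1_Y _]indicE (negbTE uY) !mulr0.
rewrite -(integral_deriv_powR (a01 u) (ltW la0)) [RHS]integral_mkcond.
apply: eq_integral => s _.
by rewrite epatch_indic /f/= [\1_Y _]indicE uY mulr1 -!EFinM.
Qed.

Lemma laplace_exponent_deriv_ge0 y s : 0 <= laplace_exponent_deriv a y s.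
Proof.
apply: Rintegral_ge0 => u _; rewrite mulr_ge0 ?powR_ge0//.
by have /andP[/ltW] := a01 u.
Qed.

Lemma measurable_laplace_exponent_deriv y :
  measurable_fun setT (laplace_exponent_deriv a y).
Proof.
pose M := measurableTypeR R.
have mY : measurable (`[0, y]%classic : set M) by exact: measurable_itv.
pose f (z : M * M) : \bar R :=
  (a z.2 * z.1 `^ (a z.2 - 1) * \1_(`[0, y]%classic) z.2)%:E.
have ma2 : measurable_fun setT (fun z : M * M => a z.2).
  exact: (measurableT_comp ma measurable_snd).
have mf : measurable_fun setT f.
  apply/measurable_EFinP; apply: measurable_funM; first apply: measurable_funM => //.
  - by apply: measurable_powR2; [exact: measurable_fst|exact: measurable_funB].
  - exact: (measurableT_comp (measurable_indic mY) measurable_snd).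
have f0 z : (0 <= f z)%E.
  by have /andP[/ltW a0 _] := a01 z.2; rewrite lee_fin !mulr_ge0 ?powR_ge0.
have mF := measurable_fun_fubini_tonelli_F (m2 := mu) f mf f0.
have := measurableT_comp (fine_measurable measurableT) mF.
apply: eq_measurable_fun => s _ /=.
rewrite /laplace_exponent_deriv /Rintegral /fubini_F; congr fine.
by rewrite [RHS]integral_mkcond; apply: eq_integral => u _; rewrite epatch_indic.
Qed.

Lemma laplace_exponent_deriv_le y s : 0 <= y -> 1 <= s ->
  laplace_exponent_deriv a y s <= y.
Proof.
move=> y0 s1; have s0 : 0 < s by rewrite (lt_le_trans ltr01).
rewrite -lee_fin -laplace_exponent_derivE//.
have -> : y%:E = (\int[mu]_(u in `[0%R, y]) 1)%E.
  rewrite integral_cst//= mul1e lebesgue_measure_itv/= lte_fin.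
  case: ltP => [_|y0']; first by rewrite -EFinB subr0.
  by congr EFin; apply/eqP; rewrite eq_le y0 y0'.
apply: ge0_le_integral => //.
- by move=> u _; have /andP[/ltW a0 _] := a01 u; rewrite lee_fin mulr_ge0 ?powR_ge0.
- apply/measurable_EFinP/measurable_funTS; apply: measurable_funM => //.
  by apply: measurable_powR2 => //; exact: measurable_funB.
- move=> u _; have /andP[a0 a1] := a01 u.
  rewrite lee_fin; apply: mulr_ile1; rewrite ?powR_ge0//; [exact: ltW|exact: ltW|].
  rewrite -opprB powRN invf_le1 ?powR_gt0//.
  by rewrite -[leLHS](powRr0 s) ler_powR// subr_ge0 ltW.
Qed.

(** The derivative in [la] may blow up at 0 but is at most [y] from 1 onwards. This is the reason
    for [1 <= p], and for testing the Palm formula on the parameters in [[j + 1, j + 2]]. *)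
Lemma integral_deriv_expN y p q : 0 <= y -> 1 <= p -> p <= q ->
  (\int[mu]_(s in `[p, q])
     (laplace_exponent_deriv a y s * expR (- laplace_exponent a s y))%:E =
   (expR (- laplace_exponent a p y) - expR (- laplace_exponent a q y))%:E)%E.
Proof.
move=> y0 p1 pq.
have p0 : 0 < p by rewrite (lt_le_trans ltr01).
(* Frozen below 1 so as to be bounded on all of [R], as the results on primitives require. *)
pose c s := laplace_exponent_deriv a y (Num.max 1 s).
have cE s : 1 <= s -> c s = laplace_exponent_deriv a y s.
  by move=> s1; rewrite /c (max_r s1).
have mc : measurable_fun setT c.
  apply: (measurableT_comp (measurable_laplace_exponent_deriv y)).
  exact: measurable_maxr.
have cM s : 0 <= c s <= y.
  by rewrite laplace_exponent_deriv_ge0 laplace_exponent_deriv_le// le_max lexx.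
have md := measurable_laplace_exponent_deriv y.
have eE s : p <= s -> laplace_exponent a s y = laplace_exponent a p y + primitive c p s.
  move=> ps; have s0 := lt_le_trans p0 ps.
  apply: EFin_inj; rewrite EFinD -(laplace_exponent_integral y0 s0) -(laplace_exponent_integral y0 p0).
  have -> : `]0, s]%classic = `]0, p]%classic `|` `]p, s]%classic :> set R.
    apply/seteqP; split => x /=; rewrite !in_itv/=.
      by move=> /andP[x0 xs]; have [xp|xp] := leP x p; [left|right]; rewrite ?x0.
    move=> [/andP[-> xp]|/andP[px ->]]; first by rewrite (le_trans xp).
    by rewrite (lt_trans p0).
  rewrite ge0_integral_setU//; first last.
  - apply/disj_setPS => x /= []; rewrite !in_itv/= => /andP[_ xp] /andP[px _].
    by move: px; rewrite ltNge xp.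
  - by move=> x _; rewrite lee_fin laplace_exponent_deriv_ge0.
  - by apply/measurable_EFinP/measurable_funTS.
  congr (_ + _)%E.
  rewrite /primitive /Rintegral fineK; last first.
    by apply: integrable_fin_num => //; exact: (integrable_itv_bounded _ _ _ _ mc cM).
  rewrite -integral_itv_obnd_cbnd; last first.
    by apply/measurable_EFinP/measurable_funTS; exact: mc.
  apply: eq_integral => x.
  rewrite inE/= in_itv/= => /andP[px _].
  by rewrite /comp cE// (le_trans p1)// ltW.
transitivity (\int[mu]_(s in `[p, q]) ((expR (- laplace_exponent a p y))%:E *
   (c s * expR (- primitive c p s))%:E))%E.
  apply: eq_integral => x; rewrite inE/= in_itv/= => /andP[px xq].
  by rewrite (eE x px) cE ?(le_trans p1)// opprD expRD -EFinM mulrCA.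
rewrite ge0_integralZl_EFin ?expR_ge0//.
- rewrite (integral_mul_expN_primitive mc cM pq) -EFinM.
  by rewrite mulrBr mulr1 -expRD -opprD -eE.
- move=> x _; rewrite lee_fin mulr_ge0 ?expR_ge0//.
  by have /andP[] := cM x.
- apply/measurable_EFinP/measurable_funTS; apply: measurable_funM.
    exact: mc.
  apply: (measurableT_comp (@measurable_expR R)); apply: measurable_funN.
  exact: (primitive_measurable _ mc cM).
Qed.

End laplace_exponent.

(** * Functionals of the Brownian path and the conditional Laplace transform *)

Section path_space.
Context {R : realType} {d : measure_display} {Omega : measurableType d}.
Variables (P : probability Omega R) (alpha : R -> R) (B sigma : R -> Omega -> R).
Hypotheses (malpha : measurable_fun setT alpha) (alpha01 : forall x, 0 < alpha x < 1).
Hypotheses (hB : is_brownian_motion P B)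
  (hS : is_variable_order_subordinator P alpha B sigma).
Notation mu := (@lebesgue_measure R).
Notation M := (measurableTypeR R).
Notation OB := (g_sigma_algebraType (past B +oo%E)).

(** Frozen at [B 0] for negative times, where [B] is not constrained, so that joint measurability
    holds over all of [R]. *)
Definition bpos (u : R) (w : Omega) : R := B (Num.max 0 u) w.

Definition order_path (w : Omega) (u : R) : R := alpha (bpos u w).

(** This is [Phi_y(la)] along the path [w]. *)
Definition path_exponent (la y : R) (w : Omega) : R :=
  laplace_exponent (order_path w) la y.

Lemma past_measurable (T : \bar R) : past B T `<=` measurable.
Proof.
move=> _ [u [u0 _ [E mE <-]]]; exact: (bm_measurable hB u0).
Qed.

Lemma measurable_past_bm (T : \bar R) u : 0 <= u -> (u%:E <= T)%E ->
  measurable_fun setT (B u : g_sigma_algebraType (past B T) -> R).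
Proof.
move=> u0 uT _ E mE; apply: sub_sigma_algebra.
by exists u; split => //; exists E.
Qed.

Lemma measurable_idOB : measurable_fun setT (id : Omega -> OB).
Proof. exact: measurable_id_g_sigma (@past_measurable _). Qed.

Lemma bm_right_continuous w u : 0 <= u -> B s w @[s --> u^'+] --> B u w.
Proof.
move=> u0; have /continuous_within_itvcyP [cin c0] := bm_continuous hB (w := w).
have [->|un0] := eqVneq u 0; first exact: c0.
apply: cvg_at_right_filter; apply: cin.
by rewrite in_itv/= andbT lt_neqAle eq_sym un0.
Qed.

Lemma measurable_bpos d' (Z : measurableType d') (f : Z -> OB) (tau : Z -> R) :
  measurable_fun setT f -> measurable_fun setT tau ->
  measurable_fun setT (fun z => bpos (tau z) (f z)).
Proof.
move=> mf mtau.
apply: (@measurable_fun_right_continuous _ OB _ Z R B (fun z => Num.max 0 (tau z)) f) => //.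
- exact: measurable_maxr.
- by move=> z; rewrite le_max lexx.
- by move=> u u0; apply: measurable_past_bm => //; rewrite leey.
- exact: bm_right_continuous.
Qed.

Lemma measurable_order_path d' (Z : measurableType d') (f : Z -> OB) (tau : Z -> R) :
  measurable_fun setT f -> measurable_fun setT tau ->
  measurable_fun setT (fun z => order_path (f z) (tau z)).
Proof. by move=> mf mtau; apply: (measurableT_comp malpha); exact: measurable_bpos. Qed.

Lemma measurable_order_path1 w : measurable_fun setT (order_path w).
Proof. by apply: (@measurable_order_path _ R (fun=> w) id). Qed.

Lemma order_path01 w u : 0 < order_path w u < 1.
Proof. exact: alpha01. Qed.

(** The domain of integration [[0, y z]] varies with [z]; written with two indicators it becomes
    part of a single jointly measurable integrand. *)
Lemma measurable_path_exponent d' (Z : measurableType d') (f : Z -> OB) (la y : Z -> R) :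
  measurable_fun setT f -> measurable_fun setT la -> measurable_fun setT y ->
  measurable_fun setT (fun z => path_exponent (la z) (y z) (f z)).
Proof.
move=> mf mla my.
pose F (x : Z * M) : \bar R :=
  (la x.1 `^ order_path (f x.1) x.2 * (\1_(`[0, +oo[%classic) x.2 * \1_(`[0, +oo[%classic) (y x.1 - x.2)))%:E.
have mpos : measurable (`[0, +oo[%classic : set R) by exact: measurable_itv.
have mF : measurable_fun setT F.
  apply/measurable_EFinP; apply: measurable_funM; last apply: measurable_funM.
  - apply: measurable_powR2; first exact: (measurableT_comp mla measurable_fst).
    apply: measurable_order_path; first exact: (measurableT_comp mf measurable_fst).
    exact: measurable_snd.
  - exact: (measurableT_comp (measurable_indic mpos) measurable_snd).
  - apply: (measurableT_comp (measurable_indic mpos)).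
    apply: measurable_funB; first exact: (measurableT_comp my measurable_fst).
    exact: measurable_snd.
have F0 x : (0 <= F x)%E by rewrite lee_fin !mulr_ge0 ?powR_ge0.
have := measurableT_comp (fine_measurable measurableT)
  (measurable_fun_fubini_tonelli_F (m2 := mu) F mF F0).
apply: eq_measurable_fun => z _ /=.
rewrite /path_exponent /laplace_exponent /primitive /Rintegral /fubini_F; congr fine.
rewrite [RHS]integral_mkcond; apply: eq_integral => u _; rewrite epatch_indic /F /=.
rewrite -EFinM; congr (_ * _)%:E; rewrite !indicE -natrM mulnb; congr ((_ : bool)%:R).
apply/andP/idP; rewrite !inE/= !in_itv/= ?andbT subr_ge0; first by move=> [-> ->].
by move=> /andP[].
Qed.

Lemma measurable_sigma d' (Z : measurableType d') (f : Z -> Omega) (tau : Z -> R) :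
  measurable_fun setT f -> measurable_fun setT tau ->
  measurable_fun setT (fun z => sigma (Num.max 0 (tau z)) (f z)).
Proof.
move=> mf mtau.
apply: (@measurable_fun_right_continuous _ Omega _ Z R sigma (fun z => Num.max 0 (tau z)) f) => //.
- exact: measurable_maxr.
- by move=> z; rewrite le_max lexx.
- by move=> u u0; exact: (sg_measurable hS).
- by move=> w u u0; exact: (sg_right_continuous hS).
Qed.

Lemma sigma_ge0 y w : 0 <= y -> 0 <= sigma y w.
Proof.
rewrite le_eqVlt => /predU1P[<-|y0]; first by rewrite (sg_start hS).
by rewrite -(sg_start hS w) ltW// (sg_increasing hS).
Qed.

Lemma path_exponent_primitive la y w :
  \int[mu]_(u in `[0, y]) (la `^ alpha (B u w)) = path_exponent la y w.
Proof.
apply: eq_Rintegral => u; rewrite inE/= in_itv/= => /andP[u0 _].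
by rewrite /order_path /bpos (max_r u0).
Qed.

(** Conditioning on the whole path of [B], so that [c] may be any nonnegative functional of that
    path; this is how the law of [sigma] enters the computations below. *)
Lemma conditional_laplace (c : OB -> R) la y : 0 < la -> 0 <= y ->
  measurable_fun setT c -> (forall w, 0 <= c w) ->
  (\int[P]_w (c w * expR (- path_exponent la y w))%:E =
   \int[P]_w (c w * expR (- (la * sigma y w)))%:E)%E.
Proof.
move=> la0 y0 mc c0.
have mz : measurable_fun setT (fun w => expR (- (la * sigma y w))).
  apply: (measurableT_comp (@measurable_expR R)); apply: measurable_funN.
  by apply: measurable_funM => //; exact: (sg_measurable hS).
have z0 w : 0 <= expR (- (la * sigma y w)) by exact: expR_ge0.
have e : (fun w => (expR (- \int[mu]_(u in `[0, y]) (la `^ alpha (B u w))))%:E) =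
         EFin \o (fun w => expR (- path_exponent la y w)).
  by apply/funext => w; rewrite path_exponent_primitive.
have := sg_laplace hS la0 y0 (leey y%:E); rewrite e => h.
exact: (cond_expectation_mul (@past_measurable _) mz z0 h mc c0).
Qed.

End path_space.

(* In the library the canonical [SigmaFiniteMeasure] structure of [m1 \x m2] is
   found only for subprobabilities, hence the existential form. *)
Lemma sigma_finite_product d1 d2 (T1 : measurableType d1) (T2 : measurableType d2)
    (R : realType) (m1 : {sigma_finite_measure set T1 -> \bar R})
    (m2 : {sigma_finite_measure set T2 -> \bar R}) :
  exists m : {sigma_finite_measure set (T1 * T2)%type -> \bar R},
    forall G : T1 * T2 -> \bar R, measurable_fun setT G -> (forall x, 0 <= G x)%E ->
      (\int[m]_x G x = \int[m1]_x \int[m2]_y G (x, y))%E.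
Proof.
have sf : sigma_finite setT (m1 \x m2)%E.
  have /sigma_finiteP[F [TF ndF Foo]] := sigma_finiteT m1.
  have /sigma_finiteP[G [TG ndG Goo]] := sigma_finiteT m2.
  exists (fun n => F n `*` G n).
    rewrite -setXTT TF TG predeqE => -[x y]; split.
      move=> [/= [n _ Fnx] [k _ Gky]]; exists (maxn n k) => //; split.
      - by move: x Fnx; exact/subsetPset/ndF/leq_maxl.
      - by move: y Gky; exact/subsetPset/ndG/leq_maxr.
    by move=> [n _ []/= ? ?]; split; exists n.
  move=> k; have [? ?] := Foo k; have [? ?] := Goo k.
  split; first exact: measurableX.
  by rewrite product_measure1E// lte_mul_pinfty// ge0_fin_numE.
pose mix := Measure_isSigmaFinite.Build _ _ _ (m1 \x m2)%E sf.
pose m : {sigma_finite_measure set (T1 * T2)%type -> \bar R} :=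
  HB.pack (m1 \x m2)%E mix.
exists m => G mG G0.
exact: (@fubini_tonelli1 _ _ _ _ _ m1 m2 G mG G0).
Qed.

(** * Stable Levy densities weighted by the jump size *)

Section levy_weight.
Context {R : realType}.
Notation mu := (@lebesgue_measure R).
Notation M := (measurableTypeR R).

Lemma measurable_Gamma : measurable_fun setT (@Gamma R).
Proof.
have mpos : measurable (`]0, +oo[%classic : set M) by exact: measurable_itv.
pose f (x : R * M) : \bar R :=
  (x.2 `^ (x.1 - 1) * expR (- x.2) * \1_(`]0, +oo[%classic) x.2)%:E.
have mf : measurable_fun setT f.
  apply/measurable_EFinP; apply: measurable_funM; first apply: measurable_funM.
  - by apply: measurable_powR2; [exact: measurable_snd|exact: measurable_funB].
  - by apply: (measurableT_comp (@measurable_expR R)); apply: measurable_funN.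
  - exact: (measurableT_comp (measurable_indic mpos) measurable_snd).
have f0 x : (0 <= f x)%E by rewrite lee_fin !mulr_ge0 ?powR_ge0 ?expR_ge0.
have := measurableT_comp (fine_measurable measurableT)
  (measurable_fun_fubini_tonelli_F (m2 := mu) f mf f0).
apply: eq_measurable_fun => z _ /=.
rewrite /Gamma /Rintegral /fubini_F; congr fine.
by rewrite [RHS]integral_mkcond; apply: eq_integral => u _; rewrite epatch_indic.
Qed.

Lemma measurable_stable_tail d (T : measurableType d) (f g : T -> R) :
  measurable_fun setT f -> measurable_fun setT g ->
  (forall x, 0 < f x < 1) ->
  measurable_fun setT (fun x => stable_tail (f x) (g x)).
Proof.
move=> mf mg f01; rewrite /stable_tail.
have mpos : measurable (`]0, +oo[%classic : set R) by exact: measurable_itv.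
apply: measurable_funM; first exact: (measurableT_comp (measurable_indic mpos) mg).
apply: measurable_funM; first by apply: measurable_powR2 => //; exact: measurable_funN.
have mG : measurable_fun setT (fun x => Gamma (1 - f x)).
  by apply: (measurableT_comp measurable_Gamma); exact: measurable_funB.
have -> : (fun x => (Gamma (1 - f x))^-1) = (fun x => Gamma (1 - f x) `^ (-1)).
  apply/funext => x; rewrite powR_inv1//.
  have /andP[/ltW a0 a1] := f01 x.
  by have [|_ /ltW//] := @Gamma_integral R (f x); rewrite a0.
exact: measurable_powR2.
Qed.

Lemma stable_tail_le0 (th s : R) : s <= 0 -> stable_tail th s = 0.
Proof.
move=> s0; rewrite /stable_tail indicE memNset ?mul0r//= in_itv/= andbT.
by apply/negP; rewrite -leNgt.
Qed.

(* [s] times the density of the Levy measure of order [th]. *)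
Definition levy_weight (th s : R) : R := th * stable_tail th s.

Lemma levy_weight_ge0 th s : 0 < th < 1 -> 0 <= levy_weight th s.
Proof.
move=> /andP[th0 th1]; apply: mulr_ge0; first exact: ltW.
by apply: stable_tail_ge0; rewrite ltW.
Qed.

Lemma measurable_levy_weight d (T : measurableType d) (f g : T -> R) :
  measurable_fun setT f -> measurable_fun setT g ->
  (forall x, 0 < f x < 1) ->
  measurable_fun setT (fun x => levy_weight (f x) (g x)).
Proof.
by move=> mf mg f01; apply: measurable_funM => //; exact: measurable_stable_tail.
Qed.

(** [th la^(th - 1)] is the derivative of [la^th]: weighting the Levy measure by the jump size
    differentiates the Laplace exponent. *)
Lemma laplace_levy_weight (th la : R) : 0 < th < 1 -> 0 < la ->
  (\int[mu]_s (levy_weight th s * expR (- (la * s)))%:E = (th * la `^ (th - 1))%:E)%E.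
Proof.
move=> th01 la0; have /andP[th0 th1] := th01.
have th01' : 0 <= th < 1 by rewrite ltW.
rewrite /levy_weight.
under eq_integral do rewrite -mulrA EFinM.
rewrite ge0_integralZl_EFin ?laplace_stable_tail// ?ltW//.
- by move=> s _; rewrite lee_fin mulr_ge0 ?expR_ge0// stable_tail_ge0.
- apply/measurable_EFinP; apply: measurable_funM.
    by apply: (@measurable_stable_tail _ R (cst th) id).
  apply: (measurableT_comp (@measurable_expR R)); apply: measurable_funN.
  exact: measurable_funM.
Qed.

Lemma integral_expN_itv (z p q : R) : 0 < z -> p <= q ->
  (\int[mu]_(eta in `[p, q]) (expR (- (eta * z)))%:E =
   ((expR (- (p * z)) - expR (- (q * z))) / z)%:E)%E.
Proof.
move=> z0 pq.
have primE u : p <= u -> primitive (cst z) p u = z * (u - p).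
  move=> pu; rewrite /primitive Rintegral_cst//= lebesgue_measure_itv/= lte_fin.
  case: ltP => //= up; congr (_ * _); apply/eqP; rewrite eq_sym subr_eq0 eq_le up//.
have h := @integral_mul_expN_primitive R (cst z) z p q.
transitivity (\int[mu]_(eta in `[p, q]) ((expR (- (p * z)) / z)%:E *
   (z * expR (- primitive (cst z) p eta))%:E))%E.
  apply: eq_integral => x; rewrite inE/= in_itv/= => /andP[px xq].
  rewrite primE// -EFinM; congr EFin.
  have -> : - (x * z) = - (p * z) + - (z * (x - p)) by ring.
  by rewrite expRD; field; rewrite gt_eqF.
rewrite ge0_integralZl_EFin.
- rewrite h//; last by move=> u /=; rewrite lexx ltW.
  rewrite primE// -EFinM; congr EFin.
  have -> : - (q * z) = - (p * z) + - (z * (q - p)) by ring.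
  by rewrite expRD; field; rewrite gt_eqF.
- by [].
- by move=> x _; rewrite lee_fin mulr_ge0 ?expR_ge0 ?ltW.
- apply/measurable_EFinP/measurable_funTS; apply: measurable_funM => //.
  apply: (measurableT_comp (@measurable_expR R)); apply: measurable_funN.
  apply: (@primitive_measurable _ (cst z) z) => //.
  by move=> u /=; rewrite lexx ltW.
- by rewrite divr_ge0 ?expR_ge0 ?ltW.
Qed.

End levy_weight.

(** * The Palm formula for the jumps of [sigma] *)

Section palm_formula.
Context {R : realType} {d : measure_display} {Omega : measurableType d}.
Variables (P : probability Omega R) (alpha : R -> R) (B sigma : R -> Omega -> R).
Hypotheses (malpha : measurable_fun setT alpha) (alpha01 : forall x, 0 < alpha x < 1).
Hypotheses (hB : is_brownian_motion P B)
  (hS : is_variable_order_subordinator P alpha B sigma).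
Notation mu := (@lebesgue_measure R).
Notation M := (measurableTypeR R).
Notation OB := (g_sigma_algebraType (past B +oo%E)).

Lemma measurable_path_deriv (y : R) d' (Z : measurableType d') (f : Z -> OB) (eta : Z -> R) :
  measurable_fun setT f -> measurable_fun setT eta ->
  measurable_fun setT (fun z => laplace_exponent_deriv (order_path alpha B (f z)) y (eta z)).
Proof.
move=> mf meta.
have mY : measurable (`[0, y]%classic : set M) by exact: measurable_itv.
pose F (x : Z * M) : \bar R := (order_path alpha B (f x.1) x.2 *
   eta x.1 `^ (order_path alpha B (f x.1) x.2 - 1) * \1_(`[0, y]%classic) x.2)%:E.
have mo : measurable_fun setT (fun x : Z * M => order_path alpha B (f x.1) x.2).
  apply: (measurable_order_path malpha hB); last exact: measurable_snd.
  exact: (measurableT_comp mf measurable_fst).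
have mF : measurable_fun setT F.
  apply/measurable_EFinP; apply: measurable_funM; first apply: measurable_funM => //.
  - apply: measurable_powR2; last exact: measurable_funB.
    exact: (measurableT_comp meta measurable_fst).
  - exact: (measurableT_comp (measurable_indic mY) measurable_snd).
have F0 x : (0 <= F x)%E.
  have /andP[/ltW a0 _] := order_path01 B alpha01 (f x.1) x.2.
  by rewrite lee_fin !mulr_ge0 ?powR_ge0.
have := measurableT_comp (fine_measurable measurableT)
  (measurable_fun_fubini_tonelli_F (m2 := mu) F mF F0).
apply: eq_measurable_fun => z _ /=.
rewrite /laplace_exponent_deriv /Rintegral /fubini_F; congr fine.
by rewrite [RHS]integral_mkcond; apply: eq_integral => u _; rewrite epatch_indic.
Qed.

Lemma tonelli_path (F : (Omega * M) * M -> \bar R) (m : {measure set (Omega * M)%type -> \bar R}) :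
  (forall G : Omega * M -> \bar R, measurable_fun setT G -> (forall x, 0 <= G x)%E ->
      (\int[m]_x G x = \int[P]_x \int[mu]_y G (x, y))%E) ->
  measurable_fun setT F -> (forall x, 0 <= F x)%E ->
  (\int[m]_x \int[mu]_s F (x, s) = \int[P]_w \int[mu]_u \int[mu]_s F (w, u, s))%E.
Proof.
move=> mE mF F0; rewrite mE//.
- exact: (@measurable_fun_fubini_tonelli_F _ _ _ _ _ mu F mF F0).
- by move=> x; apply: integral_ge0.
Qed.

(* [e^(-j z) jump_tilt z] is [int_(j+1)^(j+2) e^(-eta z) d eta] for [z > 0]. *)
Definition jump_tilt (z : R) : R :=
  expR (- Num.max 0 z) * (1 - expR (- Num.max 0 z)) * Num.max 0 z `^ (-1).

(** For [z > 0] its product with [jump_tilt z] is 1 and its product with [e^(-z) (1 - e^(-z))] is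
    [z]; its value at 0 is 0. *)
Definition jump_untilt (z : R) : R :=
  Num.max 0 z * expR (Num.max 0 z) * (1 - expR (- Num.max 0 z)) `^ (-1).

Lemma one_sub_expN_pos (z : R) : 0 < z -> 0 < 1 - expR (- z).
Proof. by move=> z0; rewrite subr_gt0 expR_lt1 oppr_lt0. Qed.

Lemma jump_tiltE (z : R) : 0 < z -> jump_tilt z = expR (- z) * (1 - expR (- z)) / z.
Proof. by move=> z0; rewrite /jump_tilt (max_r (ltW z0)) powR_inv1// ltW. Qed.

Lemma jump_untiltE (z : R) : 0 <= z ->
  jump_untilt z * (expR (- z) * (1 - expR (- z))) = z.
Proof.
rewrite le_eqVlt => /predU1P[<-|z0]; first by rewrite /jump_untilt maxxx !mul0r.
have h := one_sub_expN_pos z0.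
rewrite /jump_untilt (max_r (ltW z0)) powR_inv1 ?(ltW h)// expRN.
have e1 : 1 < expR z by rewrite expR_gt1.
by field; rewrite subr_eq0 !gt_eqF// expR_gt0.
Qed.

Lemma measurable_jump_tilt : measurable_fun setT jump_tilt.
Proof.
have mm : measurable_fun setT (fun z : R => Num.max 0 z) by exact: measurable_maxr.
have me : measurable_fun setT (fun z : R => expR (- Num.max 0 z)).
  by apply: (measurableT_comp (@measurable_expR R)); apply: measurable_funN.
apply: measurable_funM; first by apply: measurable_funM => //; exact: measurable_funB.
exact: measurable_powR2.
Qed.

Lemma measurable_jump_untilt : measurable_fun setT jump_untilt.
Proof.
have mm : measurable_fun setT (fun z : R => Num.max 0 z) by exact: measurable_maxr.
have me : measurable_fun setT (fun z : R => expR (- Num.max 0 z)).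
  by apply: (measurableT_comp (@measurable_expR R)); apply: measurable_funN.
apply: measurable_funM.
  by apply: measurable_funM => //; exact: (measurableT_comp (@measurable_expR R)).
by apply: measurable_powR2 => //; exact: measurable_funB.
Qed.

Lemma jump_tilt_ge0 z : 0 <= jump_tilt z.
Proof.
by rewrite /jump_tilt !mulr_ge0 ?expR_ge0 ?powR_ge0// subr_ge0 expR_le1 oppr_le0 le_max lexx.
Qed.

Lemma jump_untilt_ge0 z : 0 <= jump_untilt z.
Proof. by rewrite /jump_untilt !mulr_ge0 ?expR_ge0 ?powR_ge0// le_max lexx. Qed.

(** Density of [s nu(ds, B_u) du] for [0 <= u <= y], at the point [(w, u, s)]: the jump intensity
    weighted by the jump size. *)
Definition palm_weight (y : R) (x : (Omega * M) * M) : R :=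
  \1_(`[0, y]%classic) x.1.2 * levy_weight (order_path alpha B x.1.1 x.1.2) x.2.

Lemma measurable_palm_weight y : measurable_fun setT (palm_weight y).
Proof.
have mY : measurable (`[0, y]%classic : set M) by exact: measurable_itv.
apply: measurable_funM.
  by apply: (measurableT_comp (measurable_indic mY)); exact: (measurableT_comp measurable_snd measurable_fst).
apply: measurable_levy_weight => //; last by move=> x; exact: order_path01.
apply: (measurable_order_path malpha hB).
  apply: (measurableT_comp (measurable_idOB hB)).
  exact: (measurableT_comp measurable_fst measurable_fst).
exact: (measurableT_comp measurable_snd measurable_fst).
Qed.

Lemma palm_weight_ge0 y x : 0 <= palm_weight y x.
Proof. by rewrite mulr_ge0// levy_weight_ge0// order_path01. Qed.

Lemma palm_weight_eq0 y x : x.2 <= 0 -> palm_weight y x = 0.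
Proof. by move=> s0; rewrite /palm_weight /levy_weight stable_tail_le0// !mulr0. Qed.

Lemma laplace_palm_weight y eta w : 0 <= y -> 0 < eta ->
  (\int[mu]_u \int[mu]_s (palm_weight y (w, u, s) * expR (- (eta * s)))%:E =
   (laplace_exponent_deriv (order_path alpha B w) y eta)%:E)%E.
Proof.
move=> y0 eta0.
rewrite -(laplace_exponent_derivE (measurable_order_path1 malpha hB w)
  (order_path01 B alpha01 w) y eta0).
rewrite [RHS]integral_mkcond; apply: eq_integral => u _.
rewrite epatch_indic /palm_weight /=.
under eq_integral do rewrite -mulrA EFinM.
rewrite ge0_integralZl_EFin//.
- by rewrite laplace_levy_weight// ?order_path01// -EFinM mulrC.
- by move=> s _; rewrite lee_fin mulr_ge0 ?expR_ge0// levy_weight_ge0// order_path01.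
- apply/measurable_EFinP; apply: measurable_funM.
    apply: (@measurable_levy_weight _ _ R (cst (order_path alpha B w u)) id) => //.
    by move=> x; exact: order_path01.
  apply: (measurableT_comp (@measurable_expR R)); apply: measurable_funN.
  exact: measurable_funM.
Qed.

End palm_formula.

Section palm_formula2.
Context {R : realType} {d : measure_display} {Omega : measurableType d}.
Variables (P : probability Omega R) (alpha : R -> R) (B sigma : R -> Omega -> R).
Hypotheses (malpha : measurable_fun setT alpha) (alpha01 : forall x, 0 < alpha x < 1).
Hypotheses (hB : is_brownian_motion P B)
  (hS : is_variable_order_subordinator P alpha B sigma).
Notation mu := (@lebesgue_measure R).
Notation M := (measurableTypeR R).
Notation OB := (g_sigma_algebraType (past B +oo%E)).
Notation X := ((Omega * M) * M)%type.

Lemma path_product_measure :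
  exists m : {sigma_finite_measure set X -> \bar R},
    forall G : X -> \bar R, measurable_fun setT G -> (forall x, 0 <= G x)%E ->
      (\int[m]_x G x = \int[P]_w \int[mu]_u \int[mu]_s G (w, u, s))%E.
Proof.
have [m1 m1E] := sigma_finite_product P mu.
have [m2 m2E] := sigma_finite_product m1 mu.
exists m2 => G mG G0; rewrite m2E//.
exact: (tonelli_path m1E mG G0).
Qed.

Lemma conditional_laplace_sub (c : OB -> R) p q y : 0 < p -> p <= q -> 0 <= y ->
  measurable_fun setT c -> (forall w, 0 <= c w <= 1) ->
  (\int[P]_w (c w * (expR (- path_exponent alpha B p y w) -
                     expR (- path_exponent alpha B q y w)))%:E =
   \int[P]_w (c w * (expR (- (p * sigma y w)) - expR (- (q * sigma y w))))%:E)%E.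
Proof.
move=> p0 pq y0 mc c01.
have q0 : 0 < q by exact: lt_le_trans pq.
have c0 w : 0 <= c w by have /andP[] := c01 w.
have mid := measurable_idOB hB.
have mc' : measurable_fun setT (c : Omega -> R) by exact: (measurableT_comp mc mid).
have mS la : measurable_fun setT (fun w => expR (- (la * sigma y w))).
  apply: (measurableT_comp (@measurable_expR R)); apply: measurable_funN.
  by apply: measurable_funM => //; exact: (sg_measurable hS).
have mE la : measurable_fun setT (fun w : Omega => expR (- path_exponent alpha B la y w)).
  apply: (measurableT_comp (@measurable_expR R)); apply: measurable_funN.
  exact: (measurable_path_exponent malpha hB mid).
have ib (e : Omega -> R) : measurable_fun setT e -> (forall w, 0 <= e w <= 1) ->
    P.-integrable setT (fun w => (c w * e w)%:E).
  move=> me e01; apply: (@measurable_bounded_integrable _ _ _ P (fun w => c w * e w)) => //.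
  - by rewrite (le_lt_trans (probability_le1 P measurableT))// ltry.
  - exact: measurable_funM.
  - exists 1; split => // N N1 w _ /=.
    have /andP[a0 a1] := c01 w; have /andP[b0 b1] := e01 w.
    by rewrite ger0_norm ?mulr_ge0// (le_trans _ (ltW N1))// mulr_ile1.
have e1 la : 0 < la -> forall w, 0 <= expR (- path_exponent alpha B la y w) <= 1.
  by move=> la0 w; rewrite expR_ge0 expR_le1 oppr_le0 laplace_exponent_ge0.
have e2 la : 0 < la -> forall w, 0 <= expR (- (la * sigma y w)) <= 1.
  by move=> la0 w; rewrite expR_ge0 expR_le1 oppr_le0 mulr_ge0 ?(sigma_ge0 hS)// ltW.
under eq_integral do rewrite mulrBr EFinB.
under [RHS]eq_integral do rewrite mulrBr EFinB.
rewrite (integralB measurableT (ib _ (mE p) (e1 _ p0)) (ib _ (mE q) (e1 _ q0))).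
rewrite (integralB measurableT (ib _ (mS p) (e2 _ p0)) (ib _ (mS q) (e2 _ q0))).
have K la : 0 < la -> (\int[P]_w (c w * expR (- path_exponent alpha B la y w))%:E =
   \int[P]_w (c w * expR (- (la * sigma y w)))%:E)%E.
  by move=> la0; exact: (conditional_laplace hB hS la0 y0 mc c0).
exact: (congr2 (fun a b => a - b)%E (K p p0) (K q q0)).
Qed.

(** The derivative of [e^(-Phi_y(eta))] in [eta] is [- Phi' e^(-Phi)], where [Phi'] is the Laplace
    transform of [palm_weight] at [eta]; since [Phi'] depends on [B] alone, [e^(-Phi)] may be traded
    for [e^(-eta sigma(y))] in expectation. Integrating over [eta] from [j + 1] to [j + 2] avoids
    differentiating an expectation, and the integral of [e^(-eta z)] produces [jump_tilt]. *)
Lemma palm_laplace (m : {sigma_finite_measure set X -> \bar R}) (y : R)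
    (D : set OB) (j : nat) :
  (forall G : X -> \bar R, measurable_fun setT G -> (forall x, 0 <= G x)%E ->
      (\int[m]_x G x = \int[P]_w \int[mu]_u \int[mu]_s G (w, u, s))%E) ->
  0 <= y -> measurable D ->
  (\int[P]_w (\1_D w * expR (- (j%:R * sigma y w)) *
     (expR (- sigma y w) * (1 - expR (- sigma y w))))%:E =
  \int[m]_x (\1_D x.1.1 * expR (- (j%:R * (sigma y x.1.1 + x.2))) *
     (palm_weight alpha B y x * jump_tilt (sigma y x.1.1 + x.2)))%:E)%E.
Proof.
move=> mE y0 mD.
pose p : R := j%:R + 1; pose q : R := j%:R + 2.
have p1 : 1 <= p by rewrite /p lerDr.
have p0 : 0 < p by exact: lt_le_trans p1.
have pq : p <= q by rewrite /p /q lerD2l ler1n.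
have mid := measurable_idOB hB.
have m1D : measurable_fun setT (\1_D : OB -> R) by exact: measurable_indic.
have m1D' : measurable_fun setT (\1_D : Omega -> R) by exact: (measurableT_comp m1D mid).
have mJ : measurable (`[p, q]%classic : set M) by exact: measurable_itv.
have msy : measurable_fun setT (sigma y) by exact: (sg_measurable hS).
have mW := measurable_palm_weight malpha alpha01 hB y.
have W0 := palm_weight_ge0 B alpha01 y.
have D0 (w : Omega) : 0 <= (\1_D w : R) by [].
pose G eta (x : X) : R := \1_D x.1.1 * (palm_weight alpha B y x * expR (- (eta * x.2))) *
  expR (- (eta * sigma y x.1.1)).
pose F (z : X * M) : \bar R := (G z.2 z.1 * \1_(`[p, q]%classic) z.2)%:E.
have mF : measurable_fun setT F.
  have mz1 : measurable_fun setT (fun z : X * M => z.1.1.1).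
    exact: (measurableT_comp measurable_fst (measurableT_comp measurable_fst measurable_fst)).
  have mz2 : measurable_fun setT (fun z : X * M => z.1.2).
    exact: (measurableT_comp measurable_snd measurable_fst).
  apply/measurable_EFinP; apply: measurable_funM; last first.
    exact: (measurableT_comp (measurable_indic mJ) measurable_snd).
  apply: measurable_funM; first apply: measurable_funM.
  - exact: (measurableT_comp m1D' mz1).
  - apply: measurable_funM; first exact: (measurableT_comp mW measurable_fst).
    apply: (measurableT_comp (@measurable_expR R)); apply: measurable_funN.
    by apply: measurable_funM => //; exact: measurable_snd.
  - apply: (measurableT_comp (@measurable_expR R)); apply: measurable_funN.
    apply: measurable_funM; first exact: measurable_snd.
    exact: (measurableT_comp msy mz1).
have F0 z : (0 <= F z)%E.
  rewrite lee_fin; apply: mulr_ge0 => //; apply: mulr_ge0; last exact: expR_ge0.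
  apply: mulr_ge0; first exact: D0.
  by apply: mulr_ge0; [exact: W0|exact: expR_ge0].
have step1 : (\int[m]_x (\1_D x.1.1 * expR (- (j%:R * (sigma y x.1.1 + x.2))) *
     (palm_weight alpha B y x * jump_tilt (sigma y x.1.1 + x.2)))%:E =
   \int[m]_x \int[mu]_eta F (x, eta))%E.
  apply: eq_integral => x _.
  have [s0|s0] := leP x.2 0.
    rewrite palm_weight_eq0// mul0r mulr0; apply/esym/integral0_eq => eta _.
    by rewrite /F /G /= palm_weight_eq0// !(mul0r, mulr0).
  have z0 : 0 < sigma y x.1.1 + x.2 by rewrite ltr_wpDl// (sigma_ge0 hS).
  transitivity (\int[mu]_(eta in `[p, q])
    ((\1_D x.1.1 * palm_weight alpha B y x)%:E * (expR (- (eta * (sigma y x.1.1 + x.2))))%:E))%E.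
    rewrite ge0_integralZl_EFin.
    - rewrite integral_expN_itv// jump_tiltE// -EFinM; congr EFin.
      set z := sigma y x.1.1 + x.2.
      have -> : expR (- (p * z)) = expR (- (j%:R * z)) * expR (- z).
        by rewrite -expRD /p; congr expR; ring.
      have -> : expR (- (q * z)) = expR (- (j%:R * z)) * expR (- z) * expR (- z).
        by rewrite -!expRD /q; congr expR; ring.
      ring.
    - by [].
    - by move=> eta _; rewrite lee_fin expR_ge0.
    - apply/measurable_EFinP/measurable_funTS.
      apply: (measurableT_comp (@measurable_expR R)); apply: measurable_funN.
      exact: measurable_funM.
    - exact: mulr_ge0.
  rewrite [LHS]integral_mkcond; apply: eq_integral => eta _.
  rewrite epatch_indic /F /G /= -!EFinM; congr (_ * _)%:E.
  have -> : expR (- (eta * (sigma y x.1.1 + x.2))) =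
     expR (- (eta * x.2)) * expR (- (eta * sigma y x.1.1)).
    by rewrite -expRD; congr expR; ring.
  by rewrite !mulrA.
rewrite step1.
have -> : (\int[m]_x \int[mu]_eta F (x, eta) = \int[mu]_eta \int[m]_x F (x, eta))%E.
  exact: (@fubini_tonelli _ _ _ _ _ m mu F mF F0).
(* At fixed [eta] the integrals over [u] and [s] give [Phi'], a functional of the path of [B], so
   that [conditional_laplace] applies. *)
have step2 eta : p <= eta <= q -> (\int[m]_x F (x, eta) =
   \int[P]_w (\1_D w * laplace_exponent_deriv (order_path alpha B w) y eta *
        expR (- path_exponent alpha B eta y w))%:E)%E.
  move=> /andP[peta etaq]; have eta0 : 0 < eta by exact: lt_le_trans peta.
  have etaJ : eta \in `[p, q]%classic by rewrite inE/= in_itv/= peta.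
  rewrite mE; last 2 first.
  - exact: (measurableT_comp mF (measurable_pair2 _)).
  - by move=> x.
  transitivity (\int[P]_w ((\1_D w * laplace_exponent_deriv (order_path alpha B w) y eta) *
      expR (- (eta * sigma y w)))%:E)%E.
    apply: eq_integral => w _.
    transitivity ((\1_D w * expR (- (eta * sigma y w)))%:E *
       \int[mu]_u \int[mu]_s (palm_weight alpha B y (w, u, s) * expR (- (eta * s)))%:E)%E.
      have c0 : 0 <= \1_D w * expR (- (eta * sigma y w)) by rewrite mulr_ge0 ?expR_ge0.
      have mH : measurable_fun setT (fun x : M * M =>
          (palm_weight alpha B y (w, x.1, x.2) * expR (- (eta * x.2)))%:E).
        apply/measurable_EFinP; apply: measurable_funM.
          apply: (measurableT_comp mW).
          apply: measurable_fun_pair; last exact: measurable_snd.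
          by apply: measurable_fun_pair; [exact: measurable_cst|exact: measurable_fst].
        apply: (measurableT_comp (@measurable_expR R)); apply: measurable_funN.
        by apply: measurable_funM => //; exact: measurable_snd.
      have H0 x : (0 <= (palm_weight alpha B y (w, x.1, x.2) * expR (- (eta * x.2)))%:E)%E.
        by rewrite lee_fin mulr_ge0 ?expR_ge0.
      rewrite -ge0_integralZl_EFin//; last 2 first.
      - by move=> u _; apply: integral_ge0 => s _; exact: (H0 (u, s)).
      - exact: (@measurable_fun_fubini_tonelli_F _ _ _ _ _ mu _ mH H0).
      apply: eq_integral => u _.
      rewrite -ge0_integralZl_EFin//; last 2 first.
      - by move=> s _; exact: (H0 (u, s)).
      - exact: (measurableT_comp mH (measurable_pair1 _)).
      apply: eq_integral => s _; rewrite /F /G /= [\1_(`[p, q]%classic) _]indicE etaJ mulr1 -EFinM.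
      congr EFin; ring.
    rewrite (laplace_palm_weight malpha alpha01 hB w y0 eta0) -EFinM; congr EFin; ring.
  apply/esym/(conditional_laplace hB hS eta0 y0 (c := fun w =>
     \1_D w * laplace_exponent_deriv (order_path alpha B w) y eta)).
    by apply: measurable_funM => //; exact: (measurable_path_deriv malpha alpha01 hB).
  by move=> w; rewrite mulr_ge0// laplace_exponent_deriv_ge0// => u; exact: order_path01.
pose H (z : Omega * M) : \bar R := (\1_D z.1 * laplace_exponent_deriv (order_path alpha B z.1) y z.2 *
        expR (- path_exponent alpha B z.2 y z.1) * \1_(`[p, q]%classic) z.2)%:E.
have mH : measurable_fun setT H.
  have mf1 : measurable_fun setT (fun z : Omega * M => z.1 : OB).
    exact: (measurableT_comp mid measurable_fst).
  apply/measurable_EFinP; apply: measurable_funM; last first.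
    exact: (measurableT_comp (measurable_indic mJ) measurable_snd).
  apply: measurable_funM; first apply: measurable_funM.
  - exact: (measurableT_comp m1D' measurable_fst).
  - apply: (measurable_path_deriv malpha alpha01 hB _ mf1); exact: measurable_snd.
  - apply: (measurableT_comp (@measurable_expR R)); apply: measurable_funN.
    by apply: (measurable_path_exponent malpha hB mf1) => //; exact: measurable_snd.
have H0 z : (0 <= H z)%E.
  rewrite lee_fin !mulr_ge0 ?expR_ge0// laplace_exponent_deriv_ge0// => u.
  exact: order_path01.
have -> : (\int[mu]_eta \int[m]_x F (x, eta) = \int[mu]_eta \int[P]_w H (w, eta))%E.
  apply: eq_integral => eta _.
  have [etaJ|etaJ] := boolP (eta \in `[p, q]%classic).
    rewrite step2; last by move: etaJ; rewrite inE/= in_itv/=.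
    by apply: eq_integral => w _; rewrite /H /= [\1_(`[p, q]%classic) _]indicE etaJ mulr1.
  rewrite !integral0_eq// => w _.
    by rewrite /H /= [\1_(`[p, q]%classic) _]indicE (negbTE etaJ) mulr0.
  by rewrite /F /= [\1_(`[p, q]%classic) _]indicE (negbTE etaJ) mulr0.
have -> : (\int[mu]_eta \int[P]_w H (w, eta) = \int[P]_w \int[mu]_eta H (w, eta))%E.
  exact/esym/(@fubini_tonelli _ _ _ _ _ P mu H mH H0).
(* With [p = j + 1] and [q = j + 2] the difference of the two exponentials is the weight
   [e^(-j sigma) e^(-sigma) (1 - e^(-sigma))]. *)
transitivity (\int[P]_w (\1_D w * (expR (- (p * sigma y w)) - expR (- (q * sigma y w))))%:E)%E.
  apply: eq_integral => w _; congr EFin.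
  have -> : expR (- (p * sigma y w)) = expR (- (j%:R * sigma y w)) * expR (- sigma y w).
    by rewrite -expRD /p; congr expR; ring.
  have -> : expR (- (q * sigma y w)) = expR (- (j%:R * sigma y w)) * expR (- sigma y w) * expR (- sigma y w).
    by rewrite -!expRD /q; congr expR; ring.
  ring.
rewrite -(conditional_laplace_sub p0 pq y0 m1D); last first.
  by move=> w; rewrite indicE; case: (_ \in _); rewrite ?lexx ?ler01.
apply: eq_integral => w _.
have h := integral_deriv_expN (measurable_order_path1 malpha hB w)
  (order_path01 B alpha01 w) y0 p1 pq.
rewrite EFinM -h -ge0_integralZl_EFin//; last 2 first.
- move=> s _; rewrite lee_fin mulr_ge0 ?expR_ge0// laplace_exponent_deriv_ge0// => u.
  exact: order_path01.
- apply/measurable_EFinP/measurable_funTS; apply: measurable_funM.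
    apply: measurable_laplace_exponent_deriv.
      exact: (measurable_order_path1 malpha hB).
    by move=> u; exact: order_path01.
  apply: (measurableT_comp (@measurable_expR R)); apply: measurable_funN.
  by apply: (@measurable_path_exponent _ _ _ P alpha B malpha hB _ M (fun=> w) id (cst y)).
rewrite [LHS]integral_mkcond; apply: eq_integral => s _.
by rewrite epatch_indic /H /= -!EFinM !mulrA.
Qed.

End palm_formula2.

(** Homogeneity of the stable Levy measures, the property behind [shot_kernel_palm]. *)
Lemma levy_weight_scale (R : realType) (th x v : R) : 0 < x ->
  levy_weight th (x * v) = x `^ (- th) * levy_weight th v.
Proof.
move=> x0; rewrite /levy_weight /stable_tail.
have -> : (\1_(`]0, +oo[%classic) (x * v) : R) = \1_(`]0, +oo[%classic) v.
  rewrite !indicE; congr ((_ : bool)%:R).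
  by apply/idP/idP; rewrite !inE/= !in_itv/= !andbT pmulr_rgt0.
rewrite indicE; case: (boolP (v \in _)); last by rewrite !(mul0r, mulr0).
rewrite inE/= in_itv/= andbT => v0; rewrite powRM ?ltW//.
by rewrite !mul1r; ring.
Qed.

Section scaling_monotonicity.
Context {R : realType} {d : measure_display} {Omega : measurableType d}.
Variables (P : probability Omega R) (alpha : R -> R) (B sigma : R -> Omega -> R).
Hypotheses (malpha : measurable_fun setT alpha) (alpha01 : forall x, 0 < alpha x < 1).
Hypotheses (hB : is_brownian_motion P B)
  (hS : is_variable_order_subordinator P alpha B sigma).
Notation mu := (@lebesgue_measure R).
Notation M := (measurableTypeR R).
Notation OB := (g_sigma_algebraType (past B +oo%E)).
Notation X := ((Omega * M) * M)%type.

(** As [sigma(y)] is the sum of its jumps, this is a Mecke formula: a jump of size [s] at time [u],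
    with weight [s nu(ds, B_u) du], is added to the path. It follows from [palm_laplace] by
    uniqueness of Laplace transforms for the tilted measures, which are finite; the tilt is then
    divided out. *)
Lemma palm_formula (y : R) (K : OB * R -> \bar R) : 0 <= y ->
  measurable_fun setT K -> (forall z, 0 <= K z)%E ->
  (\int[P]_w ((sigma y w)%:E * K (w, sigma y w)) =
   \int[P]_w \int[mu]_u \int[mu]_s
      (K (w, sigma y w + s)%R * (palm_weight alpha B y (w, u, s))%:E))%E.
Proof.
move=> y0 mK K0.
have [m mE] := path_product_measure P.
have mid := measurable_idOB hB.
have msy : measurable_fun setT (sigma y) by exact: (sg_measurable hS).
have mW := measurable_palm_weight malpha alpha01 hB y.
have W0 := palm_weight_ge0 B alpha01 y.
pose f (w : Omega) : OB * R := (w, sigma y w).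
pose g (x : X) : OB * R := (x.1.1, sigma y x.1.1 + x.2).
pose p (w : Omega) : R := expR (- sigma y w) * (1 - expR (- sigma y w)).
pose q (x : X) : R := palm_weight alpha B y x * jump_tilt (sigma y x.1.1 + x.2).
have mf : measurable_fun setT f by exact: measurable_fun_pair.
have mz1 : measurable_fun setT (fun z : X => z.1.1).
  exact: (measurableT_comp measurable_fst measurable_fst).
have msz : measurable_fun setT (fun x : X => sigma y x.1.1 + x.2).
  apply: measurable_funD; first exact: (measurableT_comp msy mz1).
  exact: measurable_snd.
have mg : measurable_fun setT g.
  by apply: measurable_fun_pair => //; exact: (measurableT_comp mid mz1).
have mes : measurable_fun setT (fun w => expR (- sigma y w)).
  by apply: (measurableT_comp (@measurable_expR R)); exact: measurable_funN.
have mp : measurable_fun setT p by apply: measurable_funM => //; exact: measurable_funB.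
have mq : measurable_fun setT q.
  by apply: measurable_funM => //; exact: (measurableT_comp measurable_jump_tilt msz).
have s0 w : 0 <= sigma y w by exact: (sigma_ge0 hS).
have p0 w : 0 <= p w.
  by rewrite mulr_ge0 ?expR_ge0// subr_ge0 expR_le1 oppr_le0.
have q0 x : 0 <= q x by rewrite mulr_ge0// jump_tilt_ge0.
(* Cancels the tilt on both sides: it leaves the factor [sigma(y)] on the left and 1 on the
   right. *)
pose K' (z : OB * R) : \bar R := (K z * (jump_untilt z.2)%:E)%E.
have mK' : measurable_fun setT K'.
  apply: emeasurable_funM => //; apply/measurable_EFinP.
  exact: (measurableT_comp measurable_jump_untilt measurable_snd).
have K'0 z : (0 <= K' z)%E by rewrite mule_ge0// lee_fin jump_untilt_ge0.
have := @laplace_uniqueness _ OB R _ Omega _ X P m f g p q mf mg mp mq p0 q0.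
move=> /(_ _ _ _ _ K' mK' K'0) H.
transitivity (\int[P]_w (K' (f w) * (p w)%:E))%E.
  apply: eq_integral => w _; rewrite /K' /f /= -muleA -EFinM jump_untiltE//.
  by rewrite muleC.
rewrite H.
- have mKW : measurable_fun setT (fun x : X => K (g x) * (palm_weight alpha B y x)%:E)%E.
    by apply: emeasurable_funM; [exact: (measurableT_comp mK mg)|exact/measurable_EFinP].
  transitivity (\int[m]_x (K (g x) * (palm_weight alpha B y x)%:E))%E.
    apply: eq_integral => x _; rewrite /K' -muleA -EFinM; congr (_ * _%:E)%E.
    rewrite /q /g /=; have [x0|x0] := leP x.2 0; first by rewrite palm_weight_eq0// mul0r mulr0.
    have z0 : 0 < sigma y x.1.1 + x.2 by rewrite ltr_wpDl.
    have := jump_untiltE (ltW z0); rewrite jump_tiltE//.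
    set z := sigma y x.1.1 + x.2 => e.
    rewrite mulrCA; have -> : jump_untilt z * (expR (- z) * (1 - expR (- z)) / z) = 1.
      by rewrite mulrA e divff// gt_eqF.
    by rewrite mulr1.
  by rewrite mE// => x; rewrite mule_ge0// lee_fin.
- by move=> w; right; exact: s0.
- move=> x; have [x0|x0] := leP x.2 0; [left|right].
    by rewrite /q palm_weight_eq0// mul0r.
  by rewrite /g/= addr_ge0// ltW.
- apply: (@le_lt_trans _ _ (\int[P]_w 1)%E); last first.
    by rewrite integral_cst// mul1e (le_lt_trans (probability_le1 P measurableT))// ltry.
  apply: ge0_le_integral => //.
  + by move=> w _; rewrite lee_fin.
  + exact/measurable_EFinP.
  + move=> w _; rewrite lee_fin; have e1 : expR (- sigma y w) <= 1.
      by rewrite expR_le1 oppr_le0.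
    have e0 := expR_ge0 (- sigma y w).
    by apply: mulr_ile1; lra.
- by move=> D j mD; exact: (palm_laplace malpha alpha01 hB hS j mE y0 mD).
Qed.

End scaling_monotonicity.

(** * Monotonicity in the level by scaling *)

Section scaling_monotonicity2.
Context {R : realType} {d : measure_display} {Omega : measurableType d}.
Variables (P : probability Omega R) (alpha : R -> R) (B sigma : R -> Omega -> R).
Hypotheses (malpha : measurable_fun setT alpha) (alpha01 : forall x, 0 < alpha x < 1).
Hypotheses (hB : is_brownian_motion P B)
  (hS : is_variable_order_subordinator P alpha B sigma).
Notation mu := (@lebesgue_measure R).
Notation M := (measurableTypeR R).
Notation OB := (g_sigma_algebraType (past B +oo%E)).

Lemma measurable_palm_weight_past y d' (Z : measurableType d') (f : Z -> OB) (u s : Z -> R) :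
  measurable_fun setT f -> measurable_fun setT u -> measurable_fun setT s ->
  measurable_fun setT (fun z => palm_weight alpha B y (f z, u z, s z)).
Proof.
move=> mf mu' ms.
have mY : measurable (`[0, y]%classic : set R) by exact: measurable_itv.
apply: measurable_funM; first exact: (measurableT_comp (measurable_indic mY) mu').
apply: measurable_levy_weight => //; last by move=> x; exact: order_path01.
exact: (measurable_order_path malpha hB).
Qed.

(** Kernels in a path and a remaining level [s] that become nondecreasing in [s] after
    multiplication by [s^th]. The Palm formula produces two operations on kernels, and each of them
    lowers the exponent. *)
Definition shot_kernel (th : R) (K : OB * R -> \bar R) : Prop :=
  [/\ measurable_fun setT K, (forall z, 0 <= K z)%E,
    (forall w s, s <= 0 -> K (w, s) = 0%E) &
    (forall w s s', 0 < s -> s <= s' ->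
       ((s `^ th)%:E * K (w, s) <= (s' `^ th)%:E * K (w, s'))%E)].

(** The inner integral of the Palm formula, seen from the remaining level: a convolution of [K] with
    the jump intensity weighted by the jump size. *)
Definition palm_kernel (y : R) (K : OB * R -> \bar R) (z : OB * R) : \bar R :=
  (\int[mu]_u \int[mu]_s
     (K (z.1, (z.2 - s)%R) * (palm_weight alpha B y ((z.1 : Omega), u, s))%:E))%E.

Definition size_kernel (K : OB * R -> \bar R) (z : OB * R) : \bar R :=
  ((Num.max 0 z.2)%:E * K z)%E.

Lemma measurable_size_kernel K : measurable_fun setT K ->
  measurable_fun setT (size_kernel K).
Proof.
move=> mK; apply: emeasurable_funM => //; apply/measurable_EFinP.
by apply: measurable_maxr => //; exact: measurable_snd.
Qed.

Lemma shot_kernel_size th th' K : th <= th' + 1 -> shot_kernel th K ->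
  shot_kernel th' (size_kernel K).
Proof.
move=> thth' [mK K0 Kle0 Kmono]; split.
- exact: measurable_size_kernel.
- by move=> z; rewrite mule_ge0// lee_fin le_max lexx.
- by move=> w s s0; rewrite /size_kernel Kle0// mule0.
- move=> w s s' s0 ss'; have s0' := lt_le_trans s0 ss'.
  have e r : 0 < r -> ((r `^ th')%:E * size_kernel K (w, r) =
     (r `^ (th' + 1 - th))%:E * ((r `^ th)%:E * K (w, r)))%E.
    move=> r0; rewrite /size_kernel /= (max_r (ltW r0)) !muleA -!EFinM; congr (_%:E * _)%E.
    rewrite -powRD ?(gt_eqF r0) ?implybT// subrK powRD ?(gt_eqF r0) ?implybT//.
    by rewrite powRr1// ltW.
  rewrite !e//; apply: lee_pmul => //.
  + by rewrite lee_fin powR_ge0.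
  + by rewrite mule_ge0// lee_fin powR_ge0.
  + by rewrite lee_fin ge0_ler_powR ?nnegrE ?subr_ge0// ltW.
  + exact: Kmono.
Qed.

Lemma measurable_palm_kernel y K : measurable_fun setT K -> (forall z, 0 <= K z)%E ->
  measurable_fun setT (palm_kernel y K).
Proof.
move=> mK K0.
pose F (x : ((OB * R) * M) * M) : \bar R :=
  (K (x.1.1.1, (x.1.1.2 - x.2)%R) * (palm_weight alpha B y ((x.1.1.1 : Omega), x.1.2, x.2))%:E)%E.
have m11 : measurable_fun setT (fun x : ((OB * R) * M) * M => x.1.1).
  exact: (measurableT_comp measurable_fst measurable_fst).
have m111 : measurable_fun setT (fun x : ((OB * R) * M) * M => x.1.1.1).
  exact: (measurableT_comp measurable_fst m11).
have mF : measurable_fun setT F.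
  apply: emeasurable_funM.
    apply: (measurableT_comp mK); apply: measurable_fun_pair => //.
    apply: measurable_funB; first exact: (measurableT_comp measurable_snd m11).
    exact: measurable_snd.
  apply/measurable_EFinP; apply: measurable_palm_weight_past => //.
  exact: (measurableT_comp measurable_snd measurable_fst).
have F0 x : (0 <= F x)%E by rewrite mule_ge0// lee_fin palm_weight_ge0.
have mG := @measurable_fun_fubini_tonelli_F _ _ _ _ _ mu F mF F0.
have G0 x : (0 <= fubini_F mu F x)%E by apply: integral_ge0.
exact: (@measurable_fun_fubini_tonelli_F _ _ _ _ _ mu _ mG G0).
Qed.

(** Substituting [s = r v] and using homogeneity, [r^(th - (1 - amax))] times the convolution at [r]
    becomes the integral over [u] and [v] of [r^(amax - alpha) (r^th K(r (1 - v)))] against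
    [palm_weight] at [v]. Both factors are nondecreasing in [r], the first because
    [alpha <= amax]. *)
Lemma shot_kernel_palm y amax th K : (forall x, alpha x <= amax) ->
  shot_kernel th K -> shot_kernel (th - (1 - amax)) (palm_kernel y K).
Proof.
move=> hmax [mK K0 Kle0 Kmono]; split.
- exact: measurable_palm_kernel.
- move=> z; apply: integral_ge0 => u _; apply: integral_ge0 => s _.
  by rewrite mule_ge0// lee_fin palm_weight_ge0.
- move=> w x x0; apply: integral0_eq => u _; apply: integral0_eq => s _.
  have [s0|s0] := leP s 0; first by rewrite palm_weight_eq0// mule0.
  by rewrite Kle0 ?mul0e//= subr_le0 (le_trans x0)// ltW.
move=> w x x' x0 xx'; have x0' := lt_le_trans x0 xx'.
set th' := th - (1 - amax).
pose H r u v : \bar R := ((r `^ (amax - order_path alpha B w u))%:E *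
  ((r `^ th)%:E * K (w, (r * (1 - v))%R)) * (palm_weight alpha B y ((w : Omega), u, v))%:E)%E.
have mpw (u : R) : measurable_fun setT (fun v : M => palm_weight alpha B y ((w : Omega), u, v)).
  exact: (@measurable_palm_weight_past y _ M (fun=> w) (fun=> u) id).
have mH r u : measurable_fun setT (H r u : M -> \bar R).
  apply: emeasurable_funM; last first.
    by apply/measurable_EFinP; exact: mpw.
  apply: emeasurable_funM => //; apply: emeasurable_funM => //.
  apply: (measurableT_comp mK); apply: measurable_fun_pair => //.
  by apply: measurable_funM => //; exact: measurable_funB.
have H0 r u v : (0 <= H r u v)%E.
  apply: mule_ge0; last by rewrite lee_fin palm_weight_ge0.
  apply: mule_ge0; first by rewrite lee_fin powR_ge0.
  by apply: mule_ge0; rewrite ?lee_fin ?powR_ge0.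
have alg (a b c e p : R) (k : \bar R) : a * b = c * e ->
    (a%:E * (k * (b * p)%:E) = c%:E * (e%:E * k) * p%:E)%E.
  move=> abce; rewrite muleCA -EFinM [in RHS]muleA -EFinM -abce.
  by rewrite [RHS]muleAC -EFinM muleC mulrA.
have scale r : 0 < r -> ((r `^ th')%:E * palm_kernel y K (w, r) =
    \int[mu]_u \int[mu]_v H r u v)%E.
  move=> r0; rewrite /palm_kernel /=.
  pose F (z : M * M) : \bar R :=
    (K (w, (r - z.2)%R) * (palm_weight alpha B y ((w : Omega), z.1, z.2))%:E)%E.
  have mF : measurable_fun setT F.
    apply: emeasurable_funM.
      apply: (measurableT_comp mK); apply: measurable_fun_pair => //.
      by apply: measurable_funB => //; exact: measurable_snd.
    by apply/measurable_EFinP; apply: (@measurable_palm_weight_past y _ _ (fun=> w)).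
  have F0 z : (0 <= F z)%E by rewrite mule_ge0// lee_fin palm_weight_ge0.
  have mG := @measurable_fun_fubini_tonelli_F _ _ _ _ _ mu F mF F0.
  rewrite -[LHS]ge0_integralZl_EFin ?powR_ge0//; last first.
    by move=> u _; apply: integral_ge0 => v _; exact: (F0 (u, v)).
  apply: eq_integral => u _.
  have mFu : measurable_fun setT (fun s : R => F (u, s)).
    exact: (measurableT_comp mF (measurable_pair1 _)).
  have aff := @integral_affine R r 0 (fun s => F (u, s)) r0 mFu (fun s => F0 (u, s)).
  have -> : (\int[mu]_s (K (w, (r - s)%R) * (palm_weight alpha B y ((w : Omega), u, s))%:E) =
     r%:E * \int[mu]_v F (u, (r * v + 0)%R))%E.
    by rewrite aff muleA -EFinM divff ?gt_eqF// mul1e.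
  have mFr : measurable_fun setT (fun v : M => F (u, r * v + 0)).
    by apply: (measurableT_comp mFu); apply: measurable_funD => //; exact: measurable_funM.
  transitivity (\int[mu]_v ((r `^ th' * r)%:E * F (u, (r * v + 0)%R)))%E.
    have k0 : 0 <= r `^ th' * r by rewrite mulr_ge0 ?powR_ge0// ltW.
    rewrite muleA -EFinM; apply/esym.
    exact: (@ge0_integralZl_EFin _ M R mu setT measurableT _ (fun v _ => F0 (u, r * v + 0)) mFr _ k0).
  apply: eq_integral => v _; rewrite /H /F /= addr0.
  have -> : palm_weight alpha B y ((w : Omega), u, r * v) =
     r `^ (- order_path alpha B w u) * palm_weight alpha B y ((w : Omega), u, v).
    by rewrite /palm_weight/= levy_weight_scale//; ring.
  have -> : r - r * v = r * (1 - v) by ring.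
  apply: alg; rewrite -[X in _ * X * _](powRr1 (ltW r0)).
  rewrite -!powRD ?(gt_eqF r0) ?implybT//; congr (_ `^ _); rewrite /th'; ring.
have mHH r : measurable_fun setT (fun z : M * M => H r z.1 z.2).
  have mo : measurable_fun setT (fun z : M * M => order_path alpha B w z.1).
    exact: (@measurable_order_path _ _ _ P alpha B malpha hB _ _ (fun=> w) fst).
  apply: emeasurable_funM; last first.
    by apply/measurable_EFinP; apply: (@measurable_palm_weight_past y _ _ (fun=> w)).
  apply: emeasurable_funM.
    by apply/measurable_EFinP; apply: measurable_powR2 => //; exact: measurable_funB.
  apply: emeasurable_funM => //.
  apply: (measurableT_comp mK); apply: measurable_fun_pair => //.
  apply: measurable_funM => //; apply: measurable_funB => //; exact: measurable_snd.
have mHF r : measurable_fun setT (fun u : M => \int[mu]_v H r u v)%E.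
  exact: (@measurable_fun_fubini_tonelli_F _ _ _ _ _ mu _ (mHH r) (fun z => H0 r z.1 z.2)).
rewrite (scale x x0) (scale x' x0').
have G0 r u : (0 <= \int[mu]_v H r u v)%E by apply: integral_ge0 => v _; exact: H0.
apply: (@ge0_le_integral _ M R mu setT measurableT _ _ (fun u _ => G0 x u) (mHF x) (mHF x')) => u _.
apply: (@ge0_le_integral _ M R mu setT measurableT _ _ (fun v _ => H0 x u v) (mH x u) (mH x' u)) => v _.
have [v0|v0] := leP v 0; first by rewrite /H palm_weight_eq0// !mule0.
apply: lee_wpmul2r; first by rewrite lee_fin palm_weight_ge0.
have [v1|v1] := leP 1 v.
  have z r : 0 < r -> r * (1 - v) <= 0 by move=> r0; rewrite pmulr_rle0// subr_le0.
  by rewrite !Kle0 ?z// !mule0.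
have v1' : 0 < 1 - v by rewrite subr_gt0.
apply: lee_pmul.
- by rewrite lee_fin powR_ge0.
- by rewrite mule_ge0// lee_fin powR_ge0.
- rewrite lee_fin; apply: ge0_ler_powR; rewrite ?nnegrE ?(ltW x0) ?(ltW x0')//.
  by rewrite subr_ge0; exact: hmax.
(* For [v < 1] the factor [(1 - v)^(-th)] is taken out, so that the monotonicity of [K] is used at
   the point [r (1 - v)]. *)
have k0 r : 0 < r -> ((r `^ th)%:E * K (w, (r * (1 - v))%R) =
    ((1 - v) `^ (- th))%:E * (((r * (1 - v)) `^ th)%:E * K (w, (r * (1 - v))%R)))%E.
  move=> r0; rewrite muleA -EFinM powRM ?(ltW r0) ?(ltW v1')//; congr (_%:E * _)%E.
  by rewrite mulrCA -powRD ?(gt_eqF v1') ?implybT// addNr powRr0 mulr1.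
rewrite !k0//; apply: lee_wpmul2l; first by rewrite lee_fin powR_ge0.
by apply: Kmono; [rewrite mulr_gt0|rewrite ler_pM2r].
Qed.

(** Write [t = (t - sigma(y)) + sigma(y)]: the first summand gives [size_kernel], and the Palm
    formula turns the second into [palm_kernel]. *)
Lemma expectation_shot_kernel_step (y t : R) (K : OB * R -> \bar R) : 0 <= y -> 0 < t ->
  measurable_fun setT K -> (forall z, 0 <= K z)%E ->
  (forall w s, s <= 0 -> K (w, s) = 0%E) ->
  (t%:E * \int[P]_w K (w, (t - sigma y w)%R) =
   \int[P]_w size_kernel K (w, (t - sigma y w)%R) +
   \int[P]_w palm_kernel y K (w, (t - sigma y w)%R))%E.
Proof.
move=> y0 t0 mK K0 Kle0.
have mid := measurable_idOB hB.
have msy : measurable_fun setT (sigma y) by exact: (sg_measurable hS).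
have mp : measurable_fun setT (fun w : Omega => (w : OB, t - sigma y w)).
  by apply: measurable_fun_pair => //; exact: measurable_funB.
have mKw : measurable_fun setT (fun w : Omega => K (w, (t - sigma y w)%R)).
  exact: (measurableT_comp mK mp).
have s0 w : 0 <= sigma y w by exact: (sigma_ge0 hS).
pose Kt (z : OB * R) := K (z.1, (t - z.2)%R).
have mKt : measurable_fun setT Kt.
  apply: (measurableT_comp mK); apply: measurable_fun_pair => //.
  by apply: measurable_funB => //; exact: measurable_snd.
have palm := palm_formula malpha alpha01 hB hS y0 mKt (fun z => K0 _).
have palmE : (\int[P]_w \int[mu]_u \int[mu]_s
      (Kt (w, sigma y w + s)%R * (palm_weight alpha B y (w, u, s))%:E) =
   \int[P]_w palm_kernel y K (w, (t - sigma y w)%R))%E.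
  apply: eq_integral => w _; apply: eq_integral => u _; apply: eq_integral => s _.
  by rewrite /Kt/= opprD addrA.
rewrite -palmE -palm.
transitivity (\int[P]_w (t%:E * K (w, (t - sigma y w)%R)))%E.
  apply/esym; exact: (@ge0_integralZl_EFin _ Omega R P setT measurableT _ (fun w _ => K0 _) mKw _ (ltW t0)).
have n1 w : (0 <= size_kernel K (w, (t - sigma y w)%R))%E.
  by apply: mule_ge0; [rewrite lee_fin le_max lexx|exact: K0].
have n2 w : (0 <= (sigma y w)%:E * Kt (w, sigma y w))%E.
  by apply: mule_ge0; [rewrite lee_fin; exact: s0|exact: K0].
have m1 : measurable_fun setT (fun w : Omega => size_kernel K (w, (t - sigma y w)%R)).
  exact: (measurableT_comp (measurable_size_kernel mK) mp).
have m2 : measurable_fun setT (fun w : Omega => (sigma y w)%:E * Kt (w, sigma y w))%E.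
  by apply: emeasurable_funM; [apply/measurable_EFinP; exact: msy|exact: mKw].
transitivity (\int[P]_w (size_kernel K (w, (t - sigma y w)%R) +
   (sigma y w)%:E * Kt (w, sigma y w)))%E; last first.
  exact: (@ge0_integralD _ Omega R P setT measurableT _ _ (fun w _ => n1 w) m1 (fun w _ => n2 w) m2).
apply: eq_integral => w _; rewrite /size_kernel /Kt /=.
have [ts|ts] := leP (t - sigma y w) 0.
  by rewrite (Kle0 w _ ts) !mule0 adde0.
have ts0 : (0 <= (t - sigma y w)%:E)%E by rewrite lee_fin (ltW ts).
have sy0 : (0 <= (sigma y w)%:E)%E by rewrite lee_fin s0.
by rewrite -(ge0_muleDl _ ts0 sy0) -EFinD subrK.
Qed.

(** Each factor [t] is spent on one application of [expectation_shot_kernel_step], after which both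
    kernels have an exponent lower by [1 - amax]. After [n] of them the exponent is 0, so the kernel
    itself is nondecreasing, and so is its expectation. *)
Lemma expectation_shot_kernel_mono n (y amax : R) (K : OB * R -> \bar R) : 0 <= y ->
  (forall x, alpha x <= amax) -> amax < 1 ->
  shot_kernel (n%:R * (1 - amax)) K ->
  forall t t', 0 < t -> t <= t' ->
  ((t ^+ n)%:E * \int[P]_w K (w, (t - sigma y w)%R) <=
   (t' ^+ n)%:E * \int[P]_w K (w, (t' - sigma y w)%R))%E.
Proof.
move=> y0 hmax amax1; have mid := measurable_idOB hB.
have msy : measurable_fun setT (sigma y) by exact: (sg_measurable hS).
have s0 w : 0 <= sigma y w by exact: (sigma_ge0 hS).
elim: n K => [|n IH] K hK t t' t0 tt'.
  rewrite !expr0 !mul1e; move: hK; rewrite mul0r => -[mK K0 Kle0 Kmono].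
  have mp r : measurable_fun setT (fun w : Omega => (w : OB, r - sigma y w)).
    by apply: measurable_fun_pair => //; exact: measurable_funB.
  apply: ge0_le_integral => //.
  - exact: (measurableT_comp mK (mp t)).
  - exact: (measurableT_comp mK (mp t')).
  move=> w _; have [ts|ts] := leP (t - sigma y w) 0; first by rewrite Kle0.
  have := Kmono w _ (t' - sigma y w) ts; rewrite !powRr0 !mul1e; apply.
  by rewrite lerD2r.
have t0' := lt_le_trans t0 tt'.
have [mK K0 Kle0 Kmono] := hK.
have i0 K' r : (forall z, 0 <= K' z)%E -> (0 <= \int[P]_w K' (w, (r - sigma y w)%R))%E.
  by move=> K'0; apply: integral_ge0.
have amaxn : n.+1%:R * (1 - amax) - (1 - amax) = n%:R * (1 - amax).
  by rewrite -natr1; ring.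
have h1 : shot_kernel (n%:R * (1 - amax)) (palm_kernel y K).
  by rewrite -amaxn; exact: shot_kernel_palm.
(* Multiplication by the level lowers the exponent by 1, which is at least [1 - amax] because [amax]
   is positive. *)
have amax0 : 0 < amax by have /andP[h _] := alpha01 0; exact: lt_le_trans (hmax 0).
have h2 : shot_kernel (n%:R * (1 - amax)) (size_kernel K).
  by apply: shot_kernel_size hK; rewrite -natr1; lra.
have [_ h10 _ _] := h1; have [_ h20 _ _] := h2.
have e r : 0 < r -> ((r ^+ n.+1)%:E * \int[P]_w K (w, (r - sigma y w)%R) =
    (r ^+ n)%:E * \int[P]_w size_kernel K (w, (r - sigma y w)%R) +
    (r ^+ n)%:E * \int[P]_w palm_kernel y K (w, (r - sigma y w)%R))%E.
  move=> r0; rewrite exprSr EFinM -muleA (expectation_shot_kernel_step y0 r0 mK K0 Kle0).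
  by rewrite ge0_muleDr// i0.
rewrite (e t t0) (e t' t0').
by apply: leeD; exact: IH.
Qed.

End scaling_monotonicity2.

Section exponential_tail.
Context {R : realType}.
Notation mu := (@lebesgue_measure R).

Lemma integral_exponential_tail (la s : R) : 0 < la ->
  (\int[mu]_t (\1_(`[s, +oo[%classic) t * (la * expR (- (la * t))))%:E = (expR (- (la * s)))%:E)%E.
Proof.
move=> la0.
have mpdf : measurable_fun setT (fun t : R => (exponential_pdf la t)%:E).
  by apply/measurable_EFinP; exact: measurable_exponential_pdf.
have pdf0 (t : R) : (0 <= (exponential_pdf la t)%:E)%E.
  by rewrite lee_fin exponential_pdf_ge0// ltW.
have aff := integral_affine (- s) ltr01 mpdf pdf0.
rewrite integral_exponential_pdf// invr1 mule1 in aff.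
transitivity (\int[mu]_t ((expR (- (la * s)))%:E * (exponential_pdf la (1 * t + - s))%:E))%E.
  apply: eq_integral => t _; rewrite mul1r indicE -EFinM; congr EFin.
  have [st|ts] := leP s t.
    rewrite mem_set/=; last by rewrite in_itv/= st.
    rewrite exponential_pdfE ?subr_ge0// mul1r /= mulrCA -expRD.
    by congr (_ * expR _); ring.
  rewrite memNset/=; last by rewrite in_itv/= andbT; apply/negP; rewrite -ltNge.
  by rewrite lt0_exponential_pdf ?subr_lt0// mul0r mulr0.
have mf : measurable_fun setT (fun t : R => (exponential_pdf la (1 * t + - s))%:E).
  by apply: (measurableT_comp mpdf); apply: measurable_funD => //; exact: measurable_funM.
rewrite ge0_integralZl_EFin ?expR_ge0//.
by rewrite aff mule1.
Qed.

End exponential_tail.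

(** * First passage times *)

Section passage_time.
Context {R : realType} {d : measure_display} {Omega : measurableType d}.
Variables (P : probability Omega R) (alpha : R -> R) (B sigma : R -> Omega -> R).
Hypotheses (malpha : measurable_fun setT alpha) (alpha01 : forall x, 0 < alpha x < 1).
Hypotheses (hB : is_brownian_motion P B)
  (hS : is_variable_order_subordinator P alpha B sigma).
Notation mu := (@lebesgue_measure R).
Notation M := (measurableTypeR R).
Notation OB := (g_sigma_algebraType (past B +oo%E)).

Definition sigma_unbounded : set Omega :=
  \bigcap_m \bigcup_n [set w | m%:R < sigma n%:R w].

(** On a path where [sigma] stays bounded, [first_passage] falls back to 0 for levels that are never
    exceeded. The indicator makes the process identically 0 there, hence nondecreasing and right
    continuous for every [w]. *)
Definition passage (t : R) (w : Omega) : R :=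
  \1_sigma_unbounded w * first_passage sigma t w.

Lemma measurable_sigma_unbounded : measurable sigma_unbounded.
Proof.
apply: bigcap_measurable => // m _; apply: bigcup_measurable => n _.
have mS : measurable_fun setT (sigma n%:R) by exact: (sg_measurable hS).
have := mS measurableT `]m%:R, +oo[%classic (measurable_itv _).
by rewrite setTI; congr (measurable _); apply/seteqP; split => w /=; rewrite in_itv/= andbT.
Qed.

Lemma sigma_nondecreasing w u v : 0 <= u -> u <= v -> sigma u w <= sigma v w.
Proof.
move=> u0; rewrite le_eqVlt => /predU1P[->//|uv].
by apply/ltW/(sg_increasing hS).
Qed.

(** At [la = 1] the Laplace exponent at time [n] is at least [n] whatever the orders along the path,
    so Markov's inequality gives [P(sigma(n) <= m) <= e^(m - n)]. *)
Lemma P_sigma_unbounded : P (~` sigma_unbounded) = 0%E.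
Proof.
have msy y : 0 <= y -> measurable_fun setT (sigma y) by exact: (sg_measurable hS).
have mle y c : 0 <= y -> measurable [set w | sigma y w <= c].
  move=> y0; have := msy y y0 measurableT `]-oo, c]%classic (measurable_itv _).
  by rewrite setTI; congr (measurable _); apply/seteqP; split => w /=; rewrite in_itv/=.
have bound (m n : nat) : (P [set w | (sigma n%:R w <= m%:R)%R] <= (expR m%:R * expR (- n%:R))%:E)%E.
  have n0 : 0 <= n%:R :> R by [].
  have h := conditional_laplace hB hS (c := fun=> 1) ltr01 n0 (measurable_cst _) (fun _ => ler01).
  have -> : P [set w | (sigma n%:R w <= m%:R)%R] = (\int[P]_w (\1_[set w | (sigma n%:R w <= m%:R)%R] w)%:E)%E.
    by rewrite integral_indic ?setIT//; exact: mle.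
  have mexp : measurable_fun setT (fun w => expR (- (1 * sigma n%:R w))).
    apply: (measurableT_comp (@measurable_expR R)); apply: measurable_funN.
    by apply: measurable_funM => //; exact: msy.
  apply: (@le_trans _ _ (\int[P]_w ((expR m%:R)%:E * (1 * expR (- (1 * sigma n%:R w)))%:E))%E).
    apply: ge0_le_integral => //.
    - by apply/measurable_EFinP/measurable_indic; exact: mle.
    - apply/measurable_EFinP; apply: measurable_funM => //; exact: measurable_funM.
    move=> w _; rewrite -EFinM lee_fin indicE; case: (boolP (w \in _)) => [|_].
      rewrite inE/= => sm; rewrite !mul1r -expRD -[leLHS]expR0 ler_expR subr_ge0//.
    by rewrite !mulr_ge0 ?expR_ge0.
  have mexp1 : measurable_fun setT (fun w => (1 * expR (- (1 * sigma n%:R w)))%:E).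
    by apply/measurable_EFinP; exact: measurable_funM.
  have exp0 w : setT w -> (0 <= (1 * expR (- (1 * sigma n%:R w)))%:E)%E.
    by move=> _; rewrite lee_fin mul1r expR_ge0.
  rewrite (@ge0_integralZl_EFin _ Omega R P setT measurableT _ exp0 mexp1 _ (expR_ge0 _)).
  rewrite EFinM; apply: lee_wpmul2l; first by rewrite lee_fin expR_ge0.
  rewrite -h; apply: (@le_trans _ _ (\int[P]_w (expR (- n%:R))%:E)%E); last first.
    rewrite integral_cst//; rewrite -[leRHS]mule1; apply: lee_wpmul2l.
      by rewrite lee_fin expR_ge0.
    exact: probability_le1.
  have mid := measurable_idOB hB.
  apply: ge0_le_integral => //.
  - apply/measurable_EFinP; apply: measurable_funM => //.
    apply: (measurableT_comp (@measurable_expR R)); apply: measurable_funN.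
    exact: (measurable_path_exponent malpha hB mid).
  - move=> w _; rewrite lee_fin mul1r ler_expR lerN2.
    have := laplace_exponent_ge (measurable_order_path1 malpha hB w) (order_path01 B alpha01 w) ltr01 n0.
    by rewrite minxx mulr1.
have null m : P (\bigcap_n [set w | (sigma n%:R w <= m%:R)%R]) = 0%E.
  apply/eqP; rewrite eq_le measure_ge0 andbT; apply/lee_addgt0Pr => e e0.
  rewrite add0e.
  have : expR (m%:R : R) * expR (- n%:R) @[n --> \oo] --> expR (m%:R : R) * 0.
    by apply: cvgMl_tmp; exact: cvgn_expR.
  rewrite mulr0 => /cvgrPdist_le /(_ e e0) [N _ /(_ N (leqnn N))].
  rewrite /= sub0r normrN ger0_norm ?mulr_ge0 ?expR_ge0// => hN.
  apply: (@le_trans _ _ (P [set w | (sigma N%:R w <= m%:R)%R])); last first.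
    by apply: le_trans (bound m N) _; rewrite lee_fin.
  apply: le_measure; rewrite ?inE.
  - by apply: bigcap_measurable => // n _; apply: mle.
  - exact: mle.
  - by move=> w; apply.
have -> : ~` sigma_unbounded = \bigcup_m \bigcap_n [set w | (sigma n%:R w <= m%:R)%R].
  rewrite /sigma_unbounded setC_bigcap; apply: eq_bigcupr => m _.
  by rewrite setC_bigcup; apply: eq_bigcapr => n _; apply/seteqP; split => w /=; rewrite leNgt => /negP.
pose F m := \bigcap_n [set w | (sigma n%:R w <= m%:R)%R].
have mF m : measurable (F m) by apply: bigcap_measurable => // n _; apply: mle.
have -> : \bigcup_m \bigcap_n [set w | (sigma n%:R w <= m%:R)%R] = \bigcup_m F m by [].
apply/eqP; rewrite eq_le measure_ge0 andbT.
apply: (@le_trans _ _ (\sum_(m <oo) P (F m))%E).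
  by apply: measure_sigma_subadditive => //; exact: bigcupT_measurable.
by rewrite eseries0// => m _ _; exact: null.
Qed.

Lemma passage_set_nonempty t w : sigma_unbounded w ->
  has_inf [set s | 0 <= s /\ t < sigma s w].
Proof.
move=> Uw; split.
  have [n _ /= h] := Uw (Num.truncn t).+1 I.
  by exists n%:R => /=; split => //; apply: lt_trans h; rewrite truncnS_gt.
by exists 0 => s [].
Qed.

Lemma passageE t w : sigma_unbounded w -> passage t w = first_passage sigma t w.
Proof. by move=> Uw; rewrite /passage indicE mem_set// mul1r. Qed.

Lemma passage0 t w : ~ sigma_unbounded w -> passage t w = 0.
Proof. by move=> Uw; rewrite /passage indicE memNset// mul0r. Qed.

Lemma passage_ge0 t w : 0 <= passage t w.
Proof.
have [Uw|Uw] := pselect (sigma_unbounded w); last by rewrite passage0.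
rewrite passageE//; apply: lb_le_inf; first by have [] := passage_set_nonempty t Uw.
by move=> s [].
Qed.

Lemma passage_le t y w : 0 <= y -> t < sigma y w -> passage t w <= y.
Proof.
move=> y0 ty; have [Uw|Uw] := pselect (sigma_unbounded w); last by rewrite passage0.
by rewrite passageE//; apply: ge_inf; [have [] := passage_set_nonempty t Uw|split].
Qed.

Lemma passage_ge t y w : sigma_unbounded w -> 0 <= y -> sigma y w <= t -> y <= passage t w.
Proof.
move=> Uw y0 ty; rewrite passageE//.
apply: lb_le_inf; first by have [] := passage_set_nonempty t Uw.
move=> s [s0 ts]; rewrite leNgt; apply/negP => sy.
by have := lt_le_trans ts (le_trans (sigma_nondecreasing w s0 (ltW sy)) ty); rewrite ltxx.
Qed.

Lemma passage_gt t y w : sigma_unbounded w -> 0 <= y -> sigma y w < t -> y < passage t w.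
Proof.
move=> Uw y0 ty.
have [y' yy' ty'] : exists2 y', y < y' & sigma y' w <= t.
  have /cvgrPdist_lt /(_ (t - sigma y w)) := sg_right_continuous hS (w := w) y0.
  rewrite subr_gt0 => /(_ ty) [e /= e0 he].
  exists (y + e / 2); first by rewrite ltrDl divr_gt0.
  have := he (y + e / 2); rewrite /ball/= opprD addrA subrr sub0r normrN.
  rewrite ger0_norm ?divr_ge0 ?(ltW e0)// ltr_pdivrMr// ltr_pMr// ltr1n ltrDl divr_gt0//.
  by move=> /(_ isT isT); rewrite distrC => /(le_lt_trans (ler_norm _)); rewrite ltrD2r => /ltW.
by apply: (lt_le_trans yy'); apply: passage_ge => //; rewrite (le_trans y0)// ltW.
Qed.

(** The bound has to hold at a time strictly beyond [y]: [sigma(y) <= t] alone allows the passage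
    time to equal [y]. The countable quantifier serves measurability. *)
Lemma passage_gtP t y w : sigma_unbounded w -> 0 <= y ->
  y < passage t w <-> exists n, sigma (y + n.+1%:R^-1) w <= t.
Proof.
move=> Uw y0; split.
  move=> yL; have [n hn] : exists n, y + n.+1%:R^-1 < passage t w.
    have d0 : 0 < passage t w - y by rewrite subr_gt0.
    exists (Num.truncn (passage t w - y)^-1).
    by rewrite -ltrBrDl invf_plt ?posrE// truncnS_gt.
  exists n; rewrite leNgt; apply/negP => /passage_le.
  by rewrite addr_ge0// => /(_ isT); rewrite leNgt hn.
move=> [n hn]; apply: (@lt_le_trans _ _ (y + n.+1%:R^-1)); first by rewrite ltrDl.
by apply: passage_ge => //; rewrite addr_ge0.
Qed.

Lemma measurable_passage t : measurable_fun setT (passage t).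
Proof.
apply: (measurability (@RGenOInfty.G R)); first exact: RGenOInfty.measurableE.
move=> _ [_ [y ->] <-]; rewrite setTI.
have [y0|y0] := leP 0 y; last first.
  rewrite (_ : _ @^-1` _ = setT)//; apply/seteqP; split => // w _ /=.
  by rewrite in_itv/= andbT (lt_le_trans y0)// passage_ge0.
rewrite (_ : _ @^-1` _ = sigma_unbounded `&` \bigcup_n [set w | sigma (y + n.+1%:R^-1) w <= t]).
  apply: measurableI; first exact: measurable_sigma_unbounded.
  apply: bigcup_measurable => n _.
  have ms : measurable_fun setT (sigma (y + n.+1%:R^-1)).
    by apply: (sg_measurable hS); rewrite addr_ge0.
  have := ms measurableT `]-oo, t]%classic (measurable_itv _).
  by rewrite setTI; congr (measurable _); apply/seteqP; split => w /=; rewrite in_itv/=.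
apply/seteqP; split => w /=; rewrite in_itv/= andbT.
  have [Uw|Uw] := pselect (sigma_unbounded w); last by rewrite passage0// ltNge y0.
  by move=> /(passage_gtP t Uw y0) [n hn]; split => //; exists n.
by move=> [Uw [n _ hn]]; apply/(passage_gtP t Uw y0); exists n.
Qed.

Lemma passage_nondecreasing w t t' : t <= t' -> passage t w <= passage t' w.
Proof.
move=> tt'; have [Uw|Uw] := pselect (sigma_unbounded w); last by rewrite !passage0.
rewrite leNgt; apply/negP => h.
have L0 := passage_ge0 t' w.
move/(passage_gtP t Uw L0) : h => [n hn].
by have /(passage_gtP t' Uw L0) : exists n, sigma (passage t' w + n.+1%:R^-1) w <= t';
  [exists n; exact: le_trans tt'|rewrite ltxx].
Qed.

(** Every level below [sigma (passage t + e / 2)], a number larger than [t], is passed by time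
    [passage t + e / 2]. *)
Lemma passage_right_continuous w t : passage s w @[s --> t^'+] --> passage t w.
Proof.
have [Uw|Uw] := pselect (sigma_unbounded w); last first.
  rewrite (_ : (fun s => passage s w) = cst (passage t w)); first exact: cvg_cst.
  by apply/funext => s; rewrite /= !passage0.
apply/cvgrPdist_lt => e e0.
have L0 : 0 <= passage t w + e / 2 by rewrite addr_ge0 ?passage_ge0// divr_ge0// ltW.
have ts : t < sigma (passage t w + e / 2) w.
  rewrite ltNge; apply/negP => /(passage_ge Uw L0).
  by rewrite leNgt ltrDl divr_gt0.
near=> s; rewrite distrC ger0_norm; last first.
  by rewrite subr_ge0; apply: passage_nondecreasing; near: s; exact: nbhs_right_ge.
rewrite ltrBlDl; apply: (@le_lt_trans _ _ (passage t w + e / 2)).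
  by apply: passage_le => //; near: s; apply: nbhs_right_lt.
by rewrite ltrD2l ltr_pdivrMr// ltr_pMr// ltr1n.
Unshelve. all: by end_near. Qed.

Lemma measurable_passage2 : measurable_fun setT (fun z : Omega * M => passage (Num.max 0 z.2) z.1).
Proof.
apply: (@measurable_fun_right_continuous _ Omega _ (Omega * M)%type R passage (fun z => Num.max 0 z.2) fst) => //.
- by apply: measurable_maxr => //; exact: measurable_snd.
- by move=> z; rewrite le_max lexx.
- by move=> u _; exact: measurable_passage.
- by move=> w u _; exact: passage_right_continuous.
Qed.

End passage_time.

(** * The passage time over an exponential level *)

Section passage_law.
Context {R : realType} {d : measure_display} {Omega : measurableType d}.
Variables (P : probability Omega R) (alpha : R -> R) (B sigma : R -> Omega -> R).
Hypotheses (malpha : measurable_fun setT alpha) (alpha01 : forall x, 0 < alpha x < 1).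
Hypotheses (hB : is_brownian_motion P B)
  (hS : is_variable_order_subordinator P alpha B sigma).
Notation mu := (@lebesgue_measure R).
Notation M := (measurableTypeR R).
Notation OB := (g_sigma_algebraType (past B +oo%E)).

Definition exp_weight (la t : R) : R :=
  \1_(`[0, +oo[%classic) t * (la * expR (- (la * t))).

(** Given the path of [B], the density in [y] of the passage time over an independent exponential
    level of rate [la]. *)
Definition occupation_weight (la : R) (w : Omega) (y : R) : R :=
  \1_(`[0, +oo[%classic) y *
    (la `^ order_path alpha B w y * expR (- path_exponent alpha B la y w)).

Lemma exp_weight_ge0 la t : 0 < la -> 0 <= exp_weight la t.
Proof. by move=> la0; rewrite /exp_weight !mulr_ge0 ?expR_ge0// ltW. Qed.

Lemma occupation_weight_ge0 la w y : 0 <= occupation_weight la w y.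
Proof. by rewrite /occupation_weight !mulr_ge0 ?expR_ge0 ?powR_ge0. Qed.

Lemma measurable_exp_weight la : measurable_fun setT (exp_weight la).
Proof.
have m0 : measurable (`[0, +oo[%classic : set R) by exact: measurable_itv.
apply: measurable_funM; first exact: measurable_indic.
apply: measurable_funM => //; apply: (measurableT_comp (@measurable_expR R)).
by apply: measurable_funN; exact: measurable_funM.
Qed.

Lemma measurable_occupation_weight la d' (Z : measurableType d') (f : Z -> OB) (y : Z -> R) :
  measurable_fun setT f -> measurable_fun setT y ->
  measurable_fun setT (fun z => occupation_weight la (f z) (y z)).
Proof.
move=> mf my.
have m0 : measurable (`[0, +oo[%classic : set R) by exact: measurable_itv.
apply: measurable_funM; first exact: (measurableT_comp (measurable_indic m0) my).
apply: measurable_funM.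
  by apply: measurable_powR2 => //; exact: (measurable_order_path malpha hB).
apply: (measurableT_comp (@measurable_expR R)); apply: measurable_funN.
exact: (measurable_path_exponent malpha hB).
Qed.

Lemma integral_occupation_weight la w y : 0 < la ->
  (\int[mu]_x (\1_(`]y, +oo[%classic) x * occupation_weight la w x)%:E =
   (expR (- path_exponent alpha B la (Num.max 0 y) w))%:E)%E.
Proof.
move=> la0; have y0 : 0 <= Num.max 0 y by rewrite le_max lexx.
have ma := measurable_order_path1 malpha hB w.
rewrite -(integral_rate_expN_tail ma (order_path01 B alpha01 w) la0 y0).
have mG : measurable_fun setT (fun x => (la `^ order_path alpha B w x *
    expR (- laplace_exponent (order_path alpha B w) la x))%:E).
  apply/measurable_EFinP; apply: measurable_funM; first exact: measurable_powR2.
  apply: (measurableT_comp (@measurable_expR R)); apply: measurable_funN.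
  by apply: (@measurable_path_exponent _ _ _ P alpha B malpha hB _ R (fun=> w) (cst la) id).
rewrite -integral_itv_obnd_cbnd; last exact: measurable_funTS.
have [yneg|ypos] := ltP y 0.
  rewrite integral_itv_obnd_cbnd; last exact: measurable_funTS.
  rewrite [RHS]integral_mkcond; apply: eq_integral => x _.
  rewrite epatch_indic /occupation_weight -EFinM; congr EFin.
  have [x0|x0] := leP 0 x.
    have -> : \1_(`]y, +oo[%classic) x = 1 :> R.
      by rewrite indicE mem_set//= in_itv/= andbT (lt_le_trans yneg x0).
    have -> : \1_(`[0, +oo[%classic) x = 1 :> R by rewrite indicE mem_set//= in_itv/= x0.
    by rewrite !mul1r mulr1.
  have -> : \1_(`[0, +oo[%classic) x = 0 :> R.
    by rewrite indicE memNset//= in_itv/= andbT; apply/negP; rewrite -ltNge.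
  by rewrite mul0r !mulr0.
rewrite [RHS]integral_mkcond; apply: eq_integral => x _.
rewrite epatch_indic /occupation_weight -EFinM; congr EFin.
rewrite mulrA.
have -> : \1_(`]y, +oo[%classic) x * \1_(`[0, +oo[%classic) x = \1_(`]y, +oo[%classic) x :> R.
  rewrite !indicE -natrM mulnb; congr ((_ : bool)%:R).
  apply/andP/idP; rewrite !inE/= !in_itv/= !andbT; first by case.
  by move=> yx; rewrite (le_trans ypos (ltW yx)).
by rewrite mulrC.
Qed.

Lemma measurable_passage1 w : measurable_fun setT (fun t => passage sigma t w).
Proof.
apply: nondecreasing_measurable => // t t' tt'; exact: (passage_nondecreasing hS).
Qed.

Lemma integral_passage_ray la w y : 0 < la -> sigma_unbounded sigma w ->
  (\int[mu]_t (\1_(`]y, +oo[%classic) (passage sigma t w) * exp_weight la t)%:E =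
   (expR (- (la * sigma (Num.max 0 y) w)))%:E)%E.
Proof.
move=> la0 Uw; have y0 : 0 <= Num.max 0 y by rewrite le_max lexx.
have s0 : 0 <= sigma (Num.max 0 y) w by exact: (sigma_ge0 hS).
rewrite -(integral_exponential_tail _ la0).
have mray (b : itv_bound R) : measurable ([set` Interval b +oo%O] : set R) by exact: measurable_itv.
apply: ae_eq_integral => //.
- apply/measurable_EFinP; apply: measurable_funM; last exact: measurable_exp_weight.
  exact: (measurableT_comp (measurable_indic (mray _)) (measurable_passage1 w)).
- apply/measurable_EFinP; apply: measurable_funM; first exact: measurable_indic.
  apply: measurable_funM => //; apply: (measurableT_comp (@measurable_expR R)).
  by apply: measurable_funN; exact: measurable_funM.
(* The level [sigma (max 0 y)] itself is exceptional, because the passage time over it can be equal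
   to [y]. *)
exists [set sigma (Num.max 0 y) w]; split; [exact: measurable_set1|exact: lebesgue_measure_set1|].
move=> t /= /not_implyP[_]; apply: contra_notP => /eqP tne.
congr EFin; rewrite /exp_weight mulrA; congr (_ * _).
rewrite !indicE -natrM mulnb; congr ((_ : bool)%:R).
have [ts|st] := ltP t (sigma (Num.max 0 y) w).
  rewrite [RHS]memNset/=; last by rewrite in_itv/= andbT; apply/negP; rewrite -ltNge.
  have Ly := passage_le y0 ts.
  case: (boolP (t \in _)) => [|_]; last by rewrite andbF.
  rewrite inE/= in_itv/= andbT => t0; rewrite memNset//= in_itv/= andbT; apply/negP.
  rewrite -leNgt; have [y1|y1] := leP 0 y.
    by rewrite max_r in Ly.
  by move: ts; rewrite max_l ?(ltW y1)// (sg_start hS) ltNge t0.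
rewrite [RHS]mem_set/=; last by rewrite in_itv/= st.
have {}st : sigma (Num.max 0 y) w < t by rewrite lt_neqAle eq_sym tne.
have yL := passage_gt hS Uw y0 st.
have t0 : 0 <= t by exact: le_trans s0 (ltW st).
have {}yL : y < passage sigma t w by apply: le_lt_trans yL; rewrite le_max lexx orbT.
by rewrite !mem_set//= in_itv/= andbT.
Qed.

(* Both sides are the law of [(w, L)]; they are compared on [D x ]y, +oo[],
   where [passage t > y] iff [sigma y < t], up to a null set of [t]. *)
Lemma passage_law (la : R) (K : OB * R -> \bar R) : 0 < la ->
  measurable_fun setT K -> (forall z, 0 <= K z)%E ->
  (\int[P]_w \int[mu]_t (K (w, passage sigma t w) * (exp_weight la t)%:E) =
   \int[P]_w \int[mu]_y (K (w, y) * (occupation_weight la w y)%:E))%E.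
Proof.
move=> la0 mK K0.
have [m mE] := sigma_finite_product P mu.
have mid := measurable_idOB hB.
pose f (z : Omega * M) : OB * R := (z.1, passage sigma (Num.max 0 z.2) z.1).
pose g (z : Omega * M) : OB * R := (z.1, z.2).
pose p (z : Omega * M) : R := exp_weight la z.2.
pose q (z : Omega * M) : R := occupation_weight la z.1 z.2.
have mf1 : measurable_fun setT (fun z : Omega * M => z.1 : OB).
  exact: (measurableT_comp mid measurable_fst).
have mf : measurable_fun setT f.
  by apply: measurable_fun_pair => //; exact: (measurable_passage2 hS).
have mg : measurable_fun setT g.
  by apply: measurable_fun_pair => //; exact: measurable_snd.
have mp : measurable_fun setT p.
  exact: (measurableT_comp (measurable_exp_weight la) measurable_snd).
have mq : measurable_fun setT q.
  by apply: measurable_occupation_weight => //; exact: measurable_snd.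
have p0 z : 0 <= p z by exact: exp_weight_ge0.
have q0 z : 0 <= q z by exact: occupation_weight_ge0.
have fpE (h : OB * R -> \bar R) w t : (h (f (w, t)) * (p (w, t))%:E =
    h (w, passage sigma t w) * (exp_weight la t)%:E)%E.
  rewrite /f /p /=; have [t0|t0] := leP 0 t; first by [].
  rewrite /exp_weight [\1_(_) _]indicE memNset ?mul0r ?mule0//=.
  by rewrite in_itv/= andbT; apply/negP; rewrite -ltNge.
have [m1 m1E] := image_density m mf mp p0.
have [m2 m2E] := image_density m mg mq q0.
have eE (h : OB * R -> \bar R) : measurable_fun setT h -> (forall z, 0 <= h z)%E ->
    (\int[m1]_z h z = \int[P]_w \int[mu]_t (h (w, passage sigma t w) * (exp_weight la t)%:E))%E.
  move=> mh h0; rewrite m1E// mE.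
  - by apply: eq_integral => w _; apply: eq_integral => t _; exact: fpE.
  - apply: emeasurable_funM; first exact: (measurableT_comp mh mf).
    exact/measurable_EFinP.
  - by move=> z; rewrite mule_ge0// lee_fin.
have eE2 (h : OB * R -> \bar R) : measurable_fun setT h -> (forall z, 0 <= h z)%E ->
    (\int[m2]_z h z = \int[P]_w \int[mu]_y (h (w, y) * (occupation_weight la w y)%:E))%E.
  move=> mh h0; rewrite m2E// mE//.
  - apply: emeasurable_funM; first exact: (measurableT_comp mh mg).
    exact/measurable_EFinP.
  - by move=> z; rewrite mule_ge0// lee_fin.
have mindic (A : set (OB * R)) : measurable A -> measurable_fun setT (fun z => (\1_A z)%:E : \bar R).
  by move=> mA; apply/measurable_EFinP; exact: measurable_indic.
have indic0 (A : set (OB * R)) z : (0 <= (\1_A z)%:E :> \bar R)%E by rewrite lee_fin.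
transitivity (\int[m1]_z K z)%E; first exact/esym/eE.
transitivity (\int[m2]_z K z)%E; last exact: eE2.
apply: eq_measure_integral => A mA _.
have mray (D : set OB) y : measurable D -> measurable (D `*` (`]y, +oo[%classic : set R)).
  by move=> mD; apply: measurableX => //; exact: measurable_itv.
have ray1 (D : set OB) y : measurable D ->
    m1 (D `*` `]y, +oo[%classic) =
    (\int[P]_w (\1_D w * expR (- (la * sigma (Num.max 0 y) w)))%:E)%E.
  move=> mD; transitivity (\int[m1]_z (\1_(D `*` `]y, +oo[%classic) z)%:E)%E.
    by rewrite integral_indic ?setIT//; exact: mray.
  rewrite (eE _ (mindic _ (mray D y mD)) (indic0 _)).
  have mse : measurable_fun setT (fun w : Omega => (\1_D w * expR (- (la * sigma (Num.max 0 y) w)))%:E).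
    apply/measurable_EFinP; apply: measurable_funM.
      have mD' : measurable (D : set Omega).
        by have := mid measurableT D mD; rewrite setTI.
      exact: (measurable_indic mD').
    apply: (measurableT_comp (@measurable_expR R)); apply: measurable_funN.
    apply: measurable_funM => //; apply: (sg_measurable hS); by rewrite le_max lexx.
  have mF : measurable_fun setT (fun z : Omega * M =>
      ((\1_(D `*` `]y, +oo[%classic) (f z))%:E * (p z)%:E)%E).
    apply: emeasurable_funM; first exact: (measurableT_comp (mindic _ (mray D y mD)) mf).
    exact/measurable_EFinP.
  have F0 z : (0 <= (\1_(D `*` `]y, +oo[%classic) (f z))%:E * (p z)%:E)%E.
    by rewrite mule_ge0// lee_fin.
  apply: (@ae_eq_integral _ Omega R P setT) => //.
    have := @measurable_fun_fubini_tonelli_F _ _ _ _ _ mu _ mF F0.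
    apply: eq_measurable_fun => w _; apply: eq_integral => t _ /=.
    exact: (fpE (fun z => (\1_(D `*` `]y, +oo[%classic) z)%:E)).
  exists (~` sigma_unbounded sigma); split.
  - exact: measurableC (measurable_sigma_unbounded hS).
  - exact: (P_sigma_unbounded malpha alpha01 hB hS).
  move=> w /= /not_implyP[_]; apply: contra_notP => /contrapT Uw.
  rewrite EFinM -(integral_passage_ray _ la0 Uw) -ge0_integralZl_EFin//; last 2 first.
  - by move=> x _; rewrite lee_fin mulr_ge0// exp_weight_ge0.
  - apply/measurable_EFinP; apply: measurable_funM; last exact: measurable_exp_weight.
    apply: (measurableT_comp _ (measurable_passage1 w)).
    by apply: measurable_indic; exact: measurable_itv.
  apply: eq_integral => x _; rewrite -!EFinM; congr EFin; rewrite [RHS]mulrA; congr (_ * exp_weight la x).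
  rewrite !indicE -natrM mulnb; congr ((_ : bool)%:R).
  by apply/idP/andP; rewrite !inE/= => -[].
have ray2 (D : set OB) y : measurable D ->
    m2 (D `*` `]y, +oo[%classic) =
    (\int[P]_w (\1_D w * expR (- path_exponent alpha B la (Num.max 0 y) w))%:E)%E.
  move=> mD; transitivity (\int[m2]_z (\1_(D `*` `]y, +oo[%classic) z)%:E)%E.
    by rewrite integral_indic ?setIT//; exact: mray.
  rewrite (eE2 _ (mindic _ (mray D y mD)) (indic0 _)).
  apply: eq_integral => w _.
  rewrite EFinM -integral_occupation_weight// -ge0_integralZl_EFin//; last 2 first.
  - by move=> x _; rewrite lee_fin mulr_ge0// occupation_weight_ge0.
  - apply/measurable_EFinP; apply: measurable_funM.
      by apply: measurable_indic; exact: measurable_itv.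
    exact: (@measurable_occupation_weight la _ _ (fun=> w) id).
  apply: eq_integral => x _; rewrite -!EFinM; congr EFin; rewrite [RHS]mulrA; congr (_ * occupation_weight la w x).
  rewrite !indicE -natrM mulnb; congr ((_ : bool)%:R).
  by apply/idP/andP; rewrite !inE/= => -[].
have m1oo : (m1 setT < +oo)%E.
  have -> : m1 setT = (\int[m1]_z 1)%E by rewrite integral_cst// mul1e.
  rewrite (eE (cst 1%E))//; apply: (@le_lt_trans _ _ (\int[P]_w 1)%E); last first.
    by rewrite integral_cst// mul1e; apply: le_lt_trans (probability_le1 P measurableT) (ltry _).
  rewrite le_eqVlt; apply/orP; left; apply/eqP; apply: eq_integral => w _.
  under eq_integral do rewrite mul1e.
  by rewrite integral_exponential_tail// mulr0 oppr0 expR0.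
apply: (finite_measure_eq_rays (m2 := m2) m1oo _ mA) => D y mD.
rewrite (ray1 D y mD) (ray2 D y mD); apply/esym.
apply: (conditional_laplace hB hS la0 _ (measurable_indic mD)) => //.
by rewrite le_max lexx.
Qed.

End passage_law.

(** * The hitting rate: scaling and Laplace transform *)

Section tauberian.
Context {R : realType} {d : measure_display} {Omega : measurableType d}.
Variables (P : probability Omega R) (alpha : R -> R) (B sigma : R -> Omega -> R).
Hypotheses (malpha : measurable_fun setT alpha) (alpha01 : forall x, 0 < alpha x < 1).
Hypotheses (hB : is_brownian_motion P B)
  (hS : is_variable_order_subordinator P alpha B sigma).
Notation mu := (@lebesgue_measure R).
Notation M := (measurableTypeR R).
Notation OB := (g_sigma_algebraType (past B +oo%E)).

Lemma laplace_shifted_stable_tail (th s la : R) : 0 < th < 1 -> 0 < la ->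
  (\int[mu]_t (stable_tail th (t - s) * (la * expR (- (la * t))))%:E =
   (la `^ th * expR (- (la * s)))%:E)%E.
Proof.
move=> /andP[th0 th1] la0.
have th01 : 0 <= th < 1 by rewrite (ltW th0) th1.
have mst : measurable_fun setT (stable_tail th).
  by apply: (@measurable_stable_tail R _ R (cst th) id) => // x; rewrite /= th0.
pose f (u : R) : \bar R := (stable_tail th u * expR (- (la * u)))%:E.
have mf : measurable_fun setT f.
  apply/measurable_EFinP; apply: measurable_funM => //.
  apply: (measurableT_comp (@measurable_expR R)); apply: measurable_funN.
  exact: measurable_funM.
have f0 u : (0 <= f u)%E by rewrite lee_fin mulr_ge0 ?expR_ge0 ?stable_tail_ge0.
have aff := integral_affine (- s) ltr01 mf f0.
rewrite laplace_stable_tail// invr1 mul1e in aff.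
have k0 : 0 <= la * expR (- (la * s)) by rewrite mulr_ge0 ?expR_ge0 ?ltW.
transitivity (\int[mu]_t ((la * expR (- (la * s)))%:E * f (1 * t + - s)%R))%E.
  apply: eq_integral => t _; rewrite /f -EFinM; congr EFin.
  have -> : expR (- (la * t)) = expR (- (la * s)) * expR (- (la * (t - s))).
    by rewrite -expRD; congr expR; ring.
  by rewrite mul1r; ring.
have mfa : measurable_fun [set: M] (fun t : M => f (1 * t + - s)).
  apply: (measurableT_comp mf); apply: measurable_funD => //; exact: measurable_funM.
rewrite (@ge0_integralZl_EFin _ M R mu setT measurableT _ (fun t _ => f0 _) mfa _ k0) aff -EFinM.
have laE : la `^ th = la `^ (th - 1) * la.
  transitivity (la `^ (th - 1) * la `^ 1); last by rewrite powRr1 ?ltW.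
  by rewrite -powRD ?subrK// (gt_eqF la0) implybT.
by rewrite laE; congr EFin; ring.
Qed.

(** On positive arguments the product is a constant times [s^(th - a)]. *)
Lemma stable_tail_nondecreasing (th a s s' : R) : 0 < a < 1 -> a <= th -> 0 < s -> s <= s' ->
  s `^ th * stable_tail a s <= s' `^ th * stable_tail a s'.
Proof.
move=> /andP[a0 a1] ath s0 ss'; have s'0 : 0 < s' by exact: lt_le_trans ss'.
have G0 : 0 < Gamma (1 - a) by apply: (Gamma_integral _).2; rewrite (ltW a0).
have E (x : R) : 0 < x -> x `^ th * stable_tail a x = x `^ (th - a) / Gamma (1 - a).
  move=> x0; rewrite /stable_tail indicE mem_set/=; last by rewrite in_itv/= x0.
  by rewrite mul1r mulrA -powRD// (gt_eqF x0) implybT.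
rewrite !E// ler_pM2r ?invr_gt0//.
by apply: ge0_ler_powR => //; rewrite ?nnegrE ?subr_ge0// ltW.
Qed.

Variable O : set R.
Hypothesis mO : measurable O.

(** This is [J_O(la)]; the restriction to [y >= 0] and the exponential sit in
    [occupation_weight]. *)
Definition occupation_laplace (la : R) : \bar R :=
  (\int[P]_w \int[mu]_y (\1_O (bpos B y w) * occupation_weight alpha B la w y)%:E)%E.

Definition hitting_density (z : (Omega * M) * M) : R :=
  \1_O (bpos B z.1.2 z.1.1) * (\1_(`[0, +oo[%classic) z.1.2 *
    stable_tail (order_path alpha B z.1.1 z.1.2) (z.2 - sigma (Num.max 0 z.1.2) z.1.1)).

(** This is [r(t)], by compensation the expected number of jumps of [sigma] across level [t] made
    while [B] is in [O]. Times with [sigma(y) >= t] do not count, because [stable_tail] vanishes on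
    nonpositive arguments. *)
Definition hitting_rate (t : R) : \bar R :=
  (\int[P]_w \int[mu]_y (hitting_density (w, y, t))%:E)%E.

Lemma hitting_density_ge0 z : 0 <= hitting_density z.
Proof.
apply: mulr_ge0 => //; apply: mulr_ge0 => //; apply: stable_tail_ge0.
by have /andP[h0 h1] := order_path01 B alpha01 z.1.1 z.1.2; rewrite (ltW h0) h1.
Qed.

Lemma measurable_hitting_density : measurable_fun setT hitting_density.
Proof.
have m0 : measurable (`[0, +oo[%classic : set R) by exact: measurable_itv.
have m12 : measurable_fun setT (fun z : (Omega * M) * M => z.1.2 : M).
  exact: (measurableT_comp measurable_snd measurable_fst).
have m11 : measurable_fun setT (fun z : (Omega * M) * M => z.1.1 : OB).
  apply: (measurableT_comp (measurable_idOB hB)).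
  exact: (measurableT_comp measurable_fst measurable_fst).
apply: measurable_funM.
  by apply: (measurableT_comp (measurable_indic mO)); exact: (measurable_bpos hB).
apply: measurable_funM; first exact: (measurableT_comp (measurable_indic m0) m12).
apply: measurable_stable_tail.
- exact: (measurable_order_path malpha hB).
- apply: measurable_funB; first exact: measurable_snd.
  apply: (measurable_sigma hS) => //.
  exact: (measurableT_comp measurable_fst measurable_fst).
- by move=> z; exact: alpha01.
Qed.

(** At fixed [y] the integrand is the expectation of a kernel in [t - sigma(y)], namely [1_O(B_y)]
    times the stable tail of order [alpha(B_y)]. It is a shot kernel of exponent [n (1 - amax)],
    because this order is at most [amax <= n (1 - amax)]. *)
Lemma hitting_rate_mono n amax : (forall x, alpha x <= amax) -> amax < 1 ->
  amax <= n%:R * (1 - amax) -> forall t t', 0 < t -> t <= t' ->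
  ((t ^+ n)%:E * hitting_rate t <= (t' ^+ n)%:E * hitting_rate t')%E.
Proof.
move=> hmax amax1 hn t t' t0 tt'.
have mH s : measurable_fun setT (fun z : Omega * M => (hitting_density (z, s))%:E).
  by apply/measurable_EFinP; apply: (measurableT_comp measurable_hitting_density).
have H0 s (z : Omega * M) : (0 <= (hitting_density (z, s))%:E)%E.
  by rewrite lee_fin hitting_density_ge0.
have mI s : measurable_fun setT (fun y : M => (\int[P]_w (hitting_density (w, y, s))%:E)%E).
  exact: (@measurable_fun_fubini_tonelli_G _ _ _ _ _ P _ (mH s) (H0 s)).
have I0 s (y : M) : (0 <= \int[P]_w (hitting_density (w, y, s))%:E)%E.
  by apply: integral_ge0 => w _; exact: (H0 s (w, y)).
have E s : 0 <= s -> ((s ^+ n)%:E * hitting_rate s =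
    \int[mu]_y ((s ^+ n)%:E * \int[P]_w (hitting_density (w, y, s))%:E))%E.
  move=> s0; have sn0 : 0 <= s ^+ n by rewrite exprn_ge0.
  rewrite (@ge0_integralZl_EFin _ M R mu setT measurableT _ (fun y _ => I0 s y) (mI s) _ sn0).
  congr (_ * _)%E; exact: (@fubini_tonelli _ _ _ _ _ P mu _ (mH s) (H0 s)).
have t'0 : 0 < t' by exact: lt_le_trans tt'.
rewrite (E _ (ltW t0)) (E _ (ltW t'0)); apply: (@ge0_le_integral _ M R mu setT measurableT).
- by move=> y _; rewrite mule_ge0// lee_fin exprn_ge0// ltW.
- exact: measurable_funeM.
- exact: measurable_funeM.
move=> y _; have [y0|y0] := leP 0 y; last first.
  have Z s (w : Omega) : hitting_density (w, y, s) = 0.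
    rewrite /hitting_density/= [\1_(`[0, +oo[%classic) _]indicE memNset ?mul0r ?mulr0//=.
    by rewrite in_itv/= andbT; apply/negP; rewrite -ltNge.
  have Z0 s : (\int[P]_w (hitting_density (w, y, s))%:E = 0)%E.
    by under eq_integral do rewrite Z; exact: integral0.
  by rewrite !Z0 !mule0.
pose K (z : OB * R) : \bar R :=
  (\1_O (bpos B y z.1) * stable_tail (order_path alpha B z.1 y) z.2)%:E.
have HK s : (\int[P]_w (hitting_density (w, y, s))%:E = \int[P]_w K (w, s - sigma y w)%R)%E.
  apply: eq_integral => w _; congr EFin; rewrite /hitting_density /=.
  by rewrite [\1_(`[0, +oo[%classic) _]indicE mem_set/= ?in_itv/= ?y0// mul1r (max_r y0).
rewrite !HK; apply: (expectation_shot_kernel_mono malpha alpha01 hB hS (amax := amax)) => //.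
have my : measurable_fun setT (fun z : OB * R => y) by exact: measurable_cst.
have K1 (z : OB * R) : 0 <= stable_tail (order_path alpha B z.1 y) z.2.
  by apply: stable_tail_ge0; have /andP[h0 h1] := order_path01 B alpha01 z.1 y; rewrite (ltW h0) h1.
split.
- apply/measurable_EFinP; apply: measurable_funM.
    apply: (measurableT_comp (measurable_indic mO)); exact: (measurable_bpos hB measurable_fst my).
  apply: measurable_stable_tail; last by move=> z; exact: alpha01.
    exact: (measurable_order_path malpha hB measurable_fst my).
  exact: measurable_snd.
- by move=> z; rewrite lee_fin mulr_ge0.
- by move=> w s s0; rewrite /K stable_tail_le0// mulr0.
move=> w s s' s0 ss'; rewrite /K -!EFinM lee_fin mulrCA [leRHS]mulrCA ler_wpM2l//.
apply: stable_tail_nondecreasing => //; first exact: order_path01.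
exact: le_trans (hmax _) hn.
Qed.

Lemma laplace_passage_occupation la : 0 < la ->
  (\int[P]_w \int[mu]_t (\1_O (bpos B (passage sigma t w) w) * exp_weight la t)%:E =
   occupation_laplace la)%E.
Proof.
move=> la0.
pose K (z : OB * R) : \bar R := (\1_O (bpos B z.2 z.1))%:E.
have mK : measurable_fun setT K.
  apply/measurable_EFinP; apply: (measurableT_comp (measurable_indic mO)).
  exact: (measurable_bpos hB measurable_fst measurable_snd).
have K0 z : (0 <= K z)%E by rewrite lee_fin.
exact: (passage_law malpha alpha01 hB hS la0 mK K0).
Qed.

Lemma hitting_density_tonelli (k : R -> R) : measurable_fun setT k -> (forall t, 0 <= k t) ->
  (\int[P]_w \int[mu]_y \int[mu]_t (hitting_density (w, y, t) * k t)%:E =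
   \int[mu]_t (hitting_rate t * (k t)%:E))%E.
Proof.
move=> mk k0; have [m mE] := sigma_finite_product P mu.
have mH := measurable_hitting_density.
have mF : measurable_fun setT (fun z : (Omega * M) * M => (hitting_density z * k z.2)%:E).
  apply/measurable_EFinP; apply: measurable_funM => //.
  exact: (measurableT_comp mk measurable_snd).
have F0 z : (0 <= (hitting_density z * k z.2)%:E)%E.
  by rewrite lee_fin mulr_ge0// hitting_density_ge0.
rewrite -(tonelli_path mE mF F0) (@fubini_tonelli _ _ _ _ _ m mu _ mF F0).
have mHt t : measurable_fun setT (fun z : Omega * M => (hitting_density (z, t))%:E).
  by apply/measurable_EFinP; exact: (measurableT_comp mH (measurable_pair2 t)).
apply: eq_integral => t _; rewrite muleC.
have Ht0 t' (z : Omega * M) : (0 <= (hitting_density (z, t'))%:E)%E.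
  by rewrite lee_fin hitting_density_ge0.
transitivity ((k t)%:E * \int[m]_z (hitting_density (z, t))%:E)%E; last first.
  by congr (_ * _)%E; exact: (mE _ (mHt t) (Ht0 t)).
rewrite -(@ge0_integralZl_EFin _ (Omega * M)%type R m setT measurableT _ (fun z _ => Ht0 t z) (mHt t) _ (k0 t)).
by apply: eq_integral => z _; rewrite -EFinM mulrC.
Qed.

(** The tail shifted by [sigma(y)] contributes [la^alpha e^(-la sigma(y))]; every factor except the
    exponential is a functional of the path of [B], so conditioning replaces that exponential by
    [e^(-Phi_y)]. *)
Lemma laplace_hitting la : 0 < la ->
  (\int[P]_w \int[mu]_y \int[mu]_t (hitting_density (w, y, t) * (la * expR (- (la * t))))%:E =
   occupation_laplace la)%E.
Proof.
move=> la0.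
have mpos : measurable (`[0, +oo[%classic : set R) by exact: measurable_itv.
have mst z : measurable_fun setT (fun t : M => stable_tail (order_path alpha B z.1 z.2) (t - sigma (Num.max 0 z.2) z.1)).
  apply: measurable_stable_tail => //; first exact: measurable_funB.
  by move=> _; exact: alpha01.
have me : measurable_fun setT (fun t : M => la * expR (- (la * t))).
  apply: measurable_funM => //; apply: (measurableT_comp (@measurable_expR R)).
  by apply: measurable_funN; exact: measurable_funM.
have st0 z t : 0 <= stable_tail (order_path alpha B z.1 z.2) t.
  by apply: stable_tail_ge0; have /andP[h0 h1] := order_path01 B alpha01 z.1 z.2; rewrite (ltW h0) h1.
pose c (z : OB * M) : R := \1_O (bpos B z.2 z.1) * (\1_(`[0, +oo[%classic) z.2 *
  la `^ order_path alpha B z.1 z.2).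
have c0 z : 0 <= c z by rewrite /c; apply: mulr_ge0 => //; apply: mulr_ge0 => //; exact: powR_ge0.
have mc : measurable_fun setT c.
  apply: measurable_funM; first apply: (measurableT_comp (measurable_indic mO)).
    exact: (measurable_bpos hB measurable_fst measurable_snd).
  apply: measurable_funM; first exact: (measurableT_comp (measurable_indic mpos) measurable_snd).
  apply: measurable_powR2 => //; exact: (measurable_order_path malpha hB measurable_fst measurable_snd).
have mcO : measurable_fun setT (fun z : Omega * M => c (z.1 : OB, z.2)).
  apply: (measurableT_comp mc); apply: measurable_fun_pair; last exact: measurable_snd.
  exact: (measurableT_comp (measurable_idOB hB) measurable_fst).
pose F (z : Omega * M) := (c z * expR (- (la * sigma (Num.max 0 z.2) z.1)))%:E.
pose G (z : Omega * M) := (c z * expR (- path_exponent alpha B la (Num.max 0 z.2) z.1))%:E.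
have F0 z : (0 <= F z)%E by rewrite lee_fin mulr_ge0 ?expR_ge0.
have G0 z : (0 <= G z)%E by rewrite lee_fin mulr_ge0 ?expR_ge0.
have mF : measurable_fun setT F.
  apply/measurable_EFinP; apply: measurable_funM => //.
  apply: (measurableT_comp (@measurable_expR R)); apply: measurable_funN.
  by apply: measurable_funM => //; exact: (measurable_sigma hS measurable_fst measurable_snd).
have mG : measurable_fun setT G.
  apply/measurable_EFinP; apply: measurable_funM => //.
  apply: (measurableT_comp (@measurable_expR R)); apply: measurable_funN.
  apply: (measurable_path_exponent malpha hB) => //.
    exact: (measurableT_comp (measurable_idOB hB) measurable_fst).
  by apply: measurable_maxr => //; exact: measurable_snd.
transitivity (\int[P]_w \int[mu]_y F (w, y))%E.
  apply: eq_integral => w _; apply: eq_integral => y _.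
  have k0 : 0 <= \1_O (bpos B y w) * \1_(`[0, +oo[%classic) y :> R by rewrite mulr_ge0.
  transitivity ((\1_O (bpos B y w) * \1_(`[0, +oo[%classic) y)%:E *
      (la `^ order_path alpha B w y * expR (- (la * sigma (Num.max 0 y) w)))%:E)%E; last first.
    by rewrite /F /c -EFinM /=; congr EFin; rewrite !mulrA.
  rewrite -(laplace_shifted_stable_tail _ (order_path01 B alpha01 w y) la0).
  have mf : measurable_fun [set: M] (fun t : M => (stable_tail (order_path alpha B w y)
      (t - sigma (Num.max 0 y) w) * (la * expR (- (la * t))))%:E).
    by apply/measurable_EFinP; apply: measurable_funM => //; exact: (mst (w, y)).
  have f0 (t : M) : [set: M] t -> (0 <= (stable_tail (order_path alpha B w y)
      (t - sigma (Num.max 0 y) w) * (la * expR (- (la * t))))%:E)%E.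
    move=> _; rewrite lee_fin; apply: mulr_ge0; first exact: (st0 (w, y)).
    by apply: mulr_ge0; [exact: ltW|exact: expR_ge0].
  rewrite -(@ge0_integralZl_EFin _ M R mu setT measurableT _ f0 mf _ k0).
  by apply: eq_integral => t _; rewrite -EFinM /hitting_density/= !mulrA.
transitivity (\int[P]_w \int[mu]_y G (w, y))%E; last first.
  apply: eq_integral => w _; apply: eq_integral => y _.
  rewrite /G /c /occupation_weight /=; have [y0|y0] := leP 0 y; first by rewrite !mulrA.
  by rewrite [\1_(`[0, +oo[%classic) _]indicE memNset ?mul0r ?mulr0 ?mul0r//= in_itv/= andbT; apply/negP; rewrite -ltNge.
rewrite (@fubini_tonelli _ _ _ _ _ P mu _ mF F0) (@fubini_tonelli _ _ _ _ _ P mu _ mG G0).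
apply: eq_integral => y _; apply/esym.
have y0 : 0 <= Num.max 0 y by rewrite le_max lexx.
have mcy : measurable_fun setT (fun w : OB => c (w, y)).
  exact: (measurableT_comp mc (measurable_pair2 y)).
exact: (conditional_laplace hB hS la0 y0 mcy (fun w => c0 (w, y))).
Qed.

End tauberian.

(** * From Laplace transforms to bounds at every level *)

Section tauberian_bound.
Context {R : realType} {d : measure_display} {Omega : measurableType d}.
Variables (P : probability Omega R) (alpha : R -> R) (B sigma : R -> Omega -> R).
Hypotheses (malpha : measurable_fun setT alpha) (alpha01 : forall x, 0 < alpha x < 1).
Hypotheses (hB : is_brownian_motion P B)
  (hS : is_variable_order_subordinator P alpha B sigma).
Notation mu := (@lebesgue_measure R).
Notation M := (measurableTypeR R).
Notation OB := (g_sigma_algebraType (past B +oo%E)).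
Variable O : set R.
Hypothesis mO : measurable O.
Local Notation J := (occupation_laplace P alpha B O).
Local Notation H := (hitting_density alpha B sigma O).
Local Notation rate := (hitting_rate P alpha B sigma O).

Lemma measurable_indic_passage :
  measurable_fun setT (fun z : Omega * M => \1_O (bpos B (passage sigma (Num.max 0 z.2) z.1) z.1) : R).
Proof.
apply: (measurableT_comp (measurable_indic mO)).
apply: (measurable_bpos hB (tau := fun z : Omega * M => passage sigma (Num.max 0 z.2) z.1)).
  exact: (measurableT_comp (measurable_idOB hB) measurable_fst).
exact: (measurable_passage2 hS).
Qed.

(** Both sides integrate [k] against a measure in [t], made finite by the weight [e^(-t)]. The
    Laplace transforms at [j] of both measures equal [J_O(la) / la] for [la = j + 1], by
    [laplace_passage_occupation] and [laplace_hitting]. *)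
Lemma passage_hitting_uniqueness (k : R -> \bar R) : measurable_fun setT k -> (forall t, 0 <= k t)%E ->
  (\int[P]_w \int[mu]_t (k t * (\1_O (bpos B (passage sigma t w) w) * exp_weight 1 t)%:E) =
   \int[P]_w \int[mu]_y \int[mu]_t (k t * (H (w, y, t) * expR (- t))%:E))%E.
Proof.
move=> mk k0.
have [m mE] := sigma_finite_product P mu.
have [m3 m3E] := path_product_measure P.
pose p (z : Omega * M) : R := \1_O (bpos B (passage sigma (Num.max 0 z.2) z.1) z.1) * exp_weight 1 z.2.
pose q (z : (Omega * M) * M) : R := H z * expR (- z.2).
have pE w t : p (w, t) = \1_O (bpos B (passage sigma t w) w) * exp_weight 1 t.
  rewrite /p /=; have [//|t0] := leP 0 t.
  rewrite /exp_weight [\1_(`[0, +oo[%classic) _]indicE memNset ?mul0r ?mulr0//=.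
  by rewrite in_itv/= andbT; apply/negP; rewrite -ltNge.
have mp : measurable_fun setT p.
  apply: measurable_funM; first exact: measurable_indic_passage.
  exact: (measurableT_comp (measurable_exp_weight 1) measurable_snd).
have mq : measurable_fun setT q.
  apply: measurable_funM; first exact: (measurable_hitting_density malpha alpha01 hB hS mO).
  apply: (measurableT_comp (@measurable_expR R)); apply: measurable_funN; exact: measurable_snd.
have p0 z : 0 <= p z by apply: mulr_ge0 => //; exact: exp_weight_ge0.
have q0 z : 0 <= q z.
  apply: mulr_ge0; [exact: hitting_density_ge0|exact: expR_ge0].
(* [laplace_uniqueness] carries along a point of an auxiliary space; here only [t] matters, and that
   point is constantly 0. *)
have mf : measurable_fun setT (fun z : Omega * M => (0, z.2) : R * R).
  by apply: measurable_fun_pair => //; exact: measurable_snd.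
have mg : measurable_fun setT (fun z : (Omega * M) * M => (0, z.2) : R * R).
  by apply: measurable_fun_pair => //; exact: measurable_snd.
have mkk : measurable_fun setT (fun z : R * R => k z.2).
  exact: (measurableT_comp mk measurable_snd).
have lap1 la : 0 < la -> (\int[m]_z (expR (- ((la - 1) * z.2)) * p z)%:E = (la^-1)%:E * J la)%E.
  move=> la0; have il0 : 0 <= la^-1 by rewrite invr_ge0 ltW.
  have mpl : measurable_fun setT (fun z : Omega * M =>
    (\1_O (bpos B (passage sigma (Num.max 0 z.2) z.1) z.1) * exp_weight la z.2)%:E).
    apply/measurable_EFinP; apply: measurable_funM; first exact: measurable_indic_passage.
    exact: (measurableT_comp (measurable_exp_weight la) measurable_snd).
  have pl0 (z : Omega * M) : (0 <= (\1_O (bpos B (passage sigma (Num.max 0 z.2) z.1) z.1) * exp_weight la z.2)%:E)%E.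
    by rewrite lee_fin; apply: mulr_ge0 => //; exact: exp_weight_ge0.
  transitivity (\int[m]_z ((la^-1)%:E *
    (\1_O (bpos B (passage sigma (Num.max 0 z.2) z.1) z.1) * exp_weight la z.2)%:E))%E.
    apply: eq_integral => z _; rewrite -EFinM; congr EFin; rewrite /p /exp_weight.
    have -> : expR (- (la * z.2)) = expR (- ((la - 1) * z.2)) * expR (- (1 * z.2)).
      by rewrite -expRD; congr expR; ring.
    by field; rewrite gt_eqF.
  rewrite (@ge0_integralZl_EFin _ _ R m setT measurableT _ (fun z _ => pl0 z) mpl _ il0).
  congr (_ * _)%E; rewrite (mE _ mpl pl0) -(laplace_passage_occupation malpha alpha01 hB hS mO la0).
  apply: eq_integral => w _; apply: eq_integral => t _; congr EFin => /=.
  have [//|t0] := leP 0 t.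
  rewrite /exp_weight [\1_(`[0, +oo[%classic) _]indicE memNset ?mul0r ?mulr0//=.
  by rewrite in_itv/= andbT; apply/negP; rewrite -ltNge.
have lap2 la : 0 < la -> (\int[m3]_z (expR (- ((la - 1) * z.2)) * q z)%:E = (la^-1)%:E * J la)%E.
  move=> la0; have il0 : 0 <= la^-1 by rewrite invr_ge0 ltW.
  have mql : measurable_fun setT (fun z : (Omega * M) * M => (H z * (la * expR (- (la * z.2))))%:E).
    apply/measurable_EFinP; apply: measurable_funM.
      exact: (measurable_hitting_density malpha alpha01 hB hS mO).
    apply: measurable_funM => //; apply: (measurableT_comp (@measurable_expR R)); apply: measurable_funN.
    by apply: measurable_funM => //; exact: measurable_snd.
  have ql0 (z : (Omega * M) * M) : (0 <= (H z * (la * expR (- (la * z.2))))%:E)%E.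
    rewrite lee_fin; apply: mulr_ge0; first exact: hitting_density_ge0.
    by apply: mulr_ge0; [exact: ltW|exact: expR_ge0].
  transitivity (\int[m3]_z ((la^-1)%:E * (H z * (la * expR (- (la * z.2))))%:E))%E.
    apply: eq_integral => z _; rewrite -EFinM; congr EFin; rewrite /q.
    have -> : expR (- (la * z.2)) = expR (- ((la - 1) * z.2)) * expR (- z.2).
      by rewrite -expRD; congr expR; ring.
    by field; rewrite gt_eqF.
  rewrite (@ge0_integralZl_EFin _ _ R m3 setT measurableT _ (fun z _ => ql0 z) mql _ il0).
  congr (_ * _)%E; rewrite (m3E _ mql ql0).
  exact: (laplace_hitting malpha alpha01 hB hS mO la0).
have fin : (\int[m]_z (p z)%:E < +oo)%E.
  have mpe : measurable_fun setT (fun z => (p z)%:E) by exact/measurable_EFinP.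
  have pe0 z : (0 <= (p z)%:E)%E by rewrite lee_fin.
  rewrite (mE _ mpe pe0).
  have mw : measurable_fun setT (fun t : M => (exp_weight 1 t)%:E : \bar R).
    by apply/measurable_EFinP; exact: measurable_exp_weight.
  have w1 : (\int[mu]_t (exp_weight 1 t)%:E = 1)%E.
    by rewrite integral_exponential_tail// mulr0 oppr0 expR0.
  apply: (@le_lt_trans _ _ (\int[P]_w 1)%E); last first.
    by rewrite integral_cst// mul1e; apply: le_lt_trans (probability_le1 P measurableT) (ltry _).
  have mpw := @measurable_fun_fubini_tonelli_F _ _ _ _ _ mu _ mpe pe0.
  apply: (@ge0_le_integral _ Omega R P setT measurableT _ _ _ mpw) => //.
    by move=> w _; apply: integral_ge0 => t _; exact: (pe0 (w, t)).
  move=> w _; rewrite -w1.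
  have mpw1 : measurable_fun [set: M] (fun t : M => (p (w, t))%:E).
    by apply: (measurableT_comp mpe); exact: measurable_pair1.
  apply: (@ge0_le_integral _ M R mu setT measurableT _ _ (fun t _ => pe0 (w, t)) mpw1 mw).
  move=> t _; rewrite lee_fin; apply: ler_piMl; first exact: exp_weight_ge0.
  by rewrite indicE; case: (_ \in _).
have lapj (D : set R) (j : nat) : measurable D ->
    (\int[m]_z (\1_D (0 : R) * expR (- (j%:R * z.2)) * p z)%:E =
     \int[m3]_z (\1_D (0 : R) * expR (- (j%:R * z.2)) * q z)%:E)%E.
  move=> mD; have la0 : 0 < j%:R + 1 :> R by rewrite ltr_wpDl.
  have D0 : 0 <= \1_D (0 : R) :> R by [].
  have L1 := lap1 _ la0; have L2 := lap2 _ la0; rewrite addrK in L1 L2.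
  have mme1 : measurable_fun setT (fun z : Omega * M => (expR (- (j%:R * z.2)) * p z)%:E).
    apply/measurable_EFinP; apply: measurable_funM => //.
    apply: (measurableT_comp (@measurable_expR R)); apply: measurable_funN.
    by apply: measurable_funM => //; exact: measurable_snd.
  have mme2 : measurable_fun setT (fun z : (Omega * M) * M => (expR (- (j%:R * z.2)) * q z)%:E).
    apply/measurable_EFinP; apply: measurable_funM => //.
    apply: (measurableT_comp (@measurable_expR R)); apply: measurable_funN.
    by apply: measurable_funM => //; exact: measurable_snd.
  have e10 (z : Omega * M) : setT z -> (0 <= (expR (- (j%:R * z.2)) * p z)%:E)%E.
    by move=> _; rewrite lee_fin; apply: mulr_ge0; [exact: expR_ge0|].
  have e20 (z : (Omega * M) * M) : setT z -> (0 <= (expR (- (j%:R * z.2)) * q z)%:E)%E.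
    by move=> _; rewrite lee_fin; apply: mulr_ge0; [exact: expR_ge0|].
  transitivity ((\1_D (0 : R))%:E * \int[m]_z (expR (- (j%:R * z.2)) * p z)%:E)%E.
    rewrite -(@ge0_integralZl_EFin _ _ R m setT measurableT _ e10 mme1 _ D0).
    by apply: eq_integral => z _; rewrite -EFinM; congr EFin; exact/esym/mulrA.
  rewrite L1 -L2 -(@ge0_integralZl_EFin _ _ R m3 setT measurableT _ e20 mme2 _ D0).
  by apply: eq_integral => z _; rewrite -EFinM; congr EFin; exact: mulrA.
have key := laplace_uniqueness (mu := m) (nu := m3) mf mg mp mq p0 q0.
have h1 (z : Omega * M) : p z = 0 \/ 0 <= z.2.
  have [z0|z0] := leP 0 z.2; [by right|left].
  rewrite /p /exp_weight [\1_(`[0, +oo[%classic) _]indicE memNset ?mul0r ?mulr0//=.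
  by rewrite in_itv/= andbT; apply/negP; rewrite -ltNge.
have h2 (z : (Omega * M) * M) : q z = 0 \/ 0 <= z.2.
  have [z0|z0] := leP 0 z.2; [by right|left].
  rewrite /q /hitting_density stable_tail_le0 ?mulr0 ?mul0r// subr_le0.
  apply: (le_trans (ltW z0)); apply: (sigma_ge0 hS); by rewrite le_max lexx.
have keyk := key h1 h2 fin lapj _ mkk (fun z => k0 z.2).
have mk1 : measurable_fun setT (fun z : Omega * M => (k z.2 * (p z)%:E)%E).
  by apply: emeasurable_funM; [exact: (measurableT_comp mk measurable_snd)|exact/measurable_EFinP].
have k10 (z : Omega * M) : (0 <= k z.2 * (p z)%:E)%E by rewrite mule_ge0// lee_fin.
have mk2 : measurable_fun setT (fun z : (Omega * M) * M => (k z.2 * (q z)%:E)%E).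
  by apply: emeasurable_funM; [exact: (measurableT_comp mk measurable_snd)|exact/measurable_EFinP].
have k20 (z : (Omega * M) * M) : (0 <= k z.2 * (q z)%:E)%E by rewrite mule_ge0// lee_fin.
transitivity (\int[m]_z (k z.2 * (p z)%:E))%E.
  rewrite (mE _ mk1 k10); apply: eq_integral => w _; apply: eq_integral => t _.
  by rewrite pE.
by rewrite keyk (m3E _ mk2 k20).
Qed.

End tauberian_bound.

Section passage_bound.
Context {R : realType} {d : measure_display} {Omega : measurableType d}.
Variables (P : probability Omega R) (alpha : R -> R) (B sigma : R -> Omega -> R).
Hypotheses (malpha : measurable_fun setT alpha) (alpha01 : forall x, 0 < alpha x < 1).
Hypotheses (hB : is_brownian_motion P B)
  (hS : is_variable_order_subordinator P alpha B sigma).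
Notation mu := (@lebesgue_measure R).
Notation M := (measurableTypeR R).
Notation OB := (g_sigma_algebraType (past B +oo%E)).
Variable O : set R.
Hypothesis mO : measurable O.
Local Notation J := (occupation_laplace P alpha B O).
Local Notation H := (hitting_density alpha B sigma O).
Local Notation rate := (hitting_rate P alpha B sigma O).
Variables (n : nat) (amax : R).
Hypotheses (hmax : forall x, alpha x <= amax) (amax1 : amax < 1)
  (hn : amax <= n%:R * (1 - amax)).

Lemma hitting_rate_ge0 t : (0 <= rate t)%E.
Proof.
apply: integral_ge0 => w _; apply: integral_ge0 => y _; rewrite lee_fin.
exact: hitting_density_ge0.
Qed.

Lemma measurable_hitting_rate : measurable_fun [set: M] rate.
Proof.
have [m mE] := sigma_finite_product P mu.
have mH := measurable_hitting_density malpha alpha01 hB hS mO.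
have mHe : measurable_fun setT (fun z => (H z)%:E) by exact/measurable_EFinP.
have H0 z : (0 <= (H z)%:E)%E by rewrite lee_fin; exact: hitting_density_ge0.
have := @measurable_fun_fubini_tonelli_G _ _ _ _ _ m _ mHe H0.
apply: eq_measurable_fun => t _; apply: mE; last by move=> z; exact: H0.
exact: (measurableT_comp mHe (measurable_pair2 t)).
Qed.

Lemma occupation_laplace_ge0 la : (0 <= J la)%E.
Proof.
apply: integral_ge0 => w _; apply: integral_ge0 => y _; rewrite lee_fin.
by apply: mulr_ge0 => //; exact: occupation_weight_ge0.
Qed.

(* [rate s <= 2^n rate u] on [s < u <= s + t], where [e^(-u/t) >= e^(-3)]. *)
Lemma hitting_rate_le s t : 0 < t -> t < s -> s <= 2 * t ->
  (rate s <= (2 ^+ n * expR 3)%:E * J t^-1)%E.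
Proof.
move=> t0 ts s2t; have s0 : 0 < s by exact: lt_trans ts.
have C0 : 0 < 2 ^+ n * expR 3 :> R by rewrite mulr_gt0 ?expR_gt0 ?exprn_gt0.
have la0 : 0 < t^-1 by rewrite invr_gt0.
have mk : measurable_fun [set: M] (fun u : M => t^-1 * expR (- (t^-1 * u))).
  apply: measurable_funM => //; apply: (measurableT_comp (@measurable_expR R)).
  by apply: measurable_funN; exact: measurable_funM.
have k0 (u : R) : 0 <= t^-1 * expR (- (t^-1 * u)) by rewrite mulr_ge0 ?expR_ge0 ?ltW.
have JE := hitting_density_tonelli malpha alpha01 hB hS mO mk k0.
rewrite (laplace_hitting malpha alpha01 hB hS mO la0) in JE.
rewrite JE.
have mI : measurable (`]s, (s + t)%R]%classic : set M) by exact: measurable_itv.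
have mrk : measurable_fun [set: M] (fun u : M => rate u * (t^-1 * expR (- (t^-1 * u)))%:E)%E.
  by apply: emeasurable_funM; [exact: measurable_hitting_rate|exact/measurable_EFinP].
have rk0 (u : M) : (0 <= rate u * (t^-1 * expR (- (t^-1 * u)))%:E)%E.
  by rewrite mule_ge0 ?hitting_rate_ge0// lee_fin.
rewrite -lee_pdivrMl//.
apply: (@le_trans _ _ (\int[mu]_(u in `]s, (s + t)%R]) (rate u * (t^-1 * expR (- (t^-1 * u)))%:E))%E); last first.
  exact: (@ge0_subset_integral _ M R mu _ setT mI measurableT _ mrk (fun u _ => rk0 u) (@subsetT _ _)).
have -> : ((2 ^+ n * expR 3)^-1%:E * rate s =
    \int[mu]_(u in `]s, (s + t)%R]) (cst ((2 ^+ n * expR 3)^-1%:E * rate s * t^-1%:E) u))%E.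
  rewrite integral_cst//= lebesgue_measure_itv/= lte_fin ltrDl t0 -EFinB addrAC subrr add0r.
  by rewrite -muleA -EFinM mulVf ?gt_eqF// mule1.
have c0 : (0 <= (2 ^+ n * expR 3)^-1%:E * rate s * t^-1%:E)%E.
  by rewrite !mule_ge0 ?hitting_rate_ge0 ?lee_fin ?invr_ge0 ?ltW.
apply: (@ge0_le_integral _ M R mu _ mI _ _ (fun _ _ => c0) (measurable_cst _)).
  exact: measurable_funTS.
move=> u; rewrite /= in_itv/= => /andP[su ust].
have u0 : 0 < u by exact: lt_trans su.
(* Monotonicity of [t^n r(t)] together with [u <= 2 s], which holds because [u <= s + t] and
   [t < s]. *)
have su' : (rate s <= (2 ^+ n)%:E * rate u)%E.
  have := hitting_rate_mono malpha alpha01 hB hS mO hmax amax1 hn s0 (ltW su).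
  move=> h; rewrite -(@lee_pmul2l _ (s ^+ n)%:E)//; last by rewrite lte_fin exprn_gt0.
  apply: (le_trans h); rewrite muleA; apply: lee_wpmul2r; first exact: hitting_rate_ge0.
  rewrite -EFinM lee_fin -exprMn; apply: lerXn2r; rewrite ?nnegrE ?mulr_ge0 ?ltW//.
  by apply: (le_lt_trans ust); rewrite mulr2n mulrDr mulr1 ltrD2l.
apply: (@le_trans _ _ (((2 ^+ n * expR 3)^-1 * 2 ^+ n)%:E * rate u * t^-1%:E)%E).
  apply: lee_wpmul2r; first by rewrite lee_fin ltW.
  rewrite EFinM -muleA; apply: lee_wpmul2l; last exact: su'.
  by rewrite lee_fin invr_ge0 ltW.
rewrite -muleA muleCA -EFinM; apply: lee_wpmul2l; first exact: hitting_rate_ge0.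
rewrite lee_fin mulrC ler_pM2l// invfM mulrAC mulVf ?mul1r ?gt_eqF ?exprn_gt0// -expRN ler_expR lerN2.
rewrite ler_pdivrMl//; lra.
Qed.

Definition passage_probability (t : R) : \bar R :=
  (\int[P]_w (\1_O (bpos B (passage sigma t w) w))%:E)%E.

(** The test function [1_I(s) e^s] removes the weight [e^(-s)] of [passage_hitting_uniqueness]. Only
    averages over intervals are compared here, not values at a given level. *)
Lemma integral_passage_probability (t h : R) : 0 < t ->
  measurable_fun (`]t, (t + h)%R]%classic : set M) (passage_probability : M -> \bar R) /\
  (\int[mu]_(s in `]t, (t + h)%R]) passage_probability s =
   \int[mu]_(s in `]t, (t + h)%R]) rate s)%E.
Proof.
move=> t0; set I := `]t, (t + h)%R]%classic.
have mI : measurable (I : set M) by exact: measurable_itv.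
have Ipos s : I s -> 0 < s by rewrite /I/= in_itv/= => /andP[ts _]; exact: lt_trans ts.
pose f (z : Omega * M) : R := \1_O (bpos B (passage sigma (Num.max 0 z.2) z.1) z.1).
have mf : measurable_fun setT (fun z => (f z)%:E).
  by apply/measurable_EFinP; exact: (measurable_indic_passage hB hS mO).
have f0 z : (0 <= (f z)%:E)%E by rewrite lee_fin.
pose F (z : Omega * M) : \bar R := ((\1_I z.2)%:E * (f z)%:E)%E.
have mF : measurable_fun setT F.
  apply: emeasurable_funM => //; apply/measurable_EFinP.
  exact: (measurableT_comp (measurable_indic mI) measurable_snd).
have F0 z : (0 <= F z)%E by rewrite mule_ge0.
have gE (s : M) : I s -> (\int[P]_w (f (w, s))%:E = passage_probability s)%E.
  by move=> /Ipos s0; apply: eq_integral => w _; rewrite /f /= (max_r (ltW s0)).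
have mg : measurable_fun [set: M] (fun s => \int[P]_w (f (w, s))%:E)%E.
  exact: (@measurable_fun_fubini_tonelli_G _ _ _ _ _ P _ mf f0).
split.
  apply: (eq_measurable_fun (fun s => \int[P]_w (f (w, s))%:E)%E); last exact: measurable_funTS.
  by move=> s; rewrite inE => /gE.
pose k (s : R) : \bar R := (\1_I s * expR s)%:E.
have mk : measurable_fun setT k.
  by apply/measurable_EFinP; apply: measurable_funM => //; exact: measurable_indic.
have k0 s : (0 <= k s)%E by rewrite lee_fin mulr_ge0 ?expR_ge0.
have U := passage_hitting_uniqueness malpha alpha01 hB hS mO mk k0.
transitivity (\int[P]_w \int[mu]_s F (w, s))%E.
  rewrite (@fubini_tonelli _ _ _ _ _ P mu _ mF F0) integral_mkcond.
  apply: eq_integral => s _; rewrite epatch_indic muleC.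
  have mfs : measurable_fun setT (fun w : Omega => (f (w, s))%:E).
    exact: (measurableT_comp mf (measurable_pair2 s)).
  have I0 : 0 <= \1_I s :> R by [].
  transitivity ((\1_I s)%:E * \int[P]_w (f (w, s))%:E)%E; last first.
    exact/esym/(@ge0_integralZl_EFin _ Omega R P setT measurableT _ (fun w _ => f0 (w, s)) mfs _ I0).
  rewrite /= indicE; case: (boolP (s \in I)) => [|_]; last by rewrite !mul0e.
  by rewrite inE => /gE ->.
transitivity (\int[P]_w \int[mu]_t0 (k t0 * (\1_O (bpos B (passage sigma t0 w) w) * exp_weight 1 t0)%:E))%E.
  apply: eq_integral => w _; apply: eq_integral => s _.
  rewrite /F /k /= [\1_I s]indicE; case: (boolP (s \in I)) => [|_]; last by rewrite !mul0r !mul0e.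
  rewrite inE => Is; have s0 := Ipos _ Is.
  rewrite /f /= (max_r (ltW s0)) -!EFinM; congr EFin.
  rewrite /exp_weight [\1_(`[0, +oo[%classic) _]indicE mem_set/=; last by rewrite in_itv/= (ltW s0).
  by rewrite !mul1r mulrCA -expRD subrr expR0 mulr1.
rewrite U.
have mI1 : measurable_fun [set: M] (\1_I : M -> R) by exact: measurable_indic.
have I0 (s : R) : 0 <= \1_I s :> R by [].
transitivity (\int[mu]_s (rate s * (\1_I s)%:E))%E.
  rewrite -(hitting_density_tonelli malpha alpha01 hB hS mO mI1 I0).
  apply: eq_integral => w _; apply: eq_integral => y _; apply: eq_integral => s _.
  rewrite /k -EFinM; congr EFin.
  have e : expR s * expR (- s) = 1 by rewrite -expRD subrr expR0.
  by rewrite -[RHS]mulr1 -e; ring.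
by rewrite [RHS]integral_mkcond; apply: eq_integral => s _; rewrite epatch_indic.
Qed.

Lemma integral_passage_probability_le t h : 0 < t -> 0 < h -> h <= t ->
  (\int[mu]_(s in `]t, (t + h)%R]) passage_probability s <=
   (2 ^+ n * expR 3)%:E * J t^-1 * h%:E)%E.
Proof.
move=> t0 h0 ht; rewrite (integral_passage_probability h t0).2.
have C0 : 0 < 2 ^+ n * expR 3 :> R by rewrite mulr_gt0 ?expR_gt0 ?exprn_gt0.
have c0 : (0 <= (2 ^+ n * expR 3)%:E * J t^-1)%E.
  by rewrite mule_ge0 ?occupation_laplace_ge0 ?lee_fin ?ltW.
have -> : ((2 ^+ n * expR 3)%:E * J t^-1 * h%:E =
    \int[mu]_(s in `]t, (t + h)%R]) cst ((2 ^+ n * expR 3)%:E * J t^-1) s)%E.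
  rewrite integral_cst//= lebesgue_measure_itv/= lte_fin ltrDl h0 -EFinB addrAC subrr add0r.
  by [].
apply: (@ge0_le_integral _ M R mu _ (measurable_itv _) _ _ (fun s _ => hitting_rate_ge0 s) _ (measurable_cst _)).
  by apply: measurable_funTS; exact: measurable_hitting_rate.
move=> s; rewrite /= in_itv/= => /andP[ts sth]; apply: hitting_rate_le => //; lra.
Qed.

Lemma right_continuous_time_change w t :
  bpos B (passage sigma s w) w @[s --> t^'+] --> bpos B (passage sigma t w) w.
Proof.
have bE s : bpos B (passage sigma s w) w = B (passage sigma s w) w.
  by rewrite /bpos max_r// passage_ge0.
under eq_cvg do rewrite bE; rewrite bE.
have /subspace_continuousP/(_ (passage sigma t w)) := bm_continuous hB (w := w).
rewrite /= in_itv/= andbT => /(_ (passage_ge0 _ _ _)) h.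
apply: (cvg_comp _ _ _ h) => A /= [e e0 hA].
have /cvgrPdist_lt/(_ e e0) [dd dd0 hd] := passage_right_continuous hS (w := w) (t := t).
exists dd => // s hs ts; apply: hA; first exact: hd.
by rewrite /= in_itv/= andbT passage_ge0.
Qed.

Lemma measurable_time_change_preimage t :
  measurable [set w | O (bpos B (passage sigma t w) w)].
Proof.
have m : measurable_fun setT (fun w : Omega => bpos B (passage sigma t w) w).
  apply: (measurable_bpos hB (measurable_idOB hB)); exact: (measurable_passage hS).
by have := m measurableT O mO; rewrite setTI.
Qed.

Lemma passage_probabilityE t :
  passage_probability t = P [set w | O (bpos B (passage sigma t w) w)].
Proof.
have mA := measurable_time_change_preimage t.
rewrite -[RHS](congr1 P (setIT _)) -(@integral_indic _ Omega R P setT measurableT _ mA).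
exact: eq_integral.
Qed.

(** The bounds on averages over []t, t + t / (k + 1)]] yield levels [s_k] tending to [t] from the
    right at which the probability is at most [r + e]. Since [O] is open and the time-changed path
    is right continuous, the event at [t] implies the events at all [s_k] with [k] large, so its
    probability is at most their lower limit. *)
Lemma passage_probability_le t : open O -> 0 < t ->
  (passage_probability t <= (2 ^+ n * expR 3)%:E * J t^-1)%E.
Proof.
move=> oO t0; set c := (X in (_ <= X)%E).
have c0 : (0 <= c)%E.
  by rewrite mule_ge0 ?occupation_laplace_ge0// lee_fin mulr_ge0 ?expR_ge0.
case cE : c => [r| |]; [|exact: leey|by move: c0; rewrite cE].
apply/lee_addgt0Pr => e e0.
have near k : exists s, [/\ t < s, s <= t + t / k.+1%:R & (passage_probability s <= (r + e)%:E)%E].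
  have h0 : 0 < t / k.+1%:R by rewrite divr_gt0.
  have ht : t / k.+1%:R <= t by rewrite ler_piMr ?(ltW t0)// invf_le1// ler1n.
  apply: contrapT => hno.
  have [mg _] := integral_passage_probability (t / k.+1%:R) t0.
  have := integral_passage_probability_le t0 h0 ht.
  rewrite -/c cE -EFinM leNgt => /negP; apply.
  apply: (@lt_le_trans _ _ (\int[mu]_(s in `]t, (t + t / k.+1%:R)%R]) cst (r + e)%:E s)%E).
    rewrite integral_cst//= lebesgue_measure_itv/= lte_fin ltrDl h0 -EFinB addrAC subrr add0r.
    by rewrite -EFinM lte_fin ltr_pM2r// ltrDl.
  have re0 : (0 <= (r + e)%:E)%E.
    by move: c0; rewrite cE !lee_fin => r0; apply: addr_ge0 => //; exact: ltW.
  apply: (@ge0_le_integral _ M R mu _ (measurable_itv _) _ _ (fun _ _ => re0) (measurable_cst _) mg).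
  move=> s; rewrite /= in_itv/= => /andP[ts sth].
  by rewrite leNgt; apply/negP => /ltW hs; apply: hno; exists s.
have [s hs] := choice near.
pose A u := [set w | O (bpos B (passage sigma u w) w)].
have mA u : measurable (A u) by exact: measurable_time_change_preimage.
pose E m := \bigcap_(k in [set k | (m <= k)%N]) A (s k).
have mE m : measurable (E m) by apply: bigcap_measurable => [|k _]; [exists m => /=|exact: mA].
have Ecvg : P (E m) @[m --> \oo] --> P (\bigcup_m E m).
  apply: nondecreasing_cvg_mu => //; first exact: bigcupT_measurable.
  move=> i j ij; apply/subsetPset => w Ew k /= jk; apply: Ew => /=; exact: leq_trans jk.
rewrite passage_probabilityE.
apply: (@le_trans _ _ (P (\bigcup_m E m))).
  apply: le_measure; rewrite ?inE//; [exact: mA|exact: bigcupT_measurable|].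
  move=> w /= Ow.
  have : nbhs (bpos B (passage sigma t w) w) O by exact: open_nbhs_nbhs.
  move=> /(@right_continuous_time_change w t) [dd /= dd0 hdd].
  have [m hm] : exists m, t / m.+1%:R < dd.
    exists (Num.truncn (t / dd)); rewrite ltr_pdivrMr// mulrC -ltr_pdivrMr//.
    exact: truncnS_gt.
  exists m => // k /= mk; have [ts sk _] := hs k.
  apply: hdd => //=; rewrite distrC ger0_norm ?subr_ge0 ?ltW//.
  apply: le_lt_trans hm; rewrite lerBlDl (le_trans sk)// lerD2l.
  by rewrite ler_pM2l// lef_pV2 ?posrE// ler_nat.
rewrite -(cvg_lim _ Ecvg)//; apply: lime_le; first by apply/cvg_ex; eexists; exact: Ecvg.
near=> m; have [_ _] := hs m; apply: le_trans.
rewrite passage_probabilityE; apply: le_measure; rewrite ?inE//; first exact: mA.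
by move=> w; apply => /=.
Unshelve. all: by end_near. Qed.

End passage_bound.

(** * Independence of Brownian increments *)

Section independence.
Context {R : realType} {d : measure_display} {Omega : measurableType d}.
Variable P : probability Omega R.

(** [P(A & F)] and [P(A) P(F)], as functions of [A], are finite measures which agree on the whole
    space and on a class stable under intersection. *)
Lemma independent_sigma_algebra (G : set (set Omega)) (F : set Omega) :
  G `<=` measurable -> setI_closed G -> measurable F ->
  (forall A, G A -> P (A `&` F) = P A * P F)%E ->
  forall A, <<s G >> A -> (P (A `&` F) = P A * P F)%E.
Proof.
move=> Gm GI mF GF.
have PF0 : (0 <= P F)%E by exact: measure_ge0.
have PFfin : P F \is a fin_num by rewrite fin_num_measure.
pose r : {nonneg R} := NngNum (fine_ge0 PF0).
have scE A : mscale r P A = (P A * P F)%E by rewrite /mscale /= fineK// muleC.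
move=> A sA; rewrite -scE.
have -> : P (A `&` F) = mrestr P mF A by [].
have GE : [set X | G X /\ X `<=` [set: Omega]] = G.
  by apply/seteqP; split => X /=; [case|split].
apply: (@g_sigma_algebra_measure_unique_trace _ R Omega G setT measurableT _ _ (mrestr P mF) (mscale r P)); rewrite ?GE => //.
- transitivity (P setT * P F)%E; last exact/esym/scE.
  by rewrite probability_setT mul1e; congr (P _); exact: setTI.
- by move=> X GX; transitivity (P X * P F)%E; [exact: GF|exact/esym/scE].
- have mTF : measurable (setT `&` F) by rewrite setTI.
  exact: le_lt_trans (probability_le1 P mTF) (ltry _).
Qed.

Variable B : R -> Omega -> R.
Hypothesis hB : is_brownian_motion P B.

Definition increment_rectangle (t : nat -> R) (n : nat) : set (set Omega) :=
  [set D | exists E : nat -> set R, (forall i, measurable (E i)) /\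
     D = [set w | forall i, (i < n)%N -> E i (increment B t i w)]].

Lemma measurable_increment t i : time_grid t -> measurable_fun setT (increment B t i).
Proof.
move=> [t0 tS]; have tpos j : 0 <= t j by elim: j => // j /le_trans; apply; exact: tS.
by apply: measurable_funB; exact: (bm_measurable hB).
Qed.

Lemma increment_rectangle_measurable t n : time_grid t ->
  increment_rectangle t n `<=` measurable.
Proof.
move=> tg _ [E [mE ->]].
have -> : [set w | forall i, (i < n)%N -> E i (increment B t i w)] =
    \bigcap_(i in [set i | (i < n)%N]) (increment B t i @^-1` E i) by [].
apply: bigcap_measurableType => i _.
by have := measurable_increment i tg measurableT (mE i); rewrite setTI.
Qed.

Lemma increment_rectangle_setI t n : setI_closed (increment_rectangle t n).
Proof.
move=> _ _ [E1 [mE1 ->]] [E2 [mE2 ->]]; exists (fun i => E1 i `&` E2 i); split.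
  by move=> i; exact: measurableI.
apply/seteqP; split => [w [h1 h2] i lin|w h]; first by split; [exact: h1|exact: h2].
by split => i lin; have [] := h i lin.
Qed.

Lemma increment_rectangle_independent t n (F : set R) : time_grid t -> measurable F ->
  forall A, <<s increment_rectangle t n >> A ->
  (P (A `&` increment B t n @^-1` F) = P A * P (increment B t n @^-1` F))%E.
Proof.
move=> tg mF; have mFn : measurable (increment B t n @^-1` F).
  by have := measurable_increment n tg measurableT mF; rewrite setTI.
apply: independent_sigma_algebra => //.
- exact: increment_rectangle_measurable.
- exact: increment_rectangle_setI.
move=> _ [E [mE ->]].
(* The event on the increment of index [n] is appended as one more factor; the product formulas for
   [n] and [n + 1] increments are then compared. *)
pose E' i := if (i < n)%N then E i else F.
have mE' i : measurable (E' i) by rewrite /E'; case: ifP.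
have h1 := bm_independent_increments hB n tg mE.
have h2 := bm_independent_increments hB n.+1 tg mE'.
have -> : [set w | forall i, (i < n)%N -> E i (increment B t i w)] `&` increment B t n @^-1` F =
    [set w | forall i, (i < n.+1)%N -> E' i (increment B t i w)].
  apply/seteqP; split => [w [h hF] i|w h].
    rewrite ltnS leq_eqVlt => /predU1P[->|lin]; rewrite /E' ?ltnn//.
    by rewrite lin; exact: h.
  split; last by have := h n (ltnSn n); rewrite /E' ltnn.
  by move=> i lin; have := h i (ltnW lin); rewrite /E' lin.
rewrite h1 h2 big_ord_recr /= EFinM; congr (_ * _)%E.
  congr EFin; apply: eq_bigr => i _.
  by rewrite /E' ltn_ord.
by rewrite /E' ltnn fineK// fin_num_measure.
Qed.

(* The grid visits [0], the points of [us] in increasing order, then [r], and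
   stays at [s] afterwards. *)
Definition sorted_grid (us : seq R) (r s : R) (i : nat) : R :=
  nth s (0 :: rcons (sort <=%R us) r) i.

Lemma sorted_grid_time_grid us r s : (forall u, u \in us -> 0 <= u <= r) -> 0 <= r -> r <= s ->
  time_grid (sorted_grid us r s).
Proof.
move=> usr r0 rs; split => // i; rewrite /sorted_grid.
have usr' u : u \in sort <=%R us -> 0 <= u <= r by rewrite mem_sort; exact: usr.
have srt : path <=%R 0 (rcons (sort <=%R us) r).
  rewrite rcons_path; apply/andP; split.
    rewrite path_min_sorted; first exact: (sort_sorted (@le_total _ R)).
    by apply/allP => u /usr' /andP[].
  have := mem_last 0 (sort <=%R us); rewrite inE => /predU1P[->//|/usr' /andP[]//].
have szE : size (0 :: rcons (sort <=%R us) r) = (size us).+2 by rewrite /= size_rcons size_sort.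
have [isz|] := ltnP i.+1 (size us).+2.
  by move/(pathP s) : srt => /(_ i); rewrite size_rcons size_sort => /(_ isz).
move=> isz; rewrite [leRHS]nth_default ?szE//.
have [isz2|isz2] := ltnP i (size us).+2; last by rewrite nth_default ?szE.
have -> : i = (size us).+1 by apply/eqP; rewrite eqn_leq -ltnS isz2.
by rewrite /= nth_rcons size_sort ltnn eqxx.
Qed.

(** Constraints on finitely many positions up to time [r], with times in any order and one set per
    time. Unlike single-time events, these are stable under intersection, and they still generate
    the past. *)
Definition position_cylinder (r : R) : set (set Omega) :=
  [set D | exists (us : seq R) (E : R -> set R),
    [/\ forall u, u \in us -> 0 <= u <= r, forall u, measurable (E u) &
        D = [set w | forall u, u \in us -> E u (B u w)]]].

Lemma position_cylinder_setI r : setI_closed (position_cylinder r).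
Proof.
move=> _ _ [us1 [E1 [h1 mE1 ->]]] [us2 [E2 [h2 mE2 ->]]].
exists (us1 ++ us2), (fun u => (if u \in us1 then E1 u else setT) `&` (if u \in us2 then E2 u else setT)).
split.
- by move=> u; rewrite mem_cat => /orP[/h1|/h2].
- by move=> u; apply: measurableI; case: ifP.
apply/seteqP; split => [w [k1 k2] u _|w h].
  by split; case: ifP => // uin; [exact: k1|exact: k2].
by split => u uin; have := h u; rewrite mem_cat uin ?orbT => /(_ isT) [].
Qed.

(** Along a grid containing the times of the cylinder the positions are partial sums of increments,
    because [B 0 = 0]; the increment from [r] to [s] comes next on that grid. *)
Lemma position_cylinder_independent r s (F : set R) : 0 <= r -> r < s -> measurable F ->
  forall A, position_cylinder r A ->
  (P (A `&` [set w | F (B s w - B r w)%R]) = P A * P [set w | F (B s w - B r w)%R])%E.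
Proof.
move=> r0 rs mF _ [us [E [usr mE ->]]].
(* Index 0 is the time 0 and the points of [us] occupy the indices 1 to [size us], so [n] is the
   index of [r] and [n + 1] that of [s]. *)
set t := sorted_grid us r s; set n := (size us).+1.
have tg : time_grid t by apply: sorted_grid_time_grid => //; exact: ltW.
have tn : t n = r by rewrite /t /sorted_grid /n /= nth_rcons size_sort ltnn eqxx.
have tn1 : t n.+1 = s by rewrite /t /sorted_grid nth_default//= size_rcons size_sort.
have FE : [set w | F (B s w - B r w)%R] = increment B t n @^-1` F.
  by rewrite /increment tn1 tn.
rewrite FE; apply: increment_rectangle_independent => //.
set G := increment_rectangle t n.
have mincr i : (i < n)%N -> measurable_fun setT (increment B t i : g_sigma_algebraType G -> R).
  move=> lin _ C mC; rewrite setTI; apply: sub_sigma_algebra.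
  exists (fun j => if j == i then C else setT); split; first by move=> j; case: ifP.
  apply/seteqP; split => [w Cw j _|w /(_ i lin)]; last by rewrite eqxx.
  by case: ifP => // /eqP ->.
have mpos k : (k <= n)%N -> measurable_fun setT (B (t k) : g_sigma_algebraType G -> R).
  elim: k => [_|k IH kn].
    have -> : B (t 0%N) = cst 0 by apply/funext => w; exact: (bm_start hB).
    exact: measurable_cst.
  have -> : B (t k.+1) = (fun w => B (t k) w + increment B t k w).
    by apply/funext => w; rewrite /increment addrC subrK.
  apply: (@measurable_funD _ (g_sigma_algebraType G)); [exact: IH (ltnW kn)|exact: mincr].
have -> : [set w | forall u, u \in us -> E u (B u w)] =
    \bigcap_(u in [set` us]) (B u @^-1` E u) by [].
apply: (@fin_bigcap_measurable _ (g_sigma_algebraType G)); first exact: finite_seq.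
move=> u /= uin; pose k := (index u (sort <=%R us)).+1.
have kn : (index u (sort <=%R us) < size us)%N by rewrite -(size_sort <=%R) index_mem mem_sort.
have tk : t k = u.
  by rewrite /t /sorted_grid /k /= nth_rcons size_sort kn nth_index ?mem_sort.
have := mpos k (ltnW kn) measurableT (E u) (mE u).
by rewrite setTI tk.
Qed.

(** On rectangles [D x ]y, +oo[] this is independence of the increment from the past combined with
    its Gaussian law; such rectangles determine the joint law of the past and the increment. *)
Lemma increment_law r s (K : g_sigma_algebraType (past B r%:E) * R -> \bar R) :
  0 <= r -> r < s -> measurable_fun setT K -> (forall z, 0 <= K z)%E ->
  (\int[P]_w K (w, B s w - B r w)%R =
   \int[P]_w \int[lebesgue_measure]_z (K (w, z) * (normal_pdf 0 (Num.sqrt (s - r)) z)%:E))%E.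
Proof.
move=> r0 rs mK K0; set G := past B r%:E; set OBr := g_sigma_algebraType G.
set pdf := normal_pdf 0 (Num.sqrt (s - r)).
pose M := measurableTypeR R; pose mu := @lebesgue_measure R.
have s0 : 0 <= s by rewrite (le_trans r0)// ltW.
have Gm : G `<=` measurable by exact: (past_measurable hB).
have mid : measurable_fun setT (id : Omega -> OBr) by exact: measurable_id_g_sigma.
have mZ : measurable_fun setT (fun w => B s w - B r w).
  by apply: measurable_funB; exact: (bm_measurable hB).
have cylm : position_cylinder r `<=` measurable.
  move=> _ [us [E [usr mE ->]]].
  have -> : [set w | forall u, u \in us -> E u (B u w)] =
    \bigcap_(u in [set` us]) (B u @^-1` E u) by [].
  apply: fin_bigcap_measurable; first exact: finite_seq.
  move=> u /= /usr /andP[u0 _]; have := bm_measurable hB u0 measurableT (mE u).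
  by rewrite setTI.
have indep (D : set OBr) (F : set R) : measurable D -> measurable F ->
    (P (D `&` [set w | F (B s w - B r w)%R]) = P D * P [set w | F (B s w - B r w)%R])%E.
  move=> mD mF; apply: (@independent_sigma_algebra (position_cylinder r)) => //.
  - exact: position_cylinder_setI.
  - by have := mZ measurableT F mF; rewrite setTI.
  - exact: position_cylinder_independent.
  move: D mD; apply: smallest_sub; first exact: smallest_sigma_algebra.
  move=> _ [u [u0 ur [E mE <-]]]; rewrite setTI; apply: sub_sigma_algebra.
  exists [:: u], (fun=> E); split => //.
    by move=> v; rewrite inE => /eqP ->; rewrite u0 -lee_fin.
  apply/seteqP; split => [w Ew v|w /(_ u)]; first by rewrite inE => /eqP ->.
  by rewrite inE eqxx => /(_ isT).
have mpdf : measurable_fun setT (fun z : Omega * M => pdf z.2).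
  exact: (measurableT_comp (@measurable_normal_pdf R 0 _) measurable_snd).
have pdf0 (z : Omega * M) : 0 <= pdf z.2 by exact: normal_pdf_ge0.
have mphi : measurable_fun setT (fun w : Omega => (w : OBr, B s w - B r w)).
  exact: measurable_fun_pair.
have mpsi : measurable_fun setT (fun z : Omega * M => (z.1 : OBr, z.2) : OBr * R).
  apply: measurable_fun_pair; last exact: measurable_snd.
  exact: (measurableT_comp mid measurable_fst).
have [m mE] := sigma_finite_product P mu.
have m1 : measurable_fun setT (cst 1 : Omega -> R) by exact: measurable_cst.
have [m1' m1E] := image_density P mphi m1 (fun _ => ler01).
have [m2 m2E] := image_density m mpsi mpdf pdf0.
have E1 (h : OBr * R -> \bar R) : measurable_fun setT h -> (forall z, 0 <= h z)%E ->
    (\int[m1']_z h z = \int[P]_w h (w, B s w - B r w)%R)%E.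
  by move=> mh h0; rewrite (m1E h mh h0); apply: eq_integral => w _; rewrite mule1.
have E2 (h : OBr * R -> \bar R) : measurable_fun setT h -> (forall z, 0 <= h z)%E ->
    (\int[m2]_z h z = \int[P]_w \int[mu]_z (h (w, z) * (pdf z)%:E))%E.
  move=> mh h0; rewrite (m2E h mh h0) mE//.
    apply: emeasurable_funM; first exact: (measurableT_comp mh mpsi).
    exact/measurable_EFinP.
  by move=> z; rewrite mule_ge0 ?h0// lee_fin.
transitivity (\int[m1']_z K z)%E; first exact/esym/E1.
transitivity (\int[m2]_z K z)%E; last exact: E2.
apply: eq_measure_integral => A mA _.
have mray (D : set OBr) (y : R) : measurable D -> measurable (D `*` (`]y, +oo[%classic : set R)).
  by move=> mD; apply: measurableX => //; exact: measurable_itv.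
have mindic (C : set (OBr * R)) : measurable C -> measurable_fun setT (fun z => (\1_C z)%:E : \bar R).
  by move=> mC; apply/measurable_EFinP; exact: measurable_indic.
have indic0 (C : set (OBr * R)) z : (0 <= (\1_C z)%:E :> \bar R)%E by rewrite lee_fin.
have m1oo : (m1' setT < +oo)%E.
  have -> : m1' setT = (\int[m1']_z 1)%E by rewrite integral_cst// mul1e.
  rewrite (E1 (cst 1%E))// integral_cst// mul1e.
  by apply: le_lt_trans (probability_le1 P measurableT) (ltry _).
apply: (finite_measure_eq_rays (m2 := m2) m1oo _ mA) => D y mD.
have mD' : measurable (D : set Omega) by have := mid measurableT D mD; rewrite setTI.
have mF : measurable (`]y, +oo[%classic : set R) by exact: measurable_itv.
have mZF : measurable [set w | `]y, +oo[%classic (B s w - B r w)%R].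
  by have := mZ measurableT _ mF; rewrite setTI.
transitivity (\int[m1']_z (\1_(D `*` `]y, +oo[%classic) z)%:E)%E.
  by rewrite integral_indic ?setIT//; exact: mray.
transitivity (\int[m2]_z (\1_(D `*` `]y, +oo[%classic) z)%:E)%E; last first.
  by rewrite integral_indic ?setIT//; exact: mray.
rewrite (E1 _ (mindic _ (mray D y mD)) (indic0 _)) (E2 _ (mindic _ (mray D y mD)) (indic0 _)).
have XE w z : \1_(D `*` `]y, +oo[%classic) (w, z) = \1_D w * \1_(`]y, +oo[%classic) z :> R.
  by rewrite !indicE -natrM mulnb; congr ((_ : bool)%:R); apply/idP/andP; rewrite !inE/= => -[].
transitivity (P ((D : set Omega) `&` [set w | `]y, +oo[%classic (B s w - B r w)%R])).
  have mDF := measurableI _ _ mD' mZF.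
  rewrite -[RHS](congr1 P (setIT _)) -(@integral_indic _ Omega R P setT measurableT _ mDF).
  apply: eq_integral => w _; rewrite XE; apply/esym; congr EFin.
  rewrite !indicE -natrM mulnb; congr ((_ : bool)%:R).
  by apply/idP/andP; rewrite !inE/= => -[].
rewrite (indep D _ mD mF) (bm_gaussian hB r0 rs mF).
have N0 : (0 <= normal_prob 0 (Num.sqrt (s - r)) `]y, +oo[%classic)%E.
  by apply: integral_ge0 => z _; rewrite lee_fin normal_pdf_ge0.
transitivity (\int[P]_w ((\1_D w)%:E * normal_prob 0 (Num.sqrt (s - r)) `]y, +oo[%classic))%E.
  have mD1 : measurable_fun setT (fun w : Omega => (\1_(D : set Omega) w)%:E : \bar R).
    by apply/measurable_EFinP; exact: measurable_indic.
  have D10 (w : Omega) : setT w -> (0 <= (\1_(D : set Omega) w)%:E :> \bar R)%E by rewrite lee_fin.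
  rewrite (@ge0_integralZr _ Omega R P setT measurableT _ mD1 _ D10 N0); congr (_ * _)%E.
  by rewrite (@integral_indic _ Omega R P setT measurableT _ mD') setIT.
apply: eq_integral => w _; rewrite /normal_prob integral_mkcond.
have D0 : 0 <= \1_D w :> R by [].
have mf : measurable_fun [set: M] (fun z : M => ((\1_(`]y, +oo[%classic) z)%:E * (pdf z)%:E)%E : \bar R).
  apply: emeasurable_funM; apply/measurable_EFinP; first exact: measurable_indic.
  exact: measurable_normal_pdf.
have f0 (z : M) : setT z -> (0 <= (\1_(`]y, +oo[%classic) z)%:E * (pdf z)%:E)%E.
  by move=> _; rewrite mule_ge0// lee_fin normal_pdf_ge0.
transitivity ((\1_D w)%:E * \int[mu]_z ((\1_(`]y, +oo[%classic) z)%:E * (pdf z)%:E))%E.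
  by congr (_ * _)%E; apply: eq_integral => z _; rewrite epatch_indic muleC.
rewrite -(@ge0_integralZl_EFin _ M R mu setT measurableT _ f0 mf _ D0).
by apply: eq_integral => z _; rewrite XE EFinM muleA.
Qed.

End independence.

(** * Bounds on the Brownian density *)

Section brownian_density.
Context {R : realType} {d : measure_display} {Omega : measurableType d}.
Variables (P : probability Omega R) (B : R -> Omega -> R).
Hypothesis hB : is_brownian_motion P B.
Notation mu := (@lebesgue_measure R).
Notation M := (measurableTypeR R).

(** The maximum [(2 pi s)^(-1/2)] of the centred Gaussian density of variance [s > 0]. *)
Definition brownian_peak (s : R) : R := (Num.sqrt (pi *+ 2))^-1 * s `^ (- 2^-1).

Lemma brownian_peak_ge0 s : 0 <= brownian_peak s.
Proof. by rewrite mulr_ge0 ?powR_ge0// invr_ge0 sqrtr_ge0. Qed.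

Lemma normal_peakE (v : R) : 0 < v -> normal_peak (Num.sqrt v) = brownian_peak v.
Proof.
move=> v0; rewrite /normal_peak /brownian_peak sqr_sqrtr ?ltW//.
rewrite -mulrnAr sqrtrM ?ltW// invfM mulrC; congr (_ * _).
by rewrite powRN -powR12_sqrt ?ltW.
Qed.

Lemma normal_pdf_le (v z : R) : 0 < v -> normal_pdf 0 (Num.sqrt v) z <= brownian_peak v.
Proof. by move=> v0; rewrite -normal_peakE// normal_pdf_ub// gt_eqF// sqrtr_gt0. Qed.

Lemma normal_pdf_ge (v z D : R) : 0 < v -> `|z| <= D ->
  brownian_peak v * expR (- (D ^+ 2 / (v *+ 2))) <= normal_pdf 0 (Num.sqrt v) z.
Proof.
move=> v0 zD; rewrite normal_pdfE ?gt_eqF ?sqrtr_gt0// normal_peakE//.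
apply: ler_wpM2l; first exact: brownian_peak_ge0.
rewrite /normal_fun subr0 (sqr_sqrtr (ltW v0)) ler_expR mulNr lerN2.
by rewrite ler_pM2r ?invr_gt0 ?pmulrn_lgt0// -real_normK ?num_real// lerXn2r ?nnegrE// (le_trans _ zD).
Qed.

Lemma integral_indic_translate (E : set R) (b : R) : measurable E ->
  (\int[mu]_z (\1_E (b + z))%:E = mu E)%E.
Proof.
move=> mE.
have mf : measurable_fun setT (fun z : R => (\1_E z)%:E : \bar R).
  by apply/measurable_EFinP; exact: measurable_indic.
have f0 (z : R) : (0 <= (\1_E z)%:E :> \bar R)%E by rewrite lee_fin.
have aff := integral_affine b ltr01 mf f0; rewrite invr1 mul1e in aff.
transitivity (\int[mu]_z (\1_E (1 * z + b)%R)%:E)%E.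
  by apply: eq_integral => z _; rewrite mul1r addrC.
by rewrite aff (@integral_indic _ M R mu setT measurableT _ mE) setIT.
Qed.

(** Given the past, [B s] is [B r] plus an independent Gaussian of variance [s - r], so its
    conditional density is at most the peak wherever [B r] is; translation invariance of Lebesgue
    measure does the rest. *)
Lemma past_density_bound (r s : R) (X : g_sigma_algebraType (past B r%:E) -> R) (E : set R) :
  0 <= r -> r < s -> measurable_fun setT X -> (forall w, 0 <= X w) -> measurable E ->
  (\int[P]_w (X w * \1_E (B s w))%:E <=
   (\int[P]_w (X w)%:E) * ((brownian_peak (s - r))%:E * mu E))%E.
Proof.
move=> r0 rs mX X0 mE; set OBr := g_sigma_algebraType (past B r%:E).
have v0 : 0 < s - r by rewrite subr_gt0.
have mBr : measurable_fun setT (B r : OBr -> R).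
  by apply: measurable_past_bm.
have mid : measurable_fun setT (id : Omega -> OBr).
  exact: measurable_id_g_sigma (past_measurable hB (T := r%:E)).
pose K (z : OBr * R) : \bar R := (X z.1 * \1_E (B r z.1 + z.2))%:E.
have mK : measurable_fun setT K.
  apply/measurable_EFinP; apply: measurable_funM; first exact: (measurableT_comp mX measurable_fst).
  apply: (measurableT_comp (measurable_indic mE)).
  by apply: measurable_funD; [exact: (measurableT_comp mBr measurable_fst)|exact: measurable_snd].
have K0 z : (0 <= K z)%E by rewrite lee_fin mulr_ge0.
have -> : (\int[P]_w (X w * \1_E (B s w))%:E = \int[P]_w K (w, B s w - B r w)%R)%E.
  by apply: eq_integral => w _; rewrite /K /= addrC subrK.
rewrite (increment_law hB r0 rs mK K0).
have b0 := brownian_peak_ge0 (s - r).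
have mXO : measurable_fun setT (fun w : Omega => (X w)%:E).
  by apply/measurable_EFinP; exact: (measurableT_comp mX mid).
have X0e w : [set: Omega] w -> (0 <= (X w)%:E)%E by rewrite lee_fin.
have bmu0 : (0 <= (brownian_peak (s - r))%:E * mu E)%E by rewrite mule_ge0// lee_fin.
rewrite -(@ge0_integralZr _ Omega R P setT measurableT _ mXO _ X0e bmu0).
have mpdf : measurable_fun setT (fun z : M => (normal_pdf 0 (Num.sqrt (s - r)) z)%:E).
  by apply/measurable_EFinP; exact: measurable_normal_pdf.
have mF : measurable_fun setT (fun z : Omega * M =>
    K (z.1 : OBr, z.2) * (normal_pdf 0 (Num.sqrt (s - r)) z.2)%:E)%E.
  apply: emeasurable_funM; last exact: (measurableT_comp mpdf measurable_snd).
  apply: (measurableT_comp mK); apply: measurable_fun_pair; last exact: measurable_snd.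
  exact: (measurableT_comp mid measurable_fst).
have F0 (z : Omega * M) : (0 <= K (z.1 : OBr, z.2) * (normal_pdf 0 (Num.sqrt (s - r)) z.2)%:E)%E.
  by rewrite mule_ge0// lee_fin normal_pdf_ge0.
have mFF := @measurable_fun_fubini_tonelli_F _ _ _ _ _ mu _ mF F0.
apply: (@ge0_le_integral _ Omega R P setT measurableT _ _ _ mFF).
- by move=> w _; apply: integral_ge0 => z _; exact: (F0 (w, z)).
- by apply: emeasurable_funM.
move=> w _; rewrite muleA -EFinM -(integral_indic_translate (B r w) mE).
have mf : measurable_fun [set: M] (fun z : M => (\1_E (B r w + z))%:E : \bar R).
  apply/measurable_EFinP; apply: (measurableT_comp (measurable_indic mE)).
  exact: measurable_funD.
have f0 (z : M) : setT z -> (0 <= (\1_E (B r w + z))%:E :> \bar R)%E by rewrite lee_fin.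
have k0 : 0 <= X w * brownian_peak (s - r) by rewrite mulr_ge0.
rewrite -(@ge0_integralZl_EFin _ M R mu setT measurableT _ f0 mf _ k0).
have mF1 : measurable_fun [set: M] (fun z : M => (K (w, z) * (normal_pdf 0 (Num.sqrt (s - r)) z)%:E)%E).
  exact: (measurableT_comp mF (measurable_pair1 w)).
apply: (@ge0_le_integral _ M R mu setT measurableT _ _ (fun z _ => F0 (w, z)) mF1).
  by apply: emeasurable_funM => //; exact: measurable_cst.
move=> z _; rewrite /K /= -!EFinM lee_fin mulrAC.
apply: ler_wpM2r => //; apply: ler_wpM2l => //.
exact: normal_pdf_le.
Qed.

Lemma density_upper (s : R) (E : set R) : 0 < s -> measurable E ->
  (\int[P]_w (\1_E (B s w))%:E <= (brownian_peak s)%:E * mu E)%E.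
Proof.
move=> s0 mE; have := past_density_bound (X := cst 1) (lexx 0) s0 (measurable_cst _) (fun _ => ler01) mE.
have -> : (\int[P]_w (cst 1 w : R)%:E = 1)%E.
  by rewrite (integral_cst P measurableT 1) mul1e; exact: probability_setT.
rewrite subr0 mul1e; congr (_ <= _)%E.
by apply: eq_integral => w _; rewrite mul1r.
Qed.

(** On [E] the Gaussian density of variance [s] falls below its peak by a factor of at least
    [e^(-D^2 / (2 s))]. *)
Lemma density_lower (s D : R) (E : set R) : 0 < s -> measurable E ->
  (forall x, E x -> `|x| <= D) ->
  ((brownian_peak s * expR (- (D ^+ 2 / (s *+ 2))))%:E * mu E <= \int[P]_w (\1_E (B s w))%:E)%E.
Proof.
move=> s0 mE ED; set OBr := g_sigma_algebraType (past B 0%:E).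
pose K (z : OBr * R) : \bar R := (\1_E z.2)%:E.
have mK : measurable_fun setT K.
  by apply/measurable_EFinP; exact: (measurableT_comp (measurable_indic mE) measurable_snd).
have K0 z : (0 <= K z)%E by rewrite lee_fin.
have -> : (\int[P]_w (\1_E (B s w))%:E = \int[P]_w K (w, B s w - B 0 w)%R)%E.
  by apply: eq_integral => w _; rewrite /K /= (bm_start hB) subr0.
rewrite (increment_law hB (lexx 0) s0 mK K0) /K /=.
have Pcst (x : \bar R) : (\int[P]_w x = x)%E.
  rewrite (integral_cst P measurableT x) -[RHS]mule1; congr (_ * _)%E; exact: probability_setT.
rewrite Pcst.
set c := brownian_peak s * _.
have c0 : 0 <= c by rewrite mulr_ge0 ?expR_ge0 ?brownian_peak_ge0.
have mf : measurable_fun [set: M] (fun z : M => (\1_E z)%:E : \bar R).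
  by apply/measurable_EFinP; exact: measurable_indic.
have f0 (z : M) : setT z -> (0 <= (\1_E z)%:E :> \bar R)%E by rewrite lee_fin.
have -> : mu E = (\int[mu]_z (\1_E z)%:E)%E.
  by rewrite (@integral_indic _ M R mu setT measurableT _ mE) setIT.
rewrite -(@ge0_integralZl_EFin _ M R mu setT measurableT _ f0 mf _ c0).
have mpdf : measurable_fun setT (fun z : M => (normal_pdf 0 (Num.sqrt (s - 0)) z)%:E).
  by apply/measurable_EFinP; exact: measurable_normal_pdf.
apply: (@ge0_le_integral _ M R mu setT measurableT).
- by move=> z _; rewrite mule_ge0// lee_fin.
- by apply: emeasurable_funM => //; exact: measurable_cst.
- exact: emeasurable_funM.
move=> z _; rewrite -!EFinM lee_fin mulrC indicE.
case: (boolP (z \in E)) => [|_]; last by rewrite !mul0r.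
by rewrite inE !mul1r subr0 => /ED; exact: normal_pdf_ge.
Qed.

Lemma integral_inv_sqrt (T : R) : 0 <= T ->
  (\int[mu]_(s in `]0%R, T]) (s `^ (- 2^-1))%:E = (2 * Num.sqrt T)%:E)%E.
Proof.
move=> T0; have h : 0 <= (2^-1 : R) < 1 by rewrite invr_ge0 ler0n/= invf_lt1// ltr1n.
rewrite (integral_powRN h T0); congr EFin.
have -> : 1 - 2^-1 = 2^-1 :> R by field.
by rewrite invrK powR12_sqrt// mulrC.
Qed.

End brownian_density.

(** * Occupation times *)

Section occupation_inequality.
Context {R : realType} {d : measure_display} {Omega : measurableType d}.
Variables (P : probability Omega R) (alpha : R -> R) (B sigma : R -> Omega -> R).
Hypotheses (malpha : measurable_fun setT alpha) (alpha01 : forall x, 0 < alpha x < 1).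
Hypotheses (hB : is_brownian_motion P B)
  (hS : is_variable_order_subordinator P alpha B sigma).
Notation mu := (@lebesgue_measure R).
Notation M := (measurableTypeR R).
Notation OB := (g_sigma_algebraType (past B +oo%E)).
Variables (A : set R) (a la : R).
Hypotheses (mA : measurable A) (alphaA : forall x, A x -> alpha x = a) (la0 : 0 < la).
Local Notation W := (occupation_weight alpha B la).

Definition mean_weight (r : R) : \bar R := (\int[P]_w (W w r)%:E)%E.

Definition mean_occupation (s : R) : \bar R := (\int[P]_w (\1_A (bpos B s w))%:E)%E.

(** The bound on the conditional density of [B s] given the past up to [r], as a kernel supported on
    [0 <= r < s]. *)
Definition inv_sqrt_kernel (s r : R) : R :=
  \1_(`[0, +oo[%classic) r * (\1_(`]0, +oo[%classic) (s - r) * brownian_peak (s - r)).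

Lemma inv_sqrt_kernel_ge0 s r : 0 <= inv_sqrt_kernel s r.
Proof. by apply: mulr_ge0 => //; apply: mulr_ge0 => //; exact: brownian_peak_ge0. Qed.

Lemma measurable_inv_sqrt_kernel :
  measurable_fun setT (fun z : M * M => inv_sqrt_kernel z.1 z.2).
Proof.
have m0 : measurable (`[0, +oo[%classic : set R) by exact: measurable_itv.
have m1 : measurable (`]0, +oo[%classic : set R) by exact: measurable_itv.
have md : measurable_fun setT (fun z : M * M => z.1 - z.2).
  by apply: measurable_funB; [exact: measurable_fst|exact: measurable_snd].
apply: measurable_funM; first exact: (measurableT_comp (measurable_indic m0) measurable_snd).
apply: measurable_funM; first exact: (measurableT_comp (measurable_indic m1) md).
apply: measurable_funM; first exact: measurable_cst.
by apply: measurable_powR2 => //; exact: measurable_cst.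
Qed.

Lemma mean_weight_ge0 r : (0 <= mean_weight r)%E.
Proof. by apply: integral_ge0 => w _; rewrite lee_fin; exact: occupation_weight_ge0. Qed.

Lemma measurable_weight2 : measurable_fun setT (fun z : Omega * M => W z.1 z.2).
Proof.
have m1 : measurable_fun setT (fun z : Omega * M => z.1 : OB).
  exact: (measurableT_comp (measurable_idOB hB) measurable_fst).
exact: (measurable_occupation_weight malpha hB la m1 measurable_snd).
Qed.

Lemma measurable_mean_weight : measurable_fun [set: M] mean_weight.
Proof.
have mW : measurable_fun setT (fun z : Omega * M => (W z.1 z.2)%:E).
  by apply/measurable_EFinP; exact: measurable_weight2.
have W0 (z : Omega * M) : (0 <= (W z.1 z.2)%:E)%E by rewrite lee_fin; exact: occupation_weight_ge0.
exact: (@measurable_fun_fubini_tonelli_G _ _ _ _ _ P _ mW W0).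
Qed.

Lemma measurable_indic_bpos :
  measurable_fun setT (fun z : Omega * M => (\1_A (bpos B z.2 z.1))%:E : \bar R).
Proof.
apply/measurable_EFinP; apply: (measurableT_comp (measurable_indic mA)).
have m1 : measurable_fun setT (fun z : Omega * M => z.1 : OB).
  exact: (measurableT_comp (measurable_idOB hB) measurable_fst).
exact: (measurable_bpos hB m1 measurable_snd).
Qed.

Lemma measurable_mean_occupation : measurable_fun [set: M] mean_occupation.
Proof.
have A0 (z : Omega * M) : (0 <= (\1_A (bpos B z.2 z.1))%:E :> \bar R)%E by rewrite lee_fin.
exact: (@measurable_fun_fubini_tonelli_G _ _ _ _ _ P _ measurable_indic_bpos A0).
Qed.

(** That [e^(-Phi_r)] depends only on the past up to [r] is read off [sg_laplace] at [T = r], where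
    it is a conditional expectation given that past. *)
Lemma measurable_weight_past r : 0 <= r ->
  measurable_fun setT (fun w : g_sigma_algebraType (past B r%:E) => W w r).
Proof.
move=> r0; set OBr := g_sigma_algebraType (past B r%:E).
apply: measurable_funM; first exact: measurable_cst.
apply: measurable_funM.
  apply: measurable_powR2; first exact: measurable_cst.
  have mb : measurable_fun setT (B (Num.max 0 r) : OBr -> R).
    by apply: measurable_past_bm; rewrite max_r.
  exact: (measurableT_comp malpha mb).
have e : (fun w => (expR (- \int[mu]_(u in `[0, r]) (la `^ alpha (B u w))))%:E) =
         EFin \o (fun w => expR (- path_exponent alpha B la r w)).
  by apply/funext => w; rewrite (path_exponent_primitive alpha B la r w).
by have := sg_laplace hS la0 r0 (lexx r%:E); rewrite e => -[/measurable_EFinP mY _ _].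
Qed.

Lemma integral_weight_itv w (v u : R) : 0 <= v -> v <= u ->
  (\int[mu]_(r in `[v, u]) (W w r)%:E =
   (expR (- path_exponent alpha B la v w) - expR (- path_exponent alpha B la u w))%:E)%E.
Proof.
move=> v0 vu.
rewrite -(integral_rate_expN (measurable_order_path1 malpha hB w) (order_path01 B alpha01 w) la0 v0 vu).
apply: eq_integral => r; rewrite inE/= in_itv/= => /andP[vr _].
by rewrite /occupation_weight indicE mem_set/= ?mul1r// in_itv/= (le_trans v0).
Qed.

(* [e^(-Phi_s)] is replaced by [1 - int_0^s (mean weight)], whose integrand at
   [r] is determined by the path of [B] up to [r]. *)
Lemma mean_occupation_le s : 0 <= s ->
  (mean_occupation s <= (la `^ (- a))%:E * mean_weight s +
     \int[mu]_r ((inv_sqrt_kernel s r)%:E * mean_weight r) * mu A)%E.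
Proof.
(* Open at [s], since the density bound for [B s] given the past up to [r] requires [r < s]. *)
move=> s0; have mI : measurable (`[0, s[%classic : set M) by exact: measurable_itv.
have mAs : measurable_fun setT (fun w : Omega => (\1_A (bpos B s w))%:E : \bar R).
  exact: (measurableT_comp measurable_indic_bpos (measurable_pair2 s)).
have mWs : measurable_fun setT (fun w : Omega => (W w s)%:E : \bar R).
  by apply/measurable_EFinP; exact: (measurableT_comp measurable_weight2 (measurable_pair2 s)).
have W0 w r : (0 <= (W w r)%:E)%E by rewrite lee_fin; exact: occupation_weight_ge0.
pose F (z : Omega * M) : \bar R := (\1_A (bpos B s z.1) * (\1_(`[0, s[%classic) z.2 * W z.1 z.2))%:E.
have mF : measurable_fun setT F.
  apply/measurable_EFinP; apply: measurable_funM.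
    by have /measurable_EFinP m := mAs; exact: (measurableT_comp m measurable_fst).
  apply: measurable_funM; last exact: measurable_weight2.
  exact: (measurableT_comp (measurable_indic mI) measurable_snd).
have F0 z : (0 <= F z)%E.
  by rewrite lee_fin; apply: mulr_ge0 => //; apply: mulr_ge0 => //; exact: occupation_weight_ge0.
have mFF := @measurable_fun_fubini_tonelli_F _ _ _ _ _ mu _ mF F0.
have FF0 (w : Omega) : (0 <= \int[mu]_r F (w, r))%E by apply: integral_ge0 => r _; exact: F0.
have p0 : 0 <= la `^ (- a) by exact: powR_ge0.
have mlW : measurable_fun setT (fun w : Omega => (la `^ (- a))%:E * (W w s)%:E)%E.
  by apply: emeasurable_funM => //; exact: measurable_cst.
have lW0 (w : Omega) : (0 <= (la `^ (- a))%:E * (W w s)%:E)%E by rewrite mule_ge0// lee_fin.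
apply: (@le_trans _ _ (\int[P]_w ((la `^ (- a))%:E * (W w s)%:E + \int[mu]_r F (w, r)))%E).
  have A0 (w : Omega) : [set: Omega] w -> (0 <= (\1_A (bpos B s w))%:E :> \bar R)%E.
    by rewrite lee_fin.
  apply: (@ge0_le_integral _ Omega R P setT measurableT _ _ A0 mAs (emeasurable_funD mlW mFF)).
  move=> w _.
  (* The integral of the weight up to [s] accounts for [1_A(B_s) (1 - e^(-Phi_s))]. The missing
     [1_A(B_s) e^(-Phi_s)] is at most [la^(-a)] times the weight at [s], because the order equals
     [a] on [A]. *)
  have FE : (\int[mu]_r F (w, r) = (\1_A (bpos B s w))%:E *
      (1 - expR (- path_exponent alpha B la s w))%:E)%E.
    have Aw0 : 0 <= \1_A (bpos B s w) :> R by [].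
    have := integral_weight_itv w (lexx 0) s0.
    rewrite /path_exponent laplace_exponent0 oppr0 expR0 => <-.
    have mW1 : measurable_fun [set: M] (fun r : M => (W w r)%:E).
      by apply/measurable_EFinP; exact: (measurableT_comp measurable_weight2 (measurable_pair1 w)).
    rewrite -integral_itv_bndo_bndc; last exact: measurable_funTS.
    rewrite [in RHS]integral_mkcond.
    have mf : measurable_fun [set: M] (fun r : M => (\1_(`[0, s[%classic) r * W w r)%:E).
      apply/measurable_EFinP; apply: measurable_funM; first exact: measurable_indic.
      exact/measurable_EFinP.
    have f0 (r : M) : [set: M] r -> (0 <= (\1_(`[0, s[%classic) r * W w r)%:E)%E.
      by move=> _; rewrite lee_fin; apply: mulr_ge0 => //; exact: occupation_weight_ge0.
    transitivity ((\1_A (bpos B s w))%:E * \int[mu]_r (\1_(`[0, s[%classic) r * W w r)%:E)%E.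
      rewrite -(@ge0_integralZl_EFin _ M R mu setT measurableT _ f0 mf _ Aw0).
      by apply: eq_integral => r _; rewrite -EFinM.
    by congr (_ * _)%E; apply: eq_integral => r _; rewrite epatch_indic -EFinM mulrC.
  suff : ((\1_A (bpos B s w))%:E <= (la `^ (- a))%:E * (W w s)%:E + \int[mu]_r F (w, r))%E by [].
  rewrite FE -!EFinM -EFinD lee_fin.
  rewrite [\1_A _]indicE; case: (boolP (_ \in A)) => [|_]; last first.
    by rewrite mul0r addr0; apply: mulr_ge0 => //; exact: occupation_weight_ge0.
  rewrite inE => /alphaA sa; rewrite /occupation_weight indicE mem_set/=; last by rewrite in_itv/= s0.
  have -> : order_path alpha B w s = a by [].
  rewrite !mul1r mulrA -powRD; last by rewrite (gt_eqF la0) implybT.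
  by rewrite addNr powRr0 mul1r addrC subrK.
rewrite (@ge0_integralD _ Omega R P setT measurableT _ _ (fun w _ => lW0 w) mlW (fun w _ => FF0 w) mFF).
rewrite (@ge0_integralZl_EFin _ Omega R P setT measurableT _ (fun w _ => W0 w s) mWs _ p0).
apply: leeD; first exact: lexx.
rewrite (@fubini_tonelli _ _ _ _ _ P mu _ mF F0).
have mk : measurable_fun [set: M] (fun r : M => (inv_sqrt_kernel s r)%:E * mean_weight r)%E.
  apply: emeasurable_funM; last exact: measurable_mean_weight.
  by apply/measurable_EFinP; exact: (measurableT_comp measurable_inv_sqrt_kernel (measurable_pair1 s)).
have k0 (r : M) : (0 <= (inv_sqrt_kernel s r)%:E * mean_weight r)%E.
  by rewrite mule_ge0 ?mean_weight_ge0// lee_fin inv_sqrt_kernel_ge0.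
rewrite -(@ge0_integralZr _ M R mu setT measurableT _ mk _ (fun r _ => k0 r) (measure_ge0 _ _)).
have mFG := @measurable_fun_fubini_tonelli_G _ _ _ _ _ P _ mF F0.
apply: (@ge0_le_integral _ M R mu setT measurableT _ _ _ mFG).
- by move=> r _; apply: integral_ge0 => w _; exact: (F0 (w, r)).
- by apply: emeasurable_funM => //; exact: measurable_cst.
move=> r _.
suff : (\int[P]_w F (w, r) <= (inv_sqrt_kernel s r)%:E * mean_weight r * mu A)%E by [].
case: (boolP (r \in (`[0, s[%classic : set R))) => [|rn]; last first.
  have Z (w : Omega) : F (w, r) = 0%E.
    by rewrite /F /= [\1_(`[0, s[%classic) _]indicE (negbTE rn) mul0r mulr0.
  under eq_integral do rewrite Z; rewrite integral0.
  by apply: mule_ge0; [exact: k0|exact: measure_ge0].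
rewrite inE/= in_itv/= => /andP[r0 rs].
have E (w : Omega) : F (w, r) = (W w r * \1_A (B s w))%:E.
  rewrite /F /= [\1_(`[0, s[%classic) _]indicE mem_set/= ?in_itv/= ?r0// mul1r mulrC.
  by rewrite /bpos (max_r s0).
under eq_integral do rewrite E.
apply: (le_trans (past_density_bound hB r0 rs (measurable_weight_past r0) (fun w => occupation_weight_ge0 _ _ _ _ _) mA)).
rewrite muleA [X in (X * _)%E]muleC.
have -> : inv_sqrt_kernel s r = brownian_peak (s - r); last by [].
rewrite /inv_sqrt_kernel !indicE !mem_set ?mul1r//= in_itv/= ?r0//.
by rewrite andbT subr_gt0.
Qed.

End occupation_inequality.

Section occupation_time.
Context {R : realType} {d : measure_display} {Omega : measurableType d}.
Variables (P : probability Omega R) (alpha : R -> R) (B sigma : R -> Omega -> R).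
Hypotheses (malpha : measurable_fun setT alpha) (alpha01 : forall x, 0 < alpha x < 1).
Hypotheses (hB : is_brownian_motion P B)
  (hS : is_variable_order_subordinator P alpha B sigma).
Notation mu := (@lebesgue_measure R).
Notation M := (measurableTypeR R).
Notation OB := (g_sigma_algebraType (past B +oo%E)).

(** The integral of [(2 pi s)^(-1/2)] over [0 < s <= T]: per unit length, a bound on the mean time
    spent in a set before [T]. *)
Definition peak_time (T : R) : R := (Num.sqrt (pi *+ 2))^-1 * (2 * Num.sqrt T).

Lemma peak_time_ge0 T : 0 <= peak_time T.
Proof. by rewrite mulr_ge0 ?invr_ge0 ?mulr_ge0 ?sqrtr_ge0. Qed.

Lemma measurable_brownian_peak : measurable_fun setT (@brownian_peak R).
Proof.
apply: measurable_funM; first exact: measurable_cst.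
by apply: measurable_powR2 => //; exact: measurable_cst.
Qed.

Lemma integral_brownian_peak T : 0 <= T ->
  (\int[mu]_(s in `]0%R, T]) (brownian_peak s)%:E = (peak_time T)%:E)%E.
Proof.
move=> T0; have k0 : 0 <= (Num.sqrt (pi *+ 2))^-1 :> R by rewrite invr_ge0 sqrtr_ge0.
have mf : measurable_fun (`]0, T]%classic : set M) (fun s : M => (s `^ (- 2^-1))%:E : \bar R).
  by apply: measurable_funTS; apply/measurable_EFinP; apply: measurable_powR2 => //; exact: measurable_cst.
have f0 (s : M) : (`]0, T]%classic : set R) s -> (0 <= (s `^ (- 2^-1))%:E :> \bar R)%E.
  by rewrite lee_fin powR_ge0.
rewrite /peak_time EFinM -(integral_inv_sqrt T0).
rewrite -(@ge0_integralZl_EFin _ M R mu _ (measurable_itv _) _ f0 mf _ k0).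
by apply: eq_integral => s _; rewrite -EFinM.
Qed.

Lemma integral_brownian_peak_itv S T : 0 <= S -> S <= T ->
  (\int[mu]_(s in `]S, T]) (brownian_peak s)%:E = (peak_time T - peak_time S)%:E)%E.
Proof.
move=> S0 ST; have T0 : 0 <= T by exact: le_trans ST.
have := integral_brownian_peak T0.
have -> : `]0, T]%classic = `]0, S]%classic `|` `]S, T]%classic :> set R.
  by rewrite -itv_bndbnd_setU// bnd_simp.
rewrite (@ge0_integral_setU _ M R mu); last 5 first.
- exact: measurable_itv.
- exact: measurable_itv.
- by apply: measurable_funTS; apply/measurable_EFinP; exact: measurable_brownian_peak.
- by move=> s _; rewrite lee_fin; exact: brownian_peak_ge0.
- apply/disj_setPS => s /=; rewrite !in_itv/= => -[/andP[_ sS] /andP[Ss _]].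
  by move: (lt_le_trans Ss sS); rewrite ltxx.
rewrite (integral_brownian_peak S0) => h.
by rewrite EFinB -h addeAC subee ?add0e.
Qed.

Lemma occupation_time_upper (E : set R) T : 0 <= T -> measurable E ->
  (\int[mu]_(s in `[0%R, T]) mean_occupation P B E s <= (peak_time T)%:E * mu E)%E.
Proof.
move=> T0 mE.
have mo := measurable_mean_occupation hB mE.
rewrite -integral_itv_obnd_cbnd; last exact: measurable_funTS.
have mp : measurable_fun (`]0, T]%classic : set M) (fun s : M => (brownian_peak s)%:E).
  by apply: measurable_funTS; apply/measurable_EFinP; exact: measurable_brownian_peak.
have p0 (s : M) : (`]0, T]%classic : set R) s -> (0 <= (brownian_peak s)%:E)%E.
  by rewrite lee_fin brownian_peak_ge0.
rewrite -(integral_brownian_peak T0).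
rewrite -(@ge0_integralZr _ M R mu _ (measurable_itv _) _ mp _ p0 (measure_ge0 _ _)).
apply: (@ge0_le_integral _ M R mu _ (measurable_itv _)).
- by move=> s _; apply: integral_ge0 => w _; rewrite lee_fin.
- exact: measurable_funTS.
- by apply: emeasurable_funM => //; exact: measurable_cst.
move=> s; rewrite /= in_itv/= => /andP[s0 _].
have := density_upper hB s0 mE; congr (_ <= _)%E.
by apply: eq_integral => w _; rewrite /bpos (max_r (ltW s0)).
Qed.

(** After time [S] the Gaussian density on [[-D, D]] is at least [e^(-D^2 / (2 S))] times its peak.
    For [S] large and [T] much larger still, this matches [occupation_time_upper] asymptotically. *)
Lemma occupation_time_lower (E : set R) (D S T : R) : 0 < S -> S <= T -> measurable E ->
  (forall x, E x -> `|x| <= D) ->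
  ((expR (- (D ^+ 2 / (S *+ 2))) * (peak_time T - peak_time S))%:E * mu E <=
   \int[mu]_(s in `[0%R, T]) mean_occupation P B E s)%E.
Proof.
move=> S0 ST mE ED; have mo := measurable_mean_occupation hB mE.
have mI : measurable (`]S, T]%classic : set M) by exact: measurable_itv.
have o0 (s : M) : (0 <= mean_occupation P B E s)%E.
  by apply: integral_ge0 => w _; rewrite lee_fin.
apply: (@le_trans _ _ (\int[mu]_(s in `]S, T]) mean_occupation P B E s)%E); last first.
  apply: (@ge0_subset_integral _ M R mu _ _ mI (measurable_itv _)) => //.
  - exact: measurable_funTS.
  - by move=> s /=; rewrite !in_itv/= => /andP[Ss ->]; rewrite andbT (le_trans (ltW S0))// ltW.
set c := expR _.
have mp : measurable_fun (`]S, T]%classic : set M) (fun s : M => (brownian_peak s)%:E).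
  by apply: measurable_funTS; apply/measurable_EFinP; exact: measurable_brownian_peak.
have p0 (s : M) : (`]S, T]%classic : set R) s -> (0 <= (brownian_peak s)%:E)%E.
  by rewrite lee_fin brownian_peak_ge0.
rewrite EFinM muleAC -(integral_brownian_peak_itv (ltW S0) ST).
have cm0 : (0 <= c%:E * mu E)%E by rewrite mule_ge0// lee_fin expR_ge0.
rewrite -(@ge0_integralZl _ M R mu _ mI _ mp _ p0 cm0).
apply: (@ge0_le_integral _ M R mu _ mI).
- by move=> s _; rewrite mule_ge0// lee_fin brownian_peak_ge0.
- by apply: emeasurable_funM => //; exact: measurable_cst.
- exact: measurable_funTS.
move=> s; rewrite /= in_itv/= => /andP[Ss _].
have s0 : 0 < s by exact: lt_trans Ss.
have -> : mean_occupation P B E s = (\int[P]_w (\1_E (B s w))%:E)%E.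
  by apply: eq_integral => w _; rewrite /bpos (max_r (ltW s0)).
apply: (le_trans _ (density_lower hB s0 mE ED)).
rewrite muleAC -EFinM; apply: lee_wpmul2r; first exact: measure_ge0.
rewrite lee_fin mulrC; apply: ler_wpM2l; first exact: brownian_peak_ge0.
rewrite ler_expR lerN2 ler_wpM2l ?sqr_ge0// lef_pV2 ?posrE ?pmulrn_lgt0//.
by rewrite ler_pMn2r// ltW.
Qed.

(** In the variable [v = s - r] the kernel is the peak at [v], integrated over a part of []0, T]];
    for [r] outside [[0, T]] the left-hand side vanishes. *)
Lemma integral_inv_sqrt_kernel (T r : R) : 0 <= T ->
  (\int[mu]_s (\1_(`[0, T]%classic) s * inv_sqrt_kernel s r)%:E <=
   (\1_(`[0, T]%classic) r * peak_time T)%:E)%E.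
Proof.
move=> T0; have mI : measurable (`]0, T]%classic : set R) by exact: measurable_itv.
pose g (v : R) : \bar R := (\1_(`]0, T]%classic) v * brownian_peak v)%:E.
have mg : measurable_fun setT g.
  by apply/measurable_EFinP; apply: measurable_funM; [exact: measurable_indic|exact: measurable_brownian_peak].
have g0 v : (0 <= g v)%E by rewrite lee_fin mulr_ge0 ?brownian_peak_ge0.
have Ig : (\int[mu]_s g (1 * s + - r)%R = (peak_time T)%:E)%E.
  rewrite (integral_affine (- r) ltr01 mg g0) invr1 mul1e -(integral_brownian_peak T0).
  by rewrite [RHS]integral_mkcond; apply: eq_integral => v _; rewrite epatch_indic /g -EFinM mulrC.
have mpos (b : itv_bound R) c : measurable ([set` Interval b c] : set R) by exact: measurable_itv.
have F0 s : (0 <= (\1_(`[0, T]%classic) s * inv_sqrt_kernel s r)%:E)%E.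
  by rewrite lee_fin mulr_ge0 ?inv_sqrt_kernel_ge0.
case: (boolP (r \in (`[0, T]%classic : set R))) => [rin|rn]; last first.
  rewrite integral0_eq ?[\1_(`[0, T]%classic) r]indicE ?(negbTE rn) ?mul0r// => s _.
  rewrite /inv_sqrt_kernel [\1_(`[0, +oo[%classic) r]indicE.
  case: (boolP (r \in (`[0, +oo[%classic : set R))) => [|_]; last by rewrite mul0r mulr0.
  rewrite inE/= in_itv/= andbT => r0; rewrite mul1r.
  have rT : T < r.
    by rewrite ltNge; apply/negP => rT; move/negP: rn; apply; rewrite inE/= in_itv/= r0.
  have [sT|sT] := leP s T.
    rewrite [\1_(`]0, +oo[%classic) _]indicE memNset ?mul0r ?mulr0//= in_itv/= andbT subr_gt0.
    by apply/negP; rewrite -leNgt (le_trans sT)// ltW.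
  rewrite [\1_(`[0, T]%classic) s]indicE memNset ?mul0r//= in_itv/=.
  by move=> /andP[_]; rewrite leNgt sT.
rewrite [X in (_ <= X)%E](_ : _ = (peak_time T)%:E); last first.
  by rewrite indicE rin mul1r.
rewrite -Ig.
have md : measurable_fun [set: M] (fun s : M => g (1 * s + - r)%R).
  apply: (measurableT_comp mg); apply: measurable_funD => //; exact: measurable_funM.
apply: (@ge0_le_integral _ M R mu setT measurableT _ _ (fun s _ => F0 s) _ md).
  apply/measurable_EFinP; apply: measurable_funM; first exact: measurable_indic.
  exact: (measurableT_comp (@measurable_inv_sqrt_kernel R) (measurable_pair2 r)).
move=> s _; move: rin; rewrite inE/= in_itv/= => /andP[r0 rT].
rewrite /g mul1r lee_fin /inv_sqrt_kernel [\1_(`[0, +oo[%classic) r]indicE mem_set/=; last by rewrite in_itv/= r0.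
rewrite mul1r mulrA; apply: ler_wpM2r; first exact: brownian_peak_ge0.
rewrite !indicE -natrM mulnb ler_nat.
case: (boolP (s \in _)) => //=; rewrite inE/= in_itv/= => /andP[_ sT].
case: (boolP (s - r \in _)) => //=; rewrite inE/= in_itv/= andbT => sr.
by rewrite mem_set//= in_itv/= sr lerBlDr (le_trans sT)// lerDl.
Qed.

(** Along each path the weight integrates to [1 - e^(-Phi_T)] over [[0, T]]. *)
Lemma mean_weight_total la T : 0 < la -> 0 <= T ->
  (\int[mu]_(s in `[0%R, T]) mean_weight P alpha B la s +
   \int[P]_w (expR (- path_exponent alpha B la T w))%:E = 1)%E.
Proof.
move=> la0 T0; have mI : measurable (`[0, T]%classic : set M) by exact: measurable_itv.
have mW := measurable_weight2 malpha hB la.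
pose F (z : Omega * M) : \bar R := (\1_(`[0, T]%classic) z.2 * occupation_weight alpha B la z.1 z.2)%:E.
have mF : measurable_fun setT F.
  apply/measurable_EFinP; apply: measurable_funM => //.
  exact: (measurableT_comp (measurable_indic mI) measurable_snd).
have F0 z : (0 <= F z)%E by rewrite lee_fin mulr_ge0 ?occupation_weight_ge0.
have mE : measurable_fun setT (fun w => (expR (- path_exponent alpha B la T w))%:E).
  apply/measurable_EFinP; apply: (measurableT_comp (@measurable_expR R)); apply: measurable_funN.
  exact: (measurable_path_exponent malpha hB (measurable_idOB hB)).
have mFF := @measurable_fun_fubini_tonelli_F _ _ _ _ _ mu _ mF F0.
have -> : (\int[mu]_(s in `[0%R, T]) mean_weight P alpha B la s = \int[P]_w \int[mu]_s F (w, s))%E.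
  rewrite (@fubini_tonelli _ _ _ _ _ P mu _ mF F0) integral_mkcond.
  apply: eq_integral => s _; rewrite epatch_indic muleC.
  have mWs : measurable_fun setT (fun w : Omega => (occupation_weight alpha B la w s)%:E).
    by apply/measurable_EFinP; exact: (measurableT_comp mW (measurable_pair2 s)).
  have W0 (w : Omega) : setT w -> (0 <= (occupation_weight alpha B la w s)%:E)%E.
    by rewrite lee_fin occupation_weight_ge0.
  have i0 : 0 <= \1_(`[0, T]%classic) s :> R by [].
  rewrite /mean_weight -(@ge0_integralZl_EFin _ Omega R P setT measurableT _ W0 mWs _ i0).
  by apply: eq_integral => w _; rewrite -EFinM.
have FF0 (w : Omega) : [set: Omega] w -> (0 <= \int[mu]_s F (w, s))%E.
  by move=> _; apply: integral_ge0 => s _; exact: F0.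
have E0 (w : Omega) : [set: Omega] w -> (0 <= (expR (- path_exponent alpha B la T w))%:E)%E.
  by rewrite lee_fin expR_ge0.
rewrite -(@ge0_integralD _ Omega R P setT measurableT _ _ FF0 mFF E0 mE).
transitivity (\int[P]_w (1%E : \bar R))%E.
  apply: eq_integral => w _.
  have -> : (\int[mu]_s F (w, s) = \int[mu]_(s in `[0%R, T]) (occupation_weight alpha B la w s)%:E)%E.
    by rewrite [RHS]integral_mkcond; apply: eq_integral => s _; rewrite epatch_indic /F -EFinM mulrC.
  rewrite (integral_weight_itv malpha alpha01 hB la0 w (lexx 0) T0).
  by rewrite /path_exponent laplace_exponent0 oppr0 expR0 -EFinD subrK.
rewrite (integral_cst P measurableT 1%E) mul1e; exact: probability_setT.
Qed.

(** [mean_occupation_le] is integrated over [s]; once the two times are exchanged, the kernel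
    contributes at most [peak_time T] for each [r] in [[0, T]]. *)
Lemma mean_occupation_integral_le (A : set R) (a la T : R) : measurable A ->
  (forall x, A x -> alpha x = a) -> 0 < la -> 0 <= T ->
  (\int[mu]_(s in `[0%R, T]) mean_occupation P B A s <=
   \int[mu]_(s in `[0%R, T]) mean_weight P alpha B la s *
     ((la `^ (- a))%:E + (peak_time T)%:E * mu A))%E.
Proof.
move=> mA alphaA la0 T0; have mI : measurable (`[0, T]%classic : set M) by exact: measurable_itv.
set q := mean_weight P alpha B la.
have mq : measurable_fun [set: M] q by exact: (measurable_mean_weight malpha hB).
have q0 r : (0 <= q r)%E by exact: mean_weight_ge0.
have mo := measurable_mean_occupation hB mA.
have mk := @measurable_inv_sqrt_kernel R.
pose G (z : M * M) : \bar R := ((\1_(`[0, T]%classic) z.1 * inv_sqrt_kernel z.1 z.2)%:E * q z.2)%E.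
have mG : measurable_fun setT G.
  apply: emeasurable_funM; last exact: (measurableT_comp mq measurable_snd).
  apply/measurable_EFinP; apply: measurable_funM => //.
  exact: (measurableT_comp (measurable_indic mI) measurable_fst).
have G0 z : (0 <= G z)%E by rewrite mule_ge0// lee_fin mulr_ge0 ?inv_sqrt_kernel_ge0.
pose H (z : M * M) : \bar R := ((inv_sqrt_kernel z.1 z.2)%:E * q z.2)%E.
have mH : measurable_fun setT H.
  apply: emeasurable_funM; last exact: (measurableT_comp mq measurable_snd).
  exact/measurable_EFinP.
have H0 z : (0 <= H z)%E by rewrite mule_ge0// lee_fin inv_sqrt_kernel_ge0.
have mHF := @measurable_fun_fubini_tonelli_F _ _ _ _ _ mu _ mH H0.
have HF0 (s : M) : (0 <= \int[mu]_r H (s, r))%E by apply: integral_ge0 => r _; exact: H0.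
have p0 : 0 <= la `^ (- a) by exact: powR_ge0.
have mlq : measurable_fun (`[0, T]%classic : set M) (fun s => (la `^ (- a))%:E * q s)%E.
  by apply: measurable_funTS; apply: emeasurable_funM => //; exact: measurable_cst.
have lq0 (s : M) : (`[0, T]%classic : set R) s -> (0 <= (la `^ (- a))%:E * q s)%E.
  by rewrite mule_ge0// lee_fin.
have mHm : measurable_fun (`[0, T]%classic : set M) (fun s => \int[mu]_r H (s, r) * mu A)%E.
  by apply: measurable_funTS; apply: emeasurable_funM => //; exact: measurable_cst.
have Hm0 (s : M) : (`[0, T]%classic : set R) s -> (0 <= \int[mu]_r H (s, r) * mu A)%E.
  by rewrite mule_ge0.
apply: (@le_trans _ _ (\int[mu]_(s in `[0%R, T]) ((la `^ (- a))%:E * q s + \int[mu]_r H (s, r) * mu A))%E).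
  apply: (@ge0_le_integral _ M R mu _ mI).
  - by move=> s _; apply: integral_ge0 => w _; rewrite lee_fin.
  - exact: measurable_funTS.
  - exact: emeasurable_funD.
  move=> s; rewrite /= in_itv/= => /andP[s0 _].
  exact: (mean_occupation_le malpha alpha01 hB hS mA alphaA la0 s0).
rewrite (@ge0_integralD _ M R mu _ mI _ _ lq0 mlq Hm0 mHm).
have mqT : measurable_fun (`[0, T]%classic : set M) q by exact: measurable_funTS.
rewrite (@ge0_integralZl_EFin _ M R mu _ mI _ (fun s _ => q0 s) mqT _ p0).
have mHT : measurable_fun (`[0, T]%classic : set M) (fun s => \int[mu]_r H (s, r))%E.
  exact: measurable_funTS.
rewrite (@ge0_integralZr _ M R mu _ mI _ mHT _ (fun s _ => HF0 s) (measure_ge0 _ _)).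
set Q := (\int[mu]_(s in `[0%R, T]) q s)%E.
have Q0 : (0 <= Q)%E by apply: integral_ge0 => s _; exact: q0.
have pm0 : (0 <= (peak_time T)%:E * mu A)%E by rewrite mule_ge0// lee_fin peak_time_ge0.
have pe0 : (0 <= (la `^ (- a))%:E)%E by rewrite lee_fin.
rewrite (ge0_muleDr _ pe0 pm0); apply: leeD; first by rewrite muleC.
rewrite muleA; apply: lee_wpmul2r; first exact: measure_ge0.
have -> : (\int[mu]_(s in `[0%R, T]) \int[mu]_r H (s, r) = \int[mu]_s \int[mu]_r G (s, r))%E.
  rewrite integral_mkcond; apply: eq_integral => s _; rewrite epatch_indic muleC.
  have i0 : 0 <= \1_(`[0, T]%classic) s :> R by [].
  have mHs : measurable_fun [set: M] (fun r : M => H (s, r)) by exact: (measurableT_comp mH (measurable_pair1 s)).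
  rewrite /= -(@ge0_integralZl_EFin _ M R mu setT measurableT _ (fun r _ => H0 (s, r)) mHs _ i0).
  by apply: eq_integral => r _; rewrite /G /H /= muleA -EFinM.
rewrite (@fubini_tonelli _ _ _ _ _ mu mu _ mG G0).
have pT0 := peak_time_ge0 T.
have pTe0 : (0 <= (peak_time T)%:E)%E by rewrite lee_fin.
rewrite /Q -(@ge0_integralZr _ M R mu _ mI _ mqT _ (fun s _ => q0 s) pTe0) [leRHS]integral_mkcond.
have mGG := @measurable_fun_fubini_tonelli_G _ _ _ _ _ mu _ mG G0.
have mR : measurable_fun [set: M] ((fun s : M => q s * (peak_time T)%:E)%E \_ (`[0, T]%classic : set M)).
  apply/(measurable_restrictT _ mI); apply: measurable_funTS.
  by apply: emeasurable_funM => //; exact: measurable_cst.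
apply: (@ge0_le_integral _ M R mu setT measurableT _ _ _ mGG mR).
  by move=> r _; apply: integral_ge0 => s _; exact: G0.
move=> r _; rewrite epatch_indic.
suff : (\int[mu]_s G (s, r) <= q r * (peak_time T)%:E * (\1_(`[0, T]%classic) r)%:E)%E by [].
have mkr : measurable_fun [set: M] (fun s : M => (\1_(`[0, T]%classic) s * inv_sqrt_kernel s r)%:E).
  apply/measurable_EFinP; apply: measurable_funM; first exact: measurable_indic.
  exact: (measurableT_comp mk (measurable_pair2 r)).
have kr0 (s : M) : [set: M] s -> (0 <= (\1_(`[0, T]%classic) s * inv_sqrt_kernel s r)%:E)%E.
  by rewrite lee_fin mulr_ge0 ?inv_sqrt_kernel_ge0.
rewrite (@ge0_integralZr _ M R mu setT measurableT _ mkr _ kr0 (q0 r)).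
rewrite muleC -muleA; apply: lee_wpmul2l; first exact: q0.
by rewrite -EFinM mulrC; exact: integral_inv_sqrt_kernel.
Qed.

End occupation_time.

(** * Bounds on [E e^(-Phi_T)] and on [J_O], and measurability of [X(t)] *)

Section final_bounds.
Context {R : realType} {d : measure_display} {Omega : measurableType d}.
Variables (P : probability Omega R) (alpha : R -> R) (B sigma : R -> Omega -> R).
Hypotheses (malpha : measurable_fun setT alpha) (alpha01 : forall x, 0 < alpha x < 1).
Hypotheses (hB : is_brownian_motion P B)
  (hS : is_variable_order_subordinator P alpha B sigma).
Notation mu := (@lebesgue_measure R).
Notation M := (measurableTypeR R).
Notation OB := (g_sigma_algebraType (past B +oo%E)).

(** The integrated mean weight is [1 - E e^(-Phi_T)], and [F] is at most this number times the
    denominator. A mean occupation time close to the denominator therefore forces [E e^(-Phi_T)] to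
    be small. *)
Lemma exponent_mass_le (A : set R) (a la T m F : R) : measurable A ->
  (forall x, A x -> alpha x = a) -> 0 < la -> 0 <= T -> mu A = m%:E ->
  (F%:E <= \int[mu]_(s in `[0%R, T]) mean_occupation P B A s)%E ->
  (\int[P]_w (expR (- path_exponent alpha B la T w))%:E <=
   (1 - F / (la `^ (- a) + peak_time T * m))%:E)%E.
Proof.
move=> mA alphaA la0 T0 mAE hF.
have m0 : 0 <= m by rewrite -lee_fin -mAE measure_ge0.
have tot := mean_weight_total malpha alpha01 hB la0 T0.
have occ := le_trans hF (mean_occupation_integral_le malpha alpha01 hB hS mA alphaA la0 T0).
rewrite mAE -EFinM -EFinD in occ.
set E := (\int[P]_w _)%E in tot *; set Q := (\int[mu]_(s in _) _)%E in tot occ.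
have Q0 : (0 <= Q)%E by apply: integral_ge0 => s _; exact: mean_weight_ge0.
have E0 : (0 <= E)%E by apply: integral_ge0 => w _; rewrite lee_fin expR_ge0.
have c0 : 0 < la `^ (- a) + peak_time T * m.
  by apply: ltr_wpDr; rewrite ?powR_gt0// mulr_ge0// peak_time_ge0.
move: tot occ Q0 E0; case: E => [e| |]; case: Q => [q| |]//.
rewrite -EFinD -EFinM !lee_fin => -[qe] occ q0 e0.
rewrite lerBrDr -lerBrDl ler_pdivrMr//.
by have -> : 1 - e = q by rewrite -qe addrK.
Qed.

(** Before [T] the exponential is bounded by 1 and the rate by three terms: those of [N] and [V] are
    controlled by their occupation times, the last one only by the length of [[0, T]]. After [T] the
    total weight is [e^(-Phi_T)], whatever [O]. In the application [N] is the overlap of [O] with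
    [A0] and [V] a bounded interval. *)
Lemma occupation_laplace_le (O N V : set R) (a a' b la T n v : R) :
  measurable O -> measurable N -> measurable V -> 0 < la -> 0 <= T ->
  (forall x, O x -> la `^ alpha x <= la `^ a * \1_N x + la `^ a' * \1_V x + la `^ b) ->
  mu N = n%:E -> mu V = v%:E ->
  (occupation_laplace P alpha B O la <=
   ((la `^ a * n + la `^ a' * v) * peak_time T + la `^ b * T)%:E +
   \int[P]_w (expR (- path_exponent alpha B la T w))%:E)%E.
Proof.
move=> mO mN mV la0 T0 hO muN muV.
have mI : measurable (`[0, T]%classic : set M) by exact: measurable_itv.
have mI' : measurable (`[T, +oo[%classic : set M) by exact: measurable_itv.
have mOw (C : set R) : measurable C -> measurable_fun setT (fun z : Omega * M => \1_C (bpos B z.2 z.1) : R).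
  by move=> mC; apply/measurable_EFinP; exact: (measurable_indic_bpos hB mC).
have mW := measurable_weight2 malpha hB la.
pose g (z : Omega * M) : R := la `^ a * \1_N (bpos B z.2 z.1) + la `^ a' * \1_V (bpos B z.2 z.1) + la `^ b.
have g0 z : 0 <= g z by rewrite /g !addr_ge0 ?mulr_ge0 ?powR_ge0.
have mg : measurable_fun setT g.
  apply: measurable_funD; last exact: measurable_cst.
  by apply: measurable_funD; apply: measurable_funM; rewrite ?measurable_cst//; [exact: mOw|exact: mOw].
pose H0 (z : Omega * M) : \bar R := (\1_O (bpos B z.2 z.1) * occupation_weight alpha B la z.1 z.2)%:E.
pose H1 (z : Omega * M) : \bar R := (\1_(`[0, T]%classic) z.2 * g z)%:E.
pose H2 (z : Omega * M) : \bar R := (\1_(`[T, +oo[%classic) z.2 * occupation_weight alpha B la z.1 z.2)%:E.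
have mH0 : measurable_fun setT H0 by apply/measurable_EFinP; exact: measurable_funM (mOw _ mO) mW.
have mH1 : measurable_fun setT H1.
  apply/measurable_EFinP; apply: measurable_funM => //.
  exact: (measurableT_comp (measurable_indic mI) measurable_snd).
have mH2 : measurable_fun setT H2.
  apply/measurable_EFinP; apply: measurable_funM => //.
  exact: (measurableT_comp (measurable_indic mI') measurable_snd).
have H00 z : (0 <= H0 z)%E by rewrite lee_fin mulr_ge0 ?occupation_weight_ge0.
have H10 z : (0 <= H1 z)%E by rewrite lee_fin mulr_ge0.
have H20 z : (0 <= H2 z)%E by rewrite lee_fin mulr_ge0 ?occupation_weight_ge0.
have mF0 := @measurable_fun_fubini_tonelli_F _ _ _ _ _ mu _ mH0 H00.
have mF1 := @measurable_fun_fubini_tonelli_F _ _ _ _ _ mu _ mH1 H10.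
have mF2 := @measurable_fun_fubini_tonelli_F _ _ _ _ _ mu _ mH2 H20.
have F10 (w : Omega) : [set: Omega] w -> (0 <= \int[mu]_y H1 (w, y))%E.
  by move=> _; apply: integral_ge0 => y _; exact: H10.
have F20 (w : Omega) : [set: Omega] w -> (0 <= \int[mu]_y H2 (w, y))%E.
  by move=> _; apply: integral_ge0 => y _; exact: H20.
have wle (y : R) (w : Omega) : (H0 (w, y) <= H1 (w, y) + H2 (w, y))%E.
  have [y0|y0] := ltP y 0.
    rewrite [H0 _](_ : _ = 0%E) ?adde_ge0//.
    rewrite /H0 /occupation_weight/= [\1_(`[0, +oo[%classic) _]indicE memNset ?mul0r ?mulr0//= in_itv/= andbT.
    by apply/negP; rewrite -ltNge.
  have [yT|Ty] := leP y T.
    apply: (@le_trans _ _ (H1 (w, y))); last by rewrite leeDl.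
    rewrite /H0 /H1 lee_fin [\1_(`[0, T]%classic) _]indicE mem_set/=; last by rewrite in_itv/= y0.
    rewrite mul1r [\1_O _]indicE; case: (boolP (_ \in O)) => [|_]; last by rewrite mul0r.
    rewrite inE => /hO h; rewrite mul1r /occupation_weight [\1_(`[0, +oo[%classic) _]indicE mem_set/=; last by rewrite in_itv/= y0.
    rewrite mul1r; apply: le_trans h; apply: ler_piMr; first exact: powR_ge0.
    rewrite -expR0 ler_expR oppr_le0.
    exact: laplace_exponent_ge0.
  apply: (@le_trans _ _ (H2 (w, y))); last by rewrite leeDr.
  rewrite /H0 /H2 lee_fin; apply: ler_wpM2r; first exact: occupation_weight_ge0.
  rewrite [leRHS]indicE mem_set/=; last by rewrite in_itv/= ltW.
  by rewrite indicE; case: (_ \in _).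
apply: (@le_trans _ _ (\int[P]_w (\int[mu]_y H1 (w, y) + \int[mu]_y H2 (w, y)))%E).
  apply: (@ge0_le_integral _ Omega R P setT measurableT _ _ _ mF0 (emeasurable_funD mF1 mF2)).
    by move=> w _; apply: integral_ge0 => y _; exact: (H00 (w, y)).
  move=> w _.
  have m1w : measurable_fun [set: M] (fun y : M => H1 (w, y)) by exact: (measurableT_comp mH1 (measurable_pair1 w)).
  have m2w : measurable_fun [set: M] (fun y : M => H2 (w, y)) by exact: (measurableT_comp mH2 (measurable_pair1 w)).
  suff : (\int[mu]_y H0 (w, y) <= \int[mu]_y H1 (w, y) + \int[mu]_y H2 (w, y))%E by [].
  rewrite -(@ge0_integralD _ M R mu setT measurableT _ _ (fun y _ => H10 (w, y)) m1w (fun y _ => H20 (w, y)) m2w).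
  apply: (@ge0_le_integral _ M R mu setT measurableT _ _ (fun y _ => H00 (w, y)) _ (emeasurable_funD m1w m2w)).
    exact: (measurableT_comp mH0 (measurable_pair1 w)).
  by move=> y _; exact: wle.
rewrite (@ge0_integralD _ Omega R P setT measurableT _ _ F10 mF1 F20 mF2); apply: leeD; last first.
  rewrite le_eqVlt; apply/orP; left; apply/eqP; apply: eq_integral => w _.
  rewrite /path_exponent -(integral_rate_expN_tail (measurable_order_path1 malpha hB w) (order_path01 B alpha01 w) la0 T0).
  rewrite [RHS]integral_mkcond; apply: eq_integral => y _; rewrite epatch_indic /H2 -EFinM; congr EFin => /=.
  rewrite [\1_(`[T, +oo[%classic) _]indicE; case: (boolP (y \in _)) => [|_]; last by rewrite mul0r mulr0.
  rewrite inE/= in_itv/= andbT => Ty; rewrite mul1r mulr1 /occupation_weight indicE mem_set/= ?mul1r//.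
  by rewrite in_itv/= andbT (le_trans T0).
rewrite (@fubini_tonelli _ _ _ _ _ P mu _ mH1 H10).
have oN := occupation_time_upper hB T0 mN; have oV := occupation_time_upper hB T0 mV.
rewrite muN -EFinM in oN; rewrite muV -EFinM in oV.
have o0 (C : set R) s : (0 <= mean_occupation P B C s)%E by apply: integral_ge0 => w _; rewrite lee_fin.
have mo (C : set R) : measurable C -> measurable_fun (`[0, T]%classic : set M) (mean_occupation P B C).
  by move=> mC; apply: measurable_funTS; exact: (measurable_mean_occupation hB mC).
have pa : 0 <= la `^ a by exact: powR_ge0.
have pa' : 0 <= la `^ a' by exact: powR_ge0.
have pb : (0 <= (la `^ b)%:E)%E by rewrite lee_fin powR_ge0.
have mc (C : set R) c : measurable C ->
    measurable_fun (`[0, T]%classic : set M) (fun y => (c%:E * mean_occupation P B C y)%E).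
  by move=> mC; apply: emeasurable_funM; [exact: measurable_cst|exact: mo].
have c0 (C : set R) c : 0 <= c -> forall y : M, (`[0, T]%classic : set M) y -> (0 <= c%:E * mean_occupation P B C y)%E.
  by move=> c0 y _; rewrite mule_ge0.
have -> : (\int[mu]_y \int[P]_w H1 (w, y) = \int[mu]_(y in `[0%R, T])
    (((la `^ a)%:E * mean_occupation P B N y + (la `^ a')%:E * mean_occupation P B V y) + (la `^ b)%:E))%E.
  rewrite [RHS]integral_mkcond; apply: eq_integral => y _; rewrite epatch_indic muleC.
  have mNy : measurable_fun setT (fun w : Omega => (\1_N (bpos B y w))%:E : \bar R).
    exact: (measurableT_comp (measurable_indic_bpos hB mN) (measurable_pair2 y)).
  have mVy : measurable_fun setT (fun w : Omega => (\1_V (bpos B y w))%:E : \bar R).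
    exact: (measurableT_comp (measurable_indic_bpos hB mV) (measurable_pair2 y)).
  have i0 (C : set R) (w : Omega) : [set: Omega] w -> (0 <= (\1_C (bpos B y w))%:E :> \bar R)%E by rewrite lee_fin.
  have mgy : measurable_fun setT (fun w : Omega => (g (w, y))%:E).
    by apply/measurable_EFinP; exact: (measurableT_comp mg (measurable_pair2 y)).
  have gy0 (w : Omega) : [set: Omega] w -> (0 <= (g (w, y))%:E)%E by rewrite lee_fin.
  have k0 : 0 <= \1_(`[0, T]%classic) y :> R by [].
  transitivity ((\1_(`[0, T]%classic) y)%:E * \int[P]_w (g (w, y))%:E)%E.
    rewrite -(@ge0_integralZl_EFin _ Omega R P setT measurableT _ gy0 mgy _ k0).
    by apply: eq_integral => w _; rewrite -EFinM.
  congr (_ * _)%E; rewrite /mean_occupation.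
  rewrite -(@ge0_integralZl_EFin _ Omega R P setT measurableT _ (i0 N) mNy _ pa).
  rewrite -(@ge0_integralZl_EFin _ Omega R P setT measurableT _ (i0 V) mVy _ pa').
  have mN' : measurable_fun setT (fun w : Omega => (la `^ a)%:E * (\1_N (bpos B y w))%:E : \bar R)%E.
    by apply: emeasurable_funM => //; exact: measurable_cst.
  have mV' : measurable_fun setT (fun w : Omega => (la `^ a')%:E * (\1_V (bpos B y w))%:E : \bar R)%E.
    by apply: emeasurable_funM => //; exact: measurable_cst.
  have N0 (w : Omega) : [set: Omega] w -> (0 <= (la `^ a)%:E * (\1_N (bpos B y w))%:E)%E.
    by rewrite mule_ge0// lee_fin.
  have V0 (w : Omega) : [set: Omega] w -> (0 <= (la `^ a')%:E * (\1_V (bpos B y w))%:E)%E.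
    by rewrite mule_ge0// lee_fin.
  rewrite -(@ge0_integralD _ Omega R P setT measurableT _ _ N0 mN' V0 mV').
  have -> : (la `^ b)%:E = (\int[P]_w (la `^ b)%:E)%E.
    rewrite (integral_cst P measurableT (la `^ b)%:E) -[LHS]mule1; congr (_ * _)%E.
    exact/esym/probability_setT.
  have NV0 (w : Omega) : [set: Omega] w ->
      (0 <= (la `^ a)%:E * (\1_N (bpos B y w))%:E + (la `^ a')%:E * (\1_V (bpos B y w))%:E)%E.
    by move=> _; rewrite adde_ge0// mule_ge0// lee_fin.
  rewrite -(@ge0_integralD _ Omega R P setT measurableT _ _ NV0 (emeasurable_funD mN' mV') (fun _ _ => pb) (measurable_cst _)).
  by apply: eq_integral => w _; rewrite /g /= !EFinD !EFinM.
have NVy0 (y : M) : (`[0, T]%classic : set M) y ->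
    (0 <= (la `^ a)%:E * mean_occupation P B N y + (la `^ a')%:E * mean_occupation P B V y)%E.
  by move=> _; rewrite adde_ge0// mule_ge0// lee_fin.
rewrite (@ge0_integralD _ M R mu _ mI _ _ NVy0 (emeasurable_funD (mc N _ mN) (mc V _ mV)) (fun _ _ => pb) (measurable_cst _)).
rewrite (@ge0_integralD _ M R mu _ mI _ _ (c0 N _ pa) (mc N _ mN) (c0 V _ pa') (mc V _ mV)).
rewrite (@ge0_integralZl_EFin _ M R mu _ mI _ (fun y _ => o0 N y) (mo N mN) _ pa).
rewrite (@ge0_integralZl_EFin _ M R mu _ mI _ (fun y _ => o0 V y) (mo V mV) _ pa').
have muI : mu `[0, T]%classic = T%:E.
  rewrite lebesgue_measure_itv/= lte_fin; have [_|T00] := ltP 0 T; first by rewrite sube0.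
  by have -> : T = 0 by apply/eqP; rewrite eq_le T0 T00.
rewrite (@integral_cst _ M R mu _ mI) [X in ((la `^ b)%:E * X)%E]muI.
rewrite -EFinM EFinD; apply: leeD => //.
rewrite mulrDl EFinD; apply: leeD.
  by rewrite -mulrA EFinM [(n * _)%R]mulrC; apply: lee_wpmul2l; rewrite ?lee_fin.
by rewrite -mulrA EFinM [(v * _)%R]mulrC; apply: lee_wpmul2l; rewrite ?lee_fin.
Qed.

(** Here [first_passage] is taken without the correction on bounded paths, and is 0 if level [t] is
    never exceeded. For [y >= 0], [y < first_passage] thus means that the level is exceeded at some
    integer time, but not yet slightly after [y]. *)
Lemma measurable_first_passage t : measurable_fun setT (first_passage sigma t).
Proof.
apply: (measurability (@RGenOInfty.G R)); first exact: RGenOInfty.measurableE.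
move=> _ [_ [y ->] <-]; rewrite setTI.
have pos w : 0 <= first_passage sigma t w.
  rewrite /first_passage; have [->|/set0P S0] := eqVneq [set s | 0 <= s /\ t < sigma s w] set0.
    by rewrite inf0.
  by apply: lb_le_inf => // s [].
have msy (u : R) (b1 b2 : itv_bound R) : 0 <= u ->
    measurable [set w | sigma u w \in Interval b1 b2].
  move=> u0; have := sg_measurable hS u0 measurableT (measurable_itv (Interval b1 b2)).
  by rewrite setTI.
have [y0|y0] := leP 0 y; last first.
  rewrite (_ : _ @^-1` _ = setT)//; apply/seteqP; split => // w _ /=.
  by rewrite in_itv/= andbT (lt_le_trans y0).
rewrite (_ : _ @^-1` _ = (\bigcup_n [set w | sigma n%:R w \in `]t, +oo[]) `&`
    \bigcup_n [set w | sigma (y + n.+1%:R^-1) w \in `]-oo, t]]).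
  apply: measurableI; apply: bigcup_measurable => n _; apply: msy => //.
  by rewrite addr_ge0.
apply/seteqP; split => w /=; rewrite in_itv/= andbT.
  move=> yL; split.
    have [S0|/set0P [s [s0 ts]]] := eqVneq [set s | 0 <= s /\ t < sigma s w] set0.
      by move: yL; rewrite /first_passage S0 inf0 ltNge y0.
    exists (Num.truncn s).+1 => //=; rewrite in_itv/= andbT (lt_le_trans ts)//.
    by apply: (sigma_nondecreasing hS) => //; rewrite ltW// truncnS_gt.
  have d0 : 0 < first_passage sigma t w - y by rewrite subr_gt0.
  exists (Num.truncn (first_passage sigma t w - y)^-1) => //=.
  set n := Num.truncn _; have hn : y + n.+1%:R^-1 < first_passage sigma t w.
    by rewrite -ltrBrDl invf_plt ?posrE// truncnS_gt.
  rewrite in_itv/= leNgt; apply/negP => tn; move: hn; rewrite ltNge => /negP; apply.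
  by apply: ge_inf; [exists 0 => s []|split => //; rewrite addr_ge0].
move=> [[n _ /= hn] [k _ /= hk]]; move: hn hk; rewrite !in_itv/= andbT => hn hk.
apply: (@lt_le_trans _ _ (y + k.+1%:R^-1)); first by rewrite ltrDl.
apply: lb_le_inf; first by exists n%:R.
move=> s [s0 ts]; rewrite leNgt; apply/negP => sy.
have := lt_le_trans ts (le_trans (sigma_nondecreasing hS w s0 (ltW sy)) hk).
by rewrite ltxx.
Qed.

Lemma measurable_time_changed t : measurable_fun setT (time_changed B sigma t).
Proof.
have m := measurable_bpos hB (measurable_idOB hB) (measurable_first_passage t).
apply: eq_measurable_fun m => w _; rewrite /bpos /time_changed max_r//.
have [S0|/set0P S0] := eqVneq [set s | 0 <= s /\ t < sigma s w] set0.
  by rewrite /first_passage S0 inf0.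
by apply: lb_le_inf => // s [].
Qed.

End final_bounds.

(** * Choice of the constants and conclusion *)

Lemma powR_inv_small (R : realType) (p e : R) : 0 < p -> 0 < e ->
  exists t0, forall t, t0 <= t -> 0 < t /\ t^-1 `^ p <= e.
Proof.
move=> p0 e0; exists (e `^ p^-1)^-1 => t ht.
have x0 : 0 < e `^ p^-1 by exact: powR_gt0.
have t0 : 0 < t by apply: lt_le_trans ht; rewrite invr_gt0.
split => //; have -> : e = (e `^ p^-1) `^ p by rewrite -powRrM mulVf ?gt_eqF// powRr1// ltW.
apply: ge0_ler_powR; rewrite ?nnegrE ?invr_ge0 ?powR_ge0 ?(ltW p0) ?(ltW t0)//.
by rewrite invf_ple ?posrE.
Qed.

(** The neighbourhoods of radius [1 / (n + 1)] of the complement meet [A] in sets that decrease to a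
    part of the boundary of [A]; as [A] has finite measure, their measures decrease to 0. *)
Lemma open_complement_neighbourhood (R : realType) (A : set R) (e : R) :
  measurable A -> (lebesgue_measure A < +oo)%E -> lebesgue_measure (boundary A) = 0%E -> 0 < e ->
  exists O : set R, [/\ open O, ~` A `<=` O & (lebesgue_measure (O `&` A) <= e%:E)%E].
Proof.
move=> mA Aoo A0 e0; pose mu := @lebesgue_measure R.
pose O n := \bigcup_(y in ~` A) ball y (n.+1%:R^-1 : R).
have oO n : open (O n) by apply: bigcup_open => y _; apply: ball_open; rewrite invr_gt0.
have OA n : ~` A `<=` O n by move=> y Ay; exists y => //; apply: ballxx; rewrite invr_gt0.
have mO n : measurable (O n `&` A) by apply: measurableI => //; exact: open_measurable.
have Odec i j : (i <= j)%N -> O j `<=` O i.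
  move=> ij x [y Ay yx]; exists y => //; apply: le_ball yx.
  by rewrite lef_pV2 ?posrE// ler_nat.
have cvg : mu (O n `&` A) @[n --> \oo] --> mu (\bigcap_n (O n `&` A)).
  apply: nonincreasing_cvg_mu => //.
  - by apply: le_lt_trans Aoo; apply: le_measure; rewrite ?inE; [exact: mO|exact: mA|exact: subIsetr].
  - exact: bigcapT_measurable.
  - by move=> i j ij; apply/subsetPset; apply: setSI; exact: Odec.
have sub : \bigcap_n (O n `&` A) `<=` boundary A.
  move=> x hx; split; first by apply: subset_closure; have [] := hx 0%N I.
  move=> /nbhs_ballP [r /= r0 hr].
  have [[y Ay yx] _] := hx (Num.truncn r^-1) I.
  apply: Ay; apply: hr; apply: ball_sym; apply: le_ball yx.
  by rewrite invf_ple ?posrE//; apply: ltW; exact: truncnS_gt.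
have mb : measurable (boundary A).
  apply: measurableD; first exact: closed_measurable (@closed_closure _ _).
  exact: open_measurable (@open_interior _ _).
have z : mu (\bigcap_n (O n `&` A)) = 0%E.
  apply/eqP; rewrite eq_le measure_ge0 andbT -A0; apply: le_measure; rewrite ?inE; [|exact: mb|exact: sub].
  exact: bigcapT_measurable.
move: cvg; rewrite z => /fine_cvgP[fin /cvgrPdist_lt /(_ e e0) small].
near \oo => N; exists (O N); split => //.
have fN : mu (O N `&` A) \is a fin_num by near: N.
have sN : `|0 - fine (mu (O N `&` A))| < e by near: N.
have -> : lebesgue_measure (O N `&` A) = (fine (mu (O N `&` A)))%:E by rewrite fineK.
by rewrite lee_fin; apply: le_trans (ltW sN); rewrite sub0r normrN ler_norm.
Unshelve. all: by end_near. Qed.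

(** The left-hand side is [(1 + (1 - rho) x + rho z) / (1 + x)], and each of the three terms of the
    numerator is at most [eta (1 + x)]. *)
Lemma mass_ratio_le (R : realFieldType) (rho x z eta : R) : 0 <= rho <= 1 -> 0 <= x -> 0 <= z ->
  1 - rho <= eta -> 1 <= eta * (1 + x) -> z <= eta ->
  1 - rho * (x - z) / (1 + x) <= 3 * eta.
Proof.
move=> /andP[r0 r1] x0 z0 h1 h2 h3; have x1 : 0 < 1 + x by lra.
rewrite lerBlDr -lerBlDl ler_pdivlMr//.
have e1 : rho * z <= eta by apply: le_trans h3; rewrite ler_piMl.
have e2 : (1 - rho) * x <= eta * x by rewrite ler_wpM2r.
by nra.
Qed.

Section occupation_small.
Context {R : realType} {d : measure_display} {Omega : measurableType d}.
Variables (P : probability Omega R) (alpha : R -> R) (B sigma : R -> Omega -> R).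
Hypotheses (malpha : measurable_fun setT alpha) (alpha01 : forall x, 0 < alpha x < 1).
Hypotheses (hB : is_brownian_motion P B)
  (hS : is_variable_order_subordinator P alpha B sigma).
Notation mu := (@lebesgue_measure R).

(** The error budget is one [eta] for each of the three terms before the cut, and three for
    [E e^(-Phi_T)]. The order of the choices matters: [k] and [S] come first, then [O], whose
    overlap with [A] must be small compared with [1 / k], and the range of [t] last. *)
Lemma occupation_laplace_small (A : set R) (a b beta m D L eta : R) :
  measurable A -> mu A = m%:E -> 0 < m -> mu (boundary A) = 0%E ->
  (forall x, A x -> alpha x = a) -> (forall x, A x -> `|x| <= D) ->
  0 < a -> 0 < beta -> 2 * a < b -> 0 < L ->
  (forall x, ~ A x -> a + beta <= alpha x) -> (forall x, L < `|x| -> b <= alpha x) ->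
  0 < eta ->
  exists O : set R, [/\ open O, ~` A `<=` O & exists t0, forall t, t0 <= t ->
    0 < t /\ (occupation_laplace P alpha B O t^-1 <= (6 * eta)%:E)%E].
Proof.
move=> mA muA m0 bA alphaA AD a0 beta0 ab L0 offA offL eta0.
(* The cut is made at the time [T = (k / la ^ a)^2]. *)
have [c [c0 cE]] : exists c : R, 0 < c /\ forall T, peak_time T = c * Num.sqrt T.
  exists ((Num.sqrt (pi *+ 2))^-1 * 2); split; last by move=> T; rewrite /peak_time mulrA.
  by apply: mulr_gt0 => //; rewrite invr_gt0 sqrtr_gt0 pmulrn_lgt0// pi_gt0.
(* Ensures [1 / (1 + x) <= eta] for [x = c k m], the ratio of the bound [peak_time T] times [m] on
   the mean time in [A] to [la^(-a)]. *)
have [k [k0 kE]] : exists k, 0 < k /\ eta * (c * k * m) = 1.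
  exists (eta * c * m)^-1; split; first by rewrite invr_gt0; apply: mulr_gt0 => //; exact: mulr_gt0.
  by field; rewrite !gt_eqF.
(* The Gaussian loss factor [rho] below is then at least [1 - eta]; the [+ 1] in the witness keeps
   [S] positive when [D = 0]. *)
have [S [S0 DS]] : exists S, 0 < S /\ D ^+ 2 / (S *+ 2) <= eta.
  have S0 : 0 < D ^+ 2 / (2 * eta) + 1.
    by rewrite ltr_wpDl// divr_ge0 ?sqr_ge0// mulr_ge0// ltW.
  exists (D ^+ 2 / (2 * eta) + 1); split=> //.
  rewrite ler_pdivrMr ?pmulrn_lgt0//.
  have -> : eta * ((D ^+ 2 / (2 * eta) + 1) *+ 2) = D ^+ 2 + eta * 2 by field; rewrite gt_eqF.
  by rewrite lerDl mulr_ge0// ltW.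
have ck0 : 0 < c * k by exact: mulr_gt0.
have Aoo : (mu A < +oo)%E by rewrite muA ltry.
(* [peak_time T] will be [c k / la^a], so that an overlap of measure at most [eta / (c k)]
   contributes at most [eta]. *)
have [|O [oO AO muO]] := open_complement_neighbourhood mA Aoo bA (e := eta / (c * k)).
  by rewrite divr_gt0.
have mO : measurable O by exact: open_measurable.
exists O; split => //.
have mN : measurable (O `&` A) by exact: measurableI.
have Nfin : mu (O `&` A) \is a fin_num.
  by rewrite ge0_fin_numE ?measure_ge0//; exact: le_lt_trans muO (ltry _).
pose n := fine (mu (O `&` A)).
have nE : mu (O `&` A) = n%:E by rewrite fineK.
have n0 : 0 <= n by rewrite fine_ge0.
have nle : n <= eta / (c * k) by rewrite -lee_fin -nE.
pose V : set R := `[- L, L]%classic.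
have mV : measurable V by exact: measurable_itv.
have [v [v0 vE]] : exists v : R, 0 < v /\ mu V = v%:E.
  exists (L + L); split; first exact: addr_gt0.
  rewrite /V lebesgue_measure_itv/= lte_fin; have -> : - L < L by lra.
  by rewrite -EFinB opprK.
have pS0 := peak_time_ge0 S.
(* Four thresholds, in this order: the gap [beta] off [A], the surplus of [b] over [2 a] far away,
   the time before [S] lost in the lower occupation bound, and [S <= T]. *)
have [t1 h1] := powR_inv_small (p := beta) beta0 (e := eta / (c * k * v)) ltac:(by rewrite divr_gt0// mulr_gt0).
have bp : 0 < b - 2 * a by rewrite subr_gt0.
have [t2 h2] := powR_inv_small bp (e := eta / k ^+ 2) ltac:(by rewrite divr_gt0// exprn_gt0).
have [t3 h3] := powR_inv_small a0 (e := eta / (peak_time S * m + 1))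
  ltac:(by rewrite divr_gt0// ltr_wpDl// mulr_ge0// ltW).
have [t4 h4] := powR_inv_small a0 (e := k / Num.sqrt S) ltac:(by rewrite divr_gt0// sqrtr_gt0).
exists (Num.max 1 (Num.max (Num.max t1 t2) (Num.max t3 t4))) => t.
rewrite !ge_max => /andP[t1' /andP[/andP[/h1 [t0 g1] /h2 [_ g2]] /andP[/h3 [_ g3] /h4 [_ g4]]]].
split => //; set la := t^-1 in g1 g2 g3 g4 *.
have la0 : 0 < la by rewrite invr_gt0.
have la1 : la <= 1 by rewrite invf_le1.
have powR_dec r s : r <= s -> la `^ s <= la `^ r by apply: ger_powR; rewrite la0.
have [y [y0 yE]] : exists y, 0 < y /\ la `^ a = y by exists (la `^ a); split => //; exact: powR_gt0.
rewrite yE in g3 g4.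
have [T [T0 TE sT]] : exists T, [/\ 0 <= T, T = (k / y) ^+ 2 & Num.sqrt T = k / y].
  exists ((k / y) ^+ 2); split => //; first exact: sqr_ge0.
  by rewrite sqrtr_sqr ger0_norm// divr_ge0// ltW.
have ST : S <= T.
  rewrite -(@ler_sqrt _ S T)// sT ler_pdivlMr// -ler_pdivlMl ?sqrtr_gt0//.
  by rewrite mulrC.
have pT : peak_time T = c * k / y by rewrite cE sT mulrA.
(* Three regions: [A], the part of the interval [V] off [A], and the complement of [V]. As
   [la <= 1], a larger order means a smaller rate. *)
have hO x : O x -> la `^ alpha x <= la `^ a * \1_(O `&` A) x + la `^ (a + beta) * \1_V x + la `^ b.
  move=> Ox; have q0 r : 0 <= la `^ r by exact: powR_ge0.
  have i0 (C : set R) : 0 <= \1_C x :> R by [].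
  have [Ax|nAx] := pselect (A x).
    rewrite (alphaA x Ax) [\1_(O `&` A) x]indicE mem_set// mulr1 -addrA lerDl.
    by rewrite addr_ge0// mulr_ge0.
  have [xL|xL] := leP `|x| L.
    rewrite [\1_V x]indicE mem_set/=; last by rewrite /V/= in_itv/= -ler_norml.
    rewrite mulr1 -[leLHS]addr0 lerD// -[leLHS]add0r lerD ?mulr_ge0//.
    exact/powR_dec/offA.
  rewrite -[leLHS]add0r lerD ?addr_ge0 ?mulr_ge0//.
  exact/powR_dec/offL.
apply: le_trans (occupation_laplace_le malpha alpha01 hB mO mN mV la0 T0 hO nE vE) _.
pose rho := expR (- (D ^+ 2 / (S *+ 2))).
have occ := occupation_time_lower hB S0 ST mA AD.
rewrite muA -EFinM -/rho in occ.
have mass := exponent_mass_le malpha alpha01 hB hS mA alphaA la0 T0 muA occ.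
apply: le_trans (leeD2l _ mass) _.
rewrite -EFinD lee_fin.
have laN : la `^ (- a) = y^-1 by rewrite powRN yE.
have e1 : la `^ a * n * peak_time T <= eta.
  rewrite pT yE; have -> : y * n * (c * k / y) = n * (c * k) by field; rewrite gt_eqF.
  by rewrite -ler_pdivlMr.
have e2 : la `^ (a + beta) * v * peak_time T <= eta.
  rewrite powRD ?(gt_eqF la0) ?implybT// pT yE.
  have -> : y * la `^ beta * v * (c * k / y) = la `^ beta * (c * k * v) by field; rewrite gt_eqF.
  by rewrite -ler_pdivlMr// mulr_gt0.
(* [la^b T = k^2 la^(b - 2 a)]: this is where [2 a < b] enters. *)
have e3 : la `^ b * T <= eta.
  have -> : la `^ b = la `^ (b - 2 * a) * y ^+ 2.
    rewrite -yE -powR_mulrn ?powR_ge0// -powRrM -powRD ?(gt_eqF la0) ?implybT//.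
    by congr (_ `^ _); ring.
  have -> : la `^ (b - 2 * a) * y ^+ 2 * T = la `^ (b - 2 * a) * k ^+ 2 by rewrite TE; field; rewrite gt_eqF.
  by rewrite -ler_pdivlMr// exprn_gt0.
pose z := y * peak_time S * m.
have z0 : 0 <= z by rewrite /z; apply: mulr_ge0; [apply: mulr_ge0 => //; exact: ltW|exact: ltW].
have e4 : 1 - rho * (peak_time T - peak_time S) * m / (la `^ (- a) + peak_time T * m) <= 3 * eta.
  have x0 : 0 <= c * k * m by apply/ltW/mulr_gt0.
  (* Numerator and denominator are multiplied by [y = la^a], which brings the quotient into the form
     of [mass_ratio_le]. *)
  have -> : rho * (peak_time T - peak_time S) * m / (la `^ (- a) + peak_time T * m) =
      rho * (c * k * m - z) / (1 + c * k * m).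
    rewrite laN pT /z; have x1 : 1 + c * k * m != 0 by rewrite gt_eqF// ltr_wpDr.
    have y1 : y^-1 + c * k / y * m = (1 + c * k * m) / y by field; rewrite gt_eqF.
    by rewrite y1; field; rewrite x1 gt_eqF.
  apply: mass_ratio_le => //.
  - by rewrite expR_ge0 -expR0 ler_expR oppr_le0 divr_ge0 ?sqr_ge0// mulrn_wge0// ltW.
  - have : 1 + - (D ^+ 2 / (S *+ 2)) <= rho by exact: expR_ge1Dx.
    by move: DS; lra.
  - have -> : eta * (1 + c * k * m) = eta + 1.
      by rewrite mulrDr mulr1 kE.
    by rewrite lerDr ltW.
  - rewrite /z -mulrA; apply: (@le_trans _ _ (y * (peak_time S * m + 1))).
      by rewrite ler_wpM2l ?(ltW y0)// lerDl.
    by rewrite -ler_pdivlMr//; rewrite ltr_wpDl// mulr_ge0// ltW.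
rewrite mulrDl; move: e1 e2 e3 e4; lra.
Qed.

End occupation_small.

Theorem theorem4p13 (R : realType)
    (d : measure_display) (Omega : measurableType d) (P : probability Omega R)
    (alpha : R -> R) (alpha_min alpha_max alpha_I alpha_J : R)
    (A0 : set R)
    (I : nat -> set R) (B sigma : R -> Omega -> R) :
  measurable_fun setT alpha ->
  (forall x, 0 < alpha x < 1) ->
  is_min_of alpha alpha_min -> 0 < alpha_min ->
  is_max_of alpha alpha_max -> alpha_max < 1 ->
  A0 = [set x | alpha x = alpha_min] -> bounded_set A0 ->
  (forall i, is_interval (I i)) -> trivIset setT I -> A0 = \bigcup_i I i ->
  (0 < lebesgue_measure A0 < +oo)%E ->
  lebesgue_measure (boundary A0) = 0%E ->
  (\forall beta \near 0^'+, A0 = [set x | alpha x < alpha_min + beta]) ->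
  alpha x @[x --> +oo] --> alpha_I -> alpha_I < 1 ->
  alpha x @[x --> -oo] --> alpha_J -> alpha_J < 1 ->
  2 * alpha_min < Num.min alpha_I alpha_J ->
  is_brownian_motion P B ->
  is_variable_order_subordinator P alpha B sigma ->
  P [set w | time_changed B sigma t w \in A0] @[t --> +oo] --> 1%E.
Proof.
move=> malpha alpha01 _ amin0 [_ amaxle] amax1 A0E A0b _ _ _ /andP[A0pos A0oo] bA
  near_beta cvI _ cvJ _ hIJ hB hS.
have mA0 : measurable A0.
  have := malpha measurableT [set alpha_min] (measurable_set1 _).
  by rewrite setTI A0E.
have [m [m0 muA]] : exists m, 0 < m /\ lebesgue_measure A0 = m%:E.
  exists (fine (lebesgue_measure A0)); split; first by rewrite fine_gt0// A0pos.
  by rewrite fineK// ge0_fin_numE// ltW.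
(* A single admissible [beta] suffices: it is a gap between the minimum and the values of [alpha]
   off [A0]. *)
have [beta [beta0 betaE]] : exists beta, 0 < beta /\ A0 = [set x | alpha x < alpha_min + beta].
  near (0 : R)^'+ => beta; exists beta; split; last by near: beta; exact: near_beta.
  by near: beta; exact: nbhs_right_gt.
have offA x : ~ A0 x -> alpha_min + beta <= alpha x.
  by move=> A0x; rewrite leNgt; apply/negP => h; apply: A0x; rewrite betaE.
have onA x : A0 x -> alpha x = alpha_min by rewrite A0E.
(* The midpoint leaves room on both sides: [alpha] exceeds [b] near both infinities, and [b] still
   exceeds [2 alpha_min]. *)
have [b [ab bI bJ]] : exists b, [/\ 2 * alpha_min < b, b < alpha_I & b < alpha_J].
  have [h1 h2] := midf_lt hIJ; move: h2; rewrite lt_min => /andP[h2 h3].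
  by exists ((2 * alpha_min + Num.min alpha_I alpha_J) / 2).
have [M1 [_ hM1]] := cvgr_gt _ cvI _ bI.
have [M2 [_ hM2]] := cvgr_gt _ cvJ _ bJ.
have [D1 [_ hD1]] := A0b.
have AD x : A0 x -> `|x| <= D1 + 1 by move=> A0x; apply: (hD1 (D1 + 1)) => //; rewrite ltrDl.
(* The 1 makes [L] positive; the other two bounds place the points with [L < |x|] in the ranges
   where the limits take effect. *)
pose L := Num.max 1 (Num.max M1 (- M2)).
have L0 : 0 < L by rewrite lt_max ltr01.
have offL x : L < `|x| -> b <= alpha x.
  rewrite /L !gt_max => /andP[_ /andP[x1 x2]]; apply: ltW.
  have [x0|x0] := leP 0 x; first by apply: hM1; rewrite ger0_norm in x1.
  by apply: hM2; rewrite ltr0_norm// ltrNl opprK in x2.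
pose n := (Num.truncn (alpha_max / (1 - alpha_max))).+1.
have hn : alpha_max <= n%:R * (1 - alpha_max).
  by rewrite -ler_pdivrMr ?subr_gt0// ltW// truncnS_gt.
pose E t := [set w | time_changed B sigma t w \in A0].
have mE t : measurable (E t).
  have := measurable_time_changed hB hS t measurableT mA0; rewrite setTI.
  congr measurable; apply/seteqP; split => w; first by move=> h; exact/mem_set.
  by move=> /set_mem.
have small e : 0 < e -> exists t0, forall t, t0 <= t -> (P (~` E t) <= e%:E)%E.
  move=> e0; pose C : R := 2 ^+ n * expR 3.
  have C0 : 0 < C by rewrite /C mulr_gt0 ?exprn_gt0 ?expR_gt0.
  (* Compensates the Tauberian constant [C] and the factor 6 of [occupation_laplace_small]. *)
  have eta0 : 0 < e / (6 * C) by rewrite divr_gt0// mulr_gt0.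
  have [U [oU AU [t0 ht0]]] := occupation_laplace_small malpha alpha01 hB hS mA0 muA m0 bA
    onA AD amin0 beta0 ab L0 offA offL eta0.
  have mO : measurable U by exact: open_measurable.
  exists t0 => t /ht0[tpos hJ].
  have := passage_probability_le malpha alpha01 hB hS mO amaxle amax1 hn oU tpos.
  rewrite (passage_probabilityE hB hS mO) => hP.
  have mX := measurable_time_change_preimage hB hS mO t.
  have mV := measurable_sigma_unbounded hS.
  (* Off a null set [first_passage] and [passage] agree, and a position outside [A0] lies in the
     open set [U]. *)
  apply: (@le_trans _ _ (P (~` sigma_unbounded sigma `|` [set w | U (bpos B (passage sigma t w) w)]))).
    apply: le_measure; rewrite ?inE; first exact: measurableC.
      by apply: measurableU => //; exact: measurableC.
    move=> w /negP; rewrite /E /= notin_setE => nE.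
    have [Uw|nU] := pselect (sigma_unbounded sigma w); [right|by left].
    apply: AU => /=; rewrite /bpos max_r ?passage_ge0//.
    by rewrite passageE.
  apply: (@le_trans _ _ (P (~` sigma_unbounded sigma) + P [set w | U (bpos B (passage sigma t w) w)])%E).
    by apply: measureU2 => //; exact: measurableC.
  rewrite (P_sigma_unbounded malpha alpha01 hB hS) add0e; apply: (le_trans hP).
  apply: (@le_trans _ _ (C%:E * (6 * (e / (6 * C)))%:E)%E).
    by apply: lee_wpmul2l => //; rewrite lee_fin ltW.
  rewrite -EFinM lee_fin; have -> : C * (6 * (e / (6 * C))) = e by field; rewrite gt_eqF.
  by [].
have Pfin t : P (E t) \is a fin_num by exact: fin_num_measure.
apply/fine_cvgP; split; first by near=> t; exact: Pfin.
apply/cvgrPdist_le => e e0; have [t0 ht0] := small e e0.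
near=> t; have := ht0 t; rewrite probability_setC// -(fineK (Pfin t)) -EFinB lee_fin => h.
have P1 : fine (P (E t)) <= 1.
  by rewrite -lee_fin (fineK (Pfin t)); exact: probability_le1.
rewrite ger0_norm ?subr_ge0//; apply: h; near: t; apply: nbhs_pinfty_ge; exact: num_real.
Unshelve. all: by end_near. Qed.
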